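(* Suppose that $\rho_v>0$ and $v_n=L_v(n)n^{-b}\rho_v^{-n}$ for all $n\ge 1$, for a slowly varying function $L_v$ and an exponent $b>1$. Furthermore suppose that one of the following two cases holds. (i) $\rho_v=W(\rho_w)$ and $w_n=L_w(n)n^{-a}\rho_w^{-n}$ for all $n\ge 1$, for a slowly varying function $L_w$ and an exponent $a>2$, such that either $1<b<a$, or $b=a$ and $L_w(n)=o(L_v(n))$. (ii) $\rho_v<W(\rho_w)$ and $\gcd\{n\ge 0\mid w_n>0\}=1$. Set $\alpha=\min(a-1,2)$ in case (i) and $\alpha=2$ in case (ii), and let $\mu=W(\rho_u)^{-1}\sum_{n\ge 1} n w_n\rho_u^n$. Let $X$, the independent copies $(X_i)_{i\ge1}$ of $X$, and $L$ be as defined in the context. Then there exists a sequence $(s_n)_{n\ge1}$ of positive integers with $s_n=o(n)$ (and necessarily $\frac{s_n}{L(n)n^{1/\alpha}}\to\infty$) such that $$\lim_{n\to\infty}d_{\mathrm{TV}}\Big((K_1,\dots,K_{\min(N_n,\lfloor n/\mu\rfloor-s_n)}),\,(X_1,\dots,X_{\lfloor n/\mu\rfloor-s_n})\Big)=0.\qquad(\ast)$$ In specific cases asymptotic upper bounds for $s_n$ may be made explicit: (a) If $\mathbb E[X^3]<\infty$, or if $\mathbb E[X^2]<\infty$ and $\mathbb E[X^2\mathbf 1_{X\ge n}]=O(n^{-1/3})$, then $(\ast)$ holds for any sequence $s_n=o(n)$ satisfying $s_n/n^{3/4}\to\infty$. (b) If $\mathbb E[X^2]<\infty$ and $\mathbb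 E[X^2\mathbf 1_{X\ge n}]=O(n^{-r})$ for some $0<r<1/3$, then $(\ast)$ holds for any sequence $s_n=o(n)$ satisfying $s_n/n^{\frac1{1+r}}\to\infty$.
   Context: Gibbs partitions. Let $(v_i)_{i\ge1}$, $(w_i)_{i\ge0}$ be sequences of non-negative reals, $V(x)=\sum_{i\ge1}v_ix^i$, $W(x)=\sum_{i\ge0}w_ix^i$, $U(x)=V(W(x))=\sum_{n\ge0}u_nx^n$, so that $u_n=\sum_{k\ge1}v_k\sum_{x_1+\dots+x_k=n}w_{x_1}\cdots w_{x_k}$ (sum over $x_i\in\mathbb N_0$); all $u_n$ are assumed finite. Let $\rho_u,\rho_v,\rho_w$ be the radii of convergence of $U,V,W$; values such as $W(\rho_w)\in[0,\infty]$ denote the value of the series. For $n\ge1$ with $u_n>0$, the Gibbs partition $P_n$ is the random partition of $\{1,\dots,n\}$ with $\mathbb P(P_n=P)=\frac{1}{n!\,u_n}|P|!\,v_{|P|}\prod_{Q\in P}|Q|!\,w_{|Q|}$ (empty components are allowed if $w_0>0$). $N_n$ is its number of components and $K_1,\dots,K_{N_n}$ are their sizes listed in exchangeable order; precisely $\mathbb P(N_n=k,(K_1,\dots,K_k)=(x_1,\dots,x_k))=v_kw_{x_1}\cdots w_{x_k}/u_n$ for $k\ge1$, $x_i\in\mathbb N_0$, $\sum x_i=n$. Limits are as $n\to\infty$ (along $n$ with $u_n>0$). A function $L:\mathbb R_{>0}\to\mathbb R_{>0}$ is slowly varying if $L(tx)/L(x)\to1$ as $x\to\infty$ for all $t>0$.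 Let $X$ be the random non-negative integer with $\mathbb E[z^X]=W(\rho_uz)/W(\rho_u)$, so $\mu=\mathbb E[X]$, and let $X_1,X_2,\dots$ be independent copies of $X$. Let $T(x)=\mathbb E[X^2\mathbf 1_{X\le x}]$ and $g(n)=\sqrt{\mathbb V[X]/2}$ if $\mathbb V[X]<\infty$; $g(n)=\sqrt{\tfrac12T\big(\sup\{x\ge0\mid T(x)/x^2\ge 1/n\}\big)}$ if $\mathbb V[X]=\infty$ and $\alpha=2$; $g(n)=n^{-1/\alpha}|\Gamma(1-\alpha)|^{1/\alpha}\inf\{x\ge0\mid\mathbb P(X>x)\le 1/n\}$ if $\mathbb V[X]=\infty$ and $1<\alpha<2$. Set $L(n)=\mu^{-1-1/\alpha}g(n)$. $d_{\mathrm{TV}}$ denotes the total variation distance between laws; here of random finite sequences of non-negative integers (of possibly random length).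
   Formalization: Slowly varying functions L_v and L_w are additionally required to be Borel measurable (Karamata's usual convention); without this, values at integers can oscillate wildly and the limit (∗) can fail. *)

(* Defs.v *)
From HB Require Import structures.
From mathcomp Require Export all_boot all_order all_algebra.
From mathcomp Require Export all_classical all_reals all_analysis.

Set Implicit Arguments.
Unset Strict Implicit.
Unset Printing Implicit Defensive.

Import Order.TTheory GRing.Theory Num.Theory.
Import numFieldNormedType.Exports.
Local Open Scope classical_set_scope.
Local Open Scope ring_scope.

(* The countable set of finite sequences of naturals, with all subsets
   measurable. *)
HB.instance Definition _ := isPointed.Build (seq nat) [::].
HB.instance Definition _ := @isMeasurable.Build default_measure_display
  (seq nat) discrete_measurable discrete_measurable0
  discrete_measurableC discrete_measurableU.

Section Analysis.
Context {R : realType}.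
Implicit Types (c : R^nat) (L : R -> R) (x e rho : R).

Definition conv_radius c : \bar R :=
  ereal_sup [set `|x|%:E | x in [set x : R | cvgn (pseries c x)]].

(* Value in [0, +oo] of the power series with non-negative coefficients c at
   x in [0, +oo]; at +oo the conventions are 0 * +oo = 0 and +oo ^ 0 = 1. *)
Definition psum c (x : \bar R) : \bar R :=
  (\sum_(0 <= n <oo) (c n)%:E * x ^+ n)%E.

(* Only the restriction of L to the positive reals matters. As usual for
   regular variation (Karamata), L is Borel measurable; without measurability
   the values of L at the integers are almost unconstrained. *)
Definition slowly_varying L : Prop :=
  [/\ forall x, 0 < x -> 0 < L x,
      measurable_fun (`]0, +oo[ : set R) L
    & forall t, 0 < t -> L (t * x) / L x @[x --> +oo] --> (1 : R)].

Definition regularly_decaying c L e rho : Prop :=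
  forall n, (0 < n)%N -> c n = L n%:R * n%:R `^ (- e) * rho ^- n.

(* The Gamma function on the reals that are not non-positive integers: Euler's
   integral at x + m > 0, continued to x by Gamma(y + 1) = y * Gamma(y). *)
Definition Gamma x : R :=
  let m := Num.bound x in
  fine (\int[lebesgue_measure]_(t in `]0%R, +oo[)
          (t `^ (x + m%:R - 1) * expR (- t))%:E)%E
  / \prod_(i < m) (x + i%:R).

End Analysis.

Definition is_gcd (S : set nat) (g : nat) : Prop :=
  (forall n, S n -> (g %| n)%N) /\
  (forall d, (forall n, S n -> (d %| n)%N) -> (d %| g)%N).

Section Probability.
Context {R : realType}.

Definition dTV d (T : measurableType d) (p q : set T -> \bar R) : \bar R :=
  ereal_sup [set `|p A - q A|%E | A in measurable].

Definition mutually_independent dO (Omega : measurableType dO)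
    (P : probability Omega R) (X : nat -> {RV P >-> nat}) : Prop :=
  forall (m : nat) (A : nat -> set nat),
    P (\bigcap_(i in [set i | (i < m)%N]) (X i @^-1` A i)) =
    (\prod_(i < m) P (X i @^-1` A i))%E.

End Probability.

Section Gibbs.
Context {R : realType}.
Implicit Types (v w : R^nat).

(* The value v 0 plays no role: the series V starts at index 1. Since
   x_1 + ... + x_k = n forces x_i <= n, the inner sum ranges over maps from
   'I_k to 'I_n.+1. *)
Definition gibbs_u v w (n : nat) : \bar R :=
  (\sum_(1 <= k <oo)
     (v k * \sum_(x : {ffun 'I_k -> 'I_n.+1} | (\sum_i x i)%N == n)
              \prod_i w (x i))%R%:E)%E.

Definition rho_u v w : R := fine (conv_radius (fine \o gibbs_u v w)).

Definition gibbs_mu v w : R :=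
  (fine (psum w (rho_u v w)%:E))^-1 *
  fine (\sum_(1 <= n <oo) (n%:R * w n * rho_u v w ^+ n)%:E)%E.

(* K lists the component sizes of the Gibbs partition of size n in exchangeable
   order, and size K is the number of components. These values determine the
   law of K. *)
Definition is_gibbs_sizes v w (n : nat) dO (Omega : measurableType dO)
    (P : probability Omega R) (K : {RV P >-> seq nat}) : Prop :=
  forall x : seq nat, (0 < size x)%N -> sumn x = n ->
    P (K @^-1` [set x]) =
    (v (size x) * \prod_(y <- x) w y / fine (gibbs_u v w n))%:E.

Definition has_gibbs_pgf v w dO (Omega : measurableType dO)
    (P : probability Omega R) (X : {RV P >-> nat}) : Prop :=
  forall z : R, 0 <= z <= 1 ->
    ('E_P[fun omega => (z ^+ X omega)%R] =
      (fine (psum w (rho_u v w * z)%:E) / fine (psum w (rho_u v w)%:E))%:E)%E.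

End Gibbs.

Section Scaling.
Context {R : realType} dO (Omega : measurableType dO) (P : probability Omega R).
Variable X : {RV P >-> nat}.
Implicit Types (x alpha mu : R) (n : nat).

Definition moment (k : nat) : \bar R :=
  ('E_P[fun omega => ((X omega)%:R ^+ k)%R])%E.

Definition var : \bar R :=
  variance P (fun omega => (X omega)%:R).

Definition trunc_moment2 x : R :=
  fine ('E_P[fun omega =>
    ((X omega)%:R ^+ 2 * \1_[set o | (X o)%:R <= x] omega)%R])%E.

Definition tail_moment2 n : \bar R :=
  ('E_P[fun omega =>
    ((X omega)%:R ^+ 2 * \1_[set o | (n <= X o)%N] omega)%R])%E.

Definition scale_g alpha n : R :=
  if (var < +oo)%E then Num.sqrt (fine var / 2)
  else if alpha == 2 then
    Num.sqrt (2^-1 * trunc_moment2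
      (sup [set x | 0 <= x /\ n%:R^-1 <= trunc_moment2 x / x ^+ 2]))
  else n%:R `^ (- alpha^-1) * `|Gamma (1 - alpha)| `^ alpha^-1 *
    inf [set x | 0 <= x /\
                 (P [set omega | (x < (X omega)%:R)%R] <= (n%:R^-1)%:E)%E].

Definition scale_L mu alpha n : R :=
  mu `^ (- 1 - alpha^-1) * scale_g alpha n.

End Scaling.

(* Sequences of positive integers s_1, s_2, ... with s_n = o(n); the value
   s 0 plays no role. *)
Definition pos_little_o {R : realType} (s : nat -> nat) : Prop :=
  (forall n, (0 < n)%N -> (0 < s n)%N) /\
  ((s n)%:R / n%:R @[n --> \oo] --> (0 : R)).

(* take m (K_1, ..., K_N) = (K_1, ..., K_(min(N, m))), and X i stands for
   X_(i+1). The limit is along the n with u_n > 0. For small n the truncated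
   subtraction may give m n = 0. *)
Definition gibbs_tv_limit {R : realType} (v w : R^nat)
    dO (Omega : measurableType dO) (P : probability Omega R)
    (X : nat -> {RV P >-> nat})
    (dK : nat -> measure_display) (OmegaK : forall n, measurableType (dK n))
    (PK : forall n, probability (OmegaK n) R)
    (K : forall n, {RV (PK n) >-> seq nat}) (s : nat -> nat) : Prop :=
  let m n := (Num.truncn (n%:R / gibbs_mu v w) - s n)%N in
  dTV (pushforward (PK n) (fun o => take (m n) (K n o)))
      (pushforward P (fun o => mkseq (fun i => X i o) (m n)))
    @[n --> within [set n | (0 < gibbs_u v w n)%E] \oo] --> 0%E.

(* Main.v *)
Require Import Defs.
From mathcomp Require Import all_boot all_order all_algebra.
From mathcomp Require Import all_classical all_reals all_analysis.
From mathcomp Require Import measurable_realfun ring lra zify.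

Set Implicit Arguments.
Unset Strict Implicit.
Unset Printing Implicit Defensive.

Import Order.TTheory GRing.Theory Num.Theory.
Import numFieldNormedType.Exports.
Local Open Scope classical_set_scope.
Local Open Scope ring_scope.

(** Write [p j = w_j rho^j / rho_v] for the law of [X] and
    [q k = v_k rho_v^k], where [rho] is the radius of convergence of [U], and
    let [S_k] be a sum of [k] independent copies of [X]. Then
    [u_n rho^n = sum_k q k P (S_k = n)], and the probability that the first [m]
    component sizes are [x] is the product of the [p x_i] times the ratio

      [sum_j q (m + j) P (S_j = r) / sum_k q k P (S_k = n)],

    where [r = n - sum x_i] is what the prefix leaves over. The total variation
    distance is therefore small as soon as this ratio is almost at least one
    with high probability under the law of the copies.

    The local estimate ([local_ratio]) says that the ratio is almost at least
    one when [m] is close to [n / mu] and [r] is large but [o(n)]. In the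
    numerator [q] is nearly constant on the relevant indices, and the remaining
    sum is a renewal probability, close to [1 / mu] by the theorem of Erdos,
    Feller and Pollard ([renewal_theorem]). The denominator is at most
    [(1 + o(1)) q (n / mu) / mu] ([normalisation_upper]): for [k] close to or
    beyond [n / mu] this is again the renewal theorem, and for smaller [k] the
    event [S_k = n] is a large deviation: it needs one very large summand, which
    is too rare because [p] is lighter than [q], or else its probability is
    superpolynomially small by an exponential bound. That [q] is nearly
    constant on windows rests on the uniform convergence theorem for slowly
    varying functions ([uniform_convergence]) in the form of Potter's bounds.

    By Chebyshev's inequality for truncated summands the remainder is large and
    [o(n)] if [m = n / mu - s_n] with [s_n = o(n)] and
    [n E(X^2; X < n) / s_n^2 -> 0] ([remainder_concentrates]). As
    [E(X^2; X < n) = O(n^(1 - eta))] for some [eta > 0], such sequences exist;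
    when [X] has a finite second moment, every [s_n = o(n)] with
    [s_n / sqrt n -> oo] is one, and both explicit rates are of this kind.

    Conversely, the component sizes add up to [n], so convergence in total
    variation forces [P (S_m > n) -> 0]. If [s_n] were of the order of the
    fluctuations of [S_m] along a subsequence, this probability would stay away
    from zero ([spread_of_variance], [spread_of_big_jump]). The normalising
    sequence is of that order: [sqrt n] for finite variance, the threshold of
    the truncated second moment when the variance is infinite and [alpha = 2],
    and the quantile of order [1 - 1 / n] when [alpha < 2].

    It remains to identify [rho]. In the first case it is [rho_w]. In the second
    the weight of empty components is smaller than [rho_v], since otherwise some
    [u_n] would be infinite, and [W] takes the value [rho_v] strictly inside its
    disc of convergence ([power_series_level]); [X] then has exponential moments.
    That [rho] is the radius of convergence of [U] holds because beyond it the
    generating function of [X] exceeds one and its powers outgrow [q]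
    ([conv_radius_gibbs]). *)

(* Real-valued hypotheses slow the preprocessing of [lia] down. *)
Ltac nlia :=
  repeat match goal with
  | H : ?T |- _ =>
    lazymatch T with
    | nat => fail
    | is_true (leq _ _) => fail
    | is_true (_ && _) => fail
    | @eq nat _ _ => fail
    | _ => clear H
    end
  end; lia.

(** * Iterated expectations of functions of a sum *)

Section IteratedExpectation.
Context {R : realType}.
Implicit Types (p F G : nat -> R) (M k n : nat).

(** The sum of [p x_1 * ... * p x_k * F (x_1 + ... + x_k)] over all [x_i < M]:
    the expectation of [F (S_k)] on the event that all summands stay below [M].
    Truncating at a finite [M] keeps every quantity a finite sum. *)
Fixpoint iexp p M k F : R :=
  if k is k'.+1 then
    \sum_(0 <= j < M) p j * iexp p M k' (fun t => F (j + t)%N)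
  else F 0%N.

(** [P (S_k = n)]; summands larger than [n] cannot contribute. *)
Definition conv p k n : R := iexp p n.+1 k (fun t => (t == n)%:R).

Lemma eq_iexp p M k F G : F =1 G -> iexp p M k F = iexp p M k G.
Proof.
elim: k F G => [|k IH] F G FG /=; first exact: FG.
by apply: eq_bigr => j _; congr (_ * _); apply: IH => t; exact: FG.
Qed.

Lemma iexpS p M k F : iexp p M k.+1 F =
  \sum_(0 <= j < M) p j * iexp p M k (fun t => F (j + t)%N).
Proof. by []. Qed.

Lemma iexp_cat p M k l F : iexp p M (k + l) F =
  iexp p M k (fun s => iexp p M l (fun t => F (s + t)%N)).
Proof.
elim: k F => [|k IH] F; first by rewrite add0n.
rewrite addSn !iexpS; apply: eq_bigr => j _; congr (_ * _); rewrite IH.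
by apply: eq_iexp => s; apply: eq_iexp => t; rewrite addnA.
Qed.

Lemma iexpZ p M k F (c : R) : iexp p M k (fun t => c * F t) = c * iexp p M k F.
Proof.
elim: k F => [//|k IH] F; rewrite !iexpS big_distrr/=.
by apply: eq_bigr => j _; rewrite IH mulrCA.
Qed.

Lemma iexpD p M k F G :
  iexp p M k (fun t => F t + G t) = iexp p M k F + iexp p M k G.
Proof.
elim: k F G => [//|k IH] F G; rewrite !iexpS -big_split/=.
by apply: eq_bigr => j _; rewrite IH mulrDr.
Qed.

Lemma iexp_cst p M k (c : R) :
  iexp p M k (fun=> c) = c * (\sum_(0 <= j < M) p j) ^+ k.
Proof.
elim: k => [|k IH]; first by rewrite expr0 mulr1.
by rewrite iexpS IH -mulr_suml exprS; ring.
Qed.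

Lemma iexp0 p M k : iexp p M k (fun=> 0) = 0.
Proof. by rewrite iexp_cst mul0r. Qed.

Lemma iexp_sum p M k (I : Type) (r : seq I) (F : I -> nat -> R) :
  iexp p M k (fun t => \sum_(i <- r) F i t) = \sum_(i <- r) iexp p M k (F i).
Proof.
elim: r => [|i r IH].
  rewrite big_nil -[RHS](iexp0 p M k); apply: eq_iexp => t; exact: big_nil.
rewrite big_cons -IH -iexpD; apply: eq_iexp => t; exact: big_cons.
Qed.

Lemma le_iexp p M k F G : (forall j, 0 <= p j) -> (forall t, F t <= G t) ->
  iexp p M k F <= iexp p M k G.
Proof.
move=> p0; elim: k F G => [|k IH] F G FG; first exact: FG.
rewrite !iexpS; apply: ler_sum => j _; apply: ler_wpM2l => //.
by apply: IH => t; exact: FG.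
Qed.

Lemma iexp_ge0 p M k F : (forall j, 0 <= p j) -> (forall t, 0 <= F t) ->
  0 <= iexp p M k F.
Proof. by move=> p0 F0; rewrite -(iexp0 p M k); exact: le_iexp. Qed.

Lemma iexp_exp p M k (z : R) : iexp p M k (fun t => z ^+ t) =
  (\sum_(0 <= j < M) p j * z ^+ j) ^+ k.
Proof.
elim: k => [|k IH]; first by rewrite /= expr0.
rewrite iexpS exprS -IH mulr_suml; apply: eq_bigr => j _.
rewrite -mulrA; congr (_ * _); rewrite -iexpZ; apply: eq_iexp => t.
exact: exprD.
Qed.

Lemma iexp_trunc p M k n F : (forall t, (n < t)%N -> F t = 0) -> (n < M)%N ->
  iexp p M k F = iexp p n.+1 k F.
Proof.
move=> F0 nM; elim: k F F0 => [//|k IH] F F0; rewrite !iexpS.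
rewrite (@big_cat_nat _ _ _ n.+1)//= [X in _ + X]big_nat [X in _ + X]big1 ?addr0; last first.
  move=> j /andP[nj _]; rewrite (@eq_iexp _ _ _ _ (fun=> 0)) ?iexp0 ?mulr0//.
  by move=> t; rewrite F0//; lia.
by apply: eq_bigr => j _; rewrite IH// => t nt; apply: F0; lia.
Qed.

Lemma iexp_eqn p M k n : (n < M)%N ->
  iexp p M k (fun t => (t == n)%:R) = conv p k n.
Proof.
move=> nM; apply: iexp_trunc => // t nt; rewrite (_ : (t == n) = false)//; lia.
Qed.

Lemma conv0 p n : conv p 0 n = (n == 0%N)%:R.
Proof. by rewrite /conv/= eq_sym. Qed.

Lemma convS p k n :
  conv p k.+1 n = \sum_(0 <= j < n.+1) p j * conv p k (n - j).
Proof.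
rewrite /conv iexpS big_nat [RHS]big_nat; apply: eq_bigr => j /andP[_ jn].
congr (_ * _); rewrite -[RHS](@iexp_eqn p n.+1)//; last by lia.
by apply: eq_iexp => t; congr (_%:R); congr nat_of_bool; lia.
Qed.

Lemma conv_ge0 p k n : (forall j, 0 <= p j) -> 0 <= conv p k n.
Proof. by move=> p0; apply: iexp_ge0 => // t; exact: ler0n. Qed.

Lemma iexp_conv p M k n F : (forall t, (n < t)%N -> F t = 0) -> (n < M)%N ->
  iexp p M k F = \sum_(0 <= t < n.+1) F t * conv p k t.
Proof.
move=> F0 nM.
rewrite (@eq_iexp _ _ _ _ (fun t => \sum_(0 <= i < n.+1) F i * (t == i)%:R)).
  rewrite iexp_sum big_nat [RHS]big_nat; apply: eq_bigr => i /andP[_ ni].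
  by rewrite iexpZ iexp_eqn//; lia.
move=> t; have [tn|nt] := ltnP t n.+1; last first.
  rewrite F0// big_nat big1// => i /andP[_ ni].
  by rewrite (_ : (t == i) = false) ?mulr0//; lia.
rewrite big_mkord (bigD1 (Ordinal tn))//= eqxx mulr1 big1 ?addr0// => i it.
rewrite (_ : (t == i) = false) ?mulr0//; apply: contra_neqF it => /eqP ti.
exact: val_inj.
Qed.

Lemma iexp_le_conv p M k n : (n < M)%N ->
  iexp p M k (fun t => (t <= n)%:R) = \sum_(0 <= t < n.+1) conv p k t.
Proof.
move=> nM; rewrite (@iexp_conv _ _ _ n)// => [|t nt]; last first.
  by rewrite (_ : (t <= n)%N = false)//; lia.
rewrite big_nat [RHS]big_nat; apply: eq_bigr => t /andP[_ tn].
by rewrite -ltnS tn mul1r.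
Qed.

(** Order domination on one summand passes to sums. *)
Lemma iexp_domin p p' M M' k F : (forall j, 0 <= p' j) ->
  (forall H : nat -> R, (forall t, 0 <= H t) ->
    (forall s t, (s <= t)%N -> H t <= H s) ->
    \sum_(0 <= j < M) p j * H j <= \sum_(0 <= j < M') p' j * H j) ->
  (forall j, 0 <= p j) ->
  (forall t, 0 <= F t) -> (forall s t, (s <= t)%N -> F t <= F s) ->
  iexp p M k F <= iexp p' M' k F.
Proof.
move=> p'0 dom p0; elim: k F => [//|k IH] F F0 Fdec; rewrite !iexpS.
apply: (@le_trans _ _ (\sum_(0 <= j < M') p' j * iexp p M k
    (fun t => F (j + t)%N))).
  apply: (dom (fun j => iexp p M k (fun t => F (j + t)%N))).
    by move=> t; exact: iexp_ge0.
  by move=> s t st; apply: le_iexp => // u; apply: Fdec; lia.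
apply: ler_sum => j _; apply: ler_wpM2l => //; apply: IH => // s t st.
by apply: Fdec; lia.
Qed.

Section Moments.
Variables (p : nat -> R) (M : nat) (m v : R).
Hypothesis p1 : \sum_(0 <= j < M) p j = 1.
Hypothesis pm : \sum_(0 <= j < M) p j * j%:R = m.
Hypothesis pv : \sum_(0 <= j < M) p j * (j%:R - m) ^+ 2 = v.

Let centered : \sum_(0 <= j < M) p j * (j%:R - m) = 0.
Proof.
under eq_bigr do rewrite mulrBr.
by rewrite sumrB pm -mulr_suml p1 mul1r subrr.
Qed.

Lemma iexp_sqr k (c : R) :
  iexp p M k (fun t => (c + t%:R - k%:R * m) ^+ 2) = c ^+ 2 + k%:R * v.
Proof.
elim: k c => [|k IH] c; first by rewrite /= mul0r subr0 addr0 mul0r addr0.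
rewrite iexpS (eq_bigr (fun j => (c ^+ 2 + k%:R * v) * p j
    + (2 * c) * (p j * (j%:R - m)) + p j * (j%:R - m) ^+ 2)).
  by rewrite !big_split/= -!mulr_sumr p1 centered pv -natr1; ring.
move=> j _.
rewrite (@eq_iexp _ _ _ _ (fun t => (c + j%:R - m + t%:R - k%:R * m) ^+ 2)).
  by rewrite IH; ring.
by move=> t; rewrite natrD -natr1; ring.
Qed.

(** Together with the second moment this feeds the argument of Paley and
    Zygmund. *)
Lemma iexp_pow4 k (c x y : R) :
  \sum_(0 <= j < M) p j * (j%:R - m) ^+ 3 = x ->
  \sum_(0 <= j < M) p j * (j%:R - m) ^+ 4 = y ->
  iexp p M k (fun t => (c + t%:R - k%:R * m) ^+ 4) =
  c ^+ 4 + 6 * c ^+ 2 * k%:R * v + 4 * c * k%:R * x + k%:R * y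
  + 3 * k%:R * (k%:R - 1) * v ^+ 2.
Proof.
move=> px py; elim: k c => [|k IH] c; first by rewrite /=; ring.
rewrite iexpS (eq_bigr (fun j =>
    (c ^+ 4 + 6 * c ^+ 2 * k%:R * v + 4 * c * k%:R * x + k%:R * y
      + 3 * k%:R * (k%:R - 1) * v ^+ 2) * p j
    + (4 * c ^+ 3 + 12 * c * k%:R * v + 4 * k%:R * x) * (p j * (j%:R - m))
    + (6 * c ^+ 2 + 6 * k%:R * v) * (p j * (j%:R - m) ^+ 2)
    + (4 * c) * (p j * (j%:R - m) ^+ 3) + p j * (j%:R - m) ^+ 4)).
  by rewrite !big_split/= -!mulr_sumr p1 centered pv px py -natr1; ring.
move=> j _.
rewrite (@eq_iexp _ _ _ _ (fun t => (c + j%:R - m + t%:R - k%:R * m) ^+ 4)).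
  by rewrite IH; ring.
by move=> t; rewrite natrD -natr1; ring.
Qed.

Hypothesis p0 : forall j, 0 <= p j.

Lemma iexp1 k : iexp p M k (fun=> 1) = 1.
Proof. by rewrite iexp_cst p1 expr1n mulr1. Qed.

Lemma chebyshev_upper k (x : R) (n : nat) : 0 < x -> n%:R >= k%:R * m + x ->
  iexp p M k (fun t => (n <= t)%:R) <= k%:R * v / x ^+ 2.
Proof.
move=> x0 nx; rewrite (_ : k%:R * v = iexp p M k (fun t => (0 + t%:R - k%:R * m) ^+ 2)); last first.
  by rewrite iexp_sqr expr0n add0r.
rewrite mulrC -iexpZ; apply: le_iexp => // t; case: leqP => nt /=.
  rewrite mulrC ler_pdivlMr ?exprn_gt0// mul1r add0r ler_pXn2r ?nnegrE//.
  - have : (n%:R : R) <= t%:R by rewrite ler_nat.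
    lra.
  - exact: ltW.
  - have : (n%:R : R) <= t%:R by rewrite ler_nat.
    lra.
by rewrite mulr_ge0// ?sqr_ge0// invr_ge0 sqr_ge0.
Qed.

Lemma chebyshev_lower k (x : R) (n : nat) : 0 < x -> n%:R <= k%:R * m - x ->
  iexp p M k (fun t => (t <= n)%:R) <= k%:R * v / x ^+ 2.
Proof.
move=> x0 nx; rewrite (_ : k%:R * v = iexp p M k (fun t => (0 + t%:R - k%:R * m) ^+ 2)); last first.
  by rewrite iexp_sqr expr0n add0r.
rewrite mulrC -iexpZ; apply: le_iexp => // t; case: leqP => nt /=.
  have tn : (t%:R : R) <= n%:R by rewrite ler_nat.
  rewrite mulrC ler_pdivlMr ?exprn_gt0// mul1r add0r -[leRHS]sqrrN.
  by rewrite ler_pXn2r ?nnegrE//; lra.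
by rewrite mulr_ge0// ?sqr_ge0// invr_ge0 sqr_ge0.
Qed.

End Moments.

End IteratedExpectation.

(** * Truncation, and sums that exceed their mean *)

Section Truncation.
Context {R : realType}.
Implicit Types (F G : nat -> R) (M N k n : nat).
Variable p : nat -> R.
Hypothesis p0 : forall j, 0 <= p j.
Hypothesis p1 : forall N, \sum_(0 <= j < N) p j <= 1.

Lemma psum_tail_ge0 M : 0 <= 1 - \sum_(1 <= j < M) p j.
Proof.
rewrite subr_ge0; case: M => [|M]; first by rewrite big_geq.
by apply: le_trans (p1 M.+1); rewrite [leRHS]big_nat_recl// big_add1/= lerDr.
Qed.

(** Either all summands are below [M], or one of at most [k] summands takes a
    value [j >= M], and then the rest has to hit one prescribed place for each
    such [j]; the class of [F] covers the indicator of a point. *)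
Lemma iexp_one_jump M N k F (s : R) : (M <= N)%N ->
  (forall j, (M <= j < N)%N -> p j <= s) -> 0 <= s ->
  (forall t, 0 <= F t) ->
  (forall t, \sum_(0 <= j < N) F (j + t)%N <= 1) ->
  iexp p N k F <= iexp p M k F + k%:R * s.
Proof.
move=> MN ps s0; elim: k F => [|k IH] F F0 F1; first by rewrite mul0r addr0.
rewrite !iexpS (@big_cat_nat _ _ _ M)//= -natr1 mulrDl mul1r addrA.
apply: lerD.
  apply: (@le_trans _ _ (\sum_(0 <= j < M) p j *
      (iexp p M k (fun t => F (j + t)%N) + k%:R * s))).
    apply: ler_sum => j _; apply: ler_wpM2l => //; apply: IH => // t.
    under eq_bigr do rewrite addnCA; exact: F1.
  under [leLHS]eq_bigr do rewrite mulrDr.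
  rewrite big_split/= lerD2l -mulr_suml ler_piMl// mulr_ge0//.
apply: (@le_trans _ _ (s * \sum_(0 <= j < N)
    iexp p N k (fun t => F (j + t)%N))).
  rewrite mulr_sumr [leRHS](@big_cat_nat _ _ _ M)//= ler_wpDl//.
    by apply: sumr_ge0 => j _; rewrite mulr_ge0// iexp_ge0.
  rewrite big_nat [leRHS]big_nat; apply: ler_sum => j jM.
  by apply: ler_wpM2r; [exact: iexp_ge0|exact: ps].
rewrite -iexp_sum ler_piMr//.
apply: (@le_trans _ _ (iexp p N k (fun=> 1))); first exact: le_iexp.
by rewrite iexp_cst mul1r exprn_ile1// sumr_ge0.
Qed.

(** The law [p] with all values [>= M] replaced by [0]. *)
Definition truncp M j : R :=
  if j == 0%N then 1 - \sum_(1 <= i < M) p i else p j.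

Lemma truncp_ge0 M j : 0 <= truncp M j.
Proof. by rewrite /truncp; case: eqP => // _; exact: psum_tail_ge0. Qed.

Lemma sum_truncp M (H : nat -> R) : (0 < M)%N ->
  \sum_(0 <= j < M) truncp M j * H j =
  \sum_(0 <= j < M) p j * H j + (1 - \sum_(0 <= j < M) p j) * H 0%N.
Proof.
case: M => // M _; rewrite !big_nat_recl//= {1}/truncp eqxx big_add1/=.
have -> : \sum_(0 <= i < M) truncp M.+1 i.+1 * H i.+1 =
    \sum_(0 <= i < M) p i.+1 * H i.+1 by apply: eq_bigr.
ring.
Qed.

Lemma truncp1 M : (0 < M)%N -> \sum_(0 <= j < M) truncp M j = 1.
Proof.
move=> M0; under eq_bigr do rewrite -[truncp M _]mulr1.
rewrite (@sum_truncp M (fun=> 1))// mulr1.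
by under eq_bigr do rewrite mulr1; rewrite addrC subrK.
Qed.

Lemma truncp_mean M : (0 < M)%N -> \sum_(0 <= j < M) truncp M j * j%:R =
  \sum_(0 <= j < M) p j * j%:R.
Proof. by move=> M0; rewrite (@sum_truncp M (fun j => j%:R))// mulr0 addr0. Qed.

Lemma truncp_var M (m : R) : (0 < M)%N ->
  m = \sum_(0 <= j < M) p j * j%:R ->
  \sum_(0 <= j < M) truncp M j * (j%:R - m) ^+ 2 =
  \sum_(0 <= j < M) p j * j%:R ^+ 2 - m ^+ 2.
Proof.
move=> M0 mE.
rewrite (eq_bigr (fun j => truncp M j * j%:R ^+ 2
   - (2 * m) * (truncp M j * j%:R) + m ^+ 2 * truncp M j)); last first.
  by move=> j _; ring.
rewrite big_split/= sumrB -!mulr_sumr truncp1// truncp_mean// -mE.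
by rewrite (@sum_truncp M (fun j => j%:R ^+ 2))// expr0n/=; ring.
Qed.

(** Couple every summand with its truncation: the two sums differ only if one
    of the [k] summands is at least [M]. *)
Lemma iexp_truncp_le M k F : (0 < M)%N -> (forall t, 0 <= F t <= 1) ->
  iexp (truncp M) M k F <=
  iexp p M k F + k%:R * (1 - \sum_(0 <= j < M) p j).
Proof.
move=> M0; elim: k F => [|k IH] F F01; first by rewrite mul0r addr0.
have d0 : 0 <= 1 - \sum_(0 <= j < M) p j by rewrite subr_ge0.
rewrite !iexpS (@sum_truncp M (fun j =>
  iexp (truncp M) M k (fun t => F (j + t)%N)))//.
rewrite -natr1 [(_ + 1) * _]mulrDl mul1r addrA.
apply: lerD; last first.
  rewrite ler_piMr//.
  apply: (@le_trans _ _ (iexp (truncp M) M k (fun=> 1))).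
    apply: le_iexp; [exact: truncp_ge0|] => t.
    by have /andP[] := F01 (0 + t)%N.
  by rewrite iexp_cst truncp1// expr1n mulr1.
apply: (@le_trans _ _ (\sum_(0 <= j < M) p j *
   (iexp p M k (fun t => F (j + t)%N) + k%:R * (1 - \sum_(0 <= j < M) p j)))).
  by apply: ler_sum => j _; apply: ler_wpM2l => //; apply: IH.
under [leLHS]eq_bigr do rewrite mulrDr.
by rewrite big_split/= lerD2l -mulr_suml ler_piMl// mulr_ge0.
Qed.

(** Truncated summands are smaller, which raises nonincreasing [F]. *)
Lemma iexp_le_truncp M N k F : (0 < M)%N -> (forall t, 0 <= F t) ->
  (forall s t, (s <= t)%N -> F t <= F s) ->
  iexp p N k F <= iexp (truncp M) M k F.
Proof.
move=> M0 F0 Fdec; apply: iexp_domin => //; first exact: truncp_ge0.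
move=> H H0 Hdec; rewrite sum_truncp//.
have [NM|MN] := leqP N M.
  rewrite [in leRHS](@big_cat_nat _ _ _ N)//= -addrA lerDl addr_ge0//.
    by rewrite sumr_ge0// => j _; exact: mulr_ge0.
  by rewrite mulr_ge0// subr_ge0.
rewrite (@big_cat_nat _ _ _ M)//= ?(ltnW MN)// lerD2l.
apply: (@le_trans _ _ (\sum_(M <= j < N) p j * H 0%N)).
  by apply: ler_sum => j _; apply: ler_wpM2l => //; apply: Hdec.
rewrite -mulr_suml ler_wpM2r//.
have := p1 N; rewrite (@big_cat_nat _ _ _ M)//= ?(ltnW MN)//.
lra.
Qed.

End Truncation.

Section LowerBounds.
Context {R : realType}.
Implicit Types (p F : nat -> R) (M N k n : nat).

Section Law.
Variables (p : nat -> R) (M : nat).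
Hypothesis p0 : forall j, 0 <= p j.
Hypothesis p1 : \sum_(0 <= j < M) p j = 1.

Lemma iexp_ge_cat k l (x y : R) :
  iexp p M k (fun t => (x <= t%:R)%R%:R) * iexp p M l (fun t => (y <= t%:R)%R%:R)
  <= iexp p M (k + l) (fun t => (x + y <= t%:R)%R%:R).
Proof.
rewrite iexp_cat mulrC -iexpZ; apply: le_iexp => // s.
rewrite mulrC -iexpZ; apply: le_iexp => // t.
case: (leP x _) => xs; last by rewrite mul0r ler0n.
case: (leP y _) => yt; last by rewrite mulr0 ler0n.
have -> : x + y <= (s + t)%:R by rewrite natrD lerD.
by rewrite mul1r.
Qed.

Lemma iexp_ge_blocks i k (x : R) :
  iexp p M k (fun t => (x <= t%:R)%R%:R) ^+ i <=
  iexp p M (i * k) (fun t => (i%:R * x <= t%:R)%R%:R).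
Proof.
elim: i => [|i IH]; first by rewrite expr0 mul0n /= mul0r lexx.
rewrite exprS mulSn (_ : i.+1%:R * x = x + i%:R * x); last first.
  by rewrite -natr1 mulrDl mul1r addrC.
by apply: le_trans (iexp_ge_cat _ _ _ _); apply: ler_wpM2l => //; apply: iexp_ge0.
Qed.

Lemma iexp_ge_mono k l (x : R) : (k <= l)%N ->
  iexp p M k (fun t => (x <= t%:R)%R%:R) <= iexp p M l (fun t => (x <= t%:R)%R%:R).
Proof.
move=> kl; rewrite -(subnKC kl).
have := iexp_ge_cat k (l - k) x 0; rewrite addr0.
rewrite (@eq_iexp _ _ _ (l - k) _ (fun=> 1)); first by rewrite iexp1// mulr1.
by move=> t; rewrite ler0n.
Qed.

(** A sum with mean zero, variance one and fourth moment at most 4 exceeds 1/5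
    with probability at least 1/40: the polynomial [z + z^2/2 - z^4/40 - 1/4]
    has expectation at least [3/20], is nonpositive for [z <= 1/5] and is
    bounded by 6. *)
Lemma paley_zygmund k (m v y s x : R) :
  \sum_(0 <= j < M) p j * j%:R = m ->
  \sum_(0 <= j < M) p j * (j%:R - m) ^+ 2 = v ->
  (forall j, (j < M)%N -> (j%:R - m) ^+ 2 <= y ^+ 2) ->
  0 < s -> s ^+ 2 = k%:R * v -> y ^+ 2 <= k%:R * v ->
  x <= k%:R * m + s / 5 ->
  40^-1 <= iexp p M k (fun t => (x <= t%:R)%R%:R).
Proof.
move=> pm pv py s0 sE yv xle.
set x4 := \sum_(0 <= j < M) p j * (j%:R - m) ^+ 4.
have x4le : x4 <= y ^+ 2 * v.
  rewrite -pv mulr_sumr /x4 big_nat [leRHS]big_nat; apply: ler_sum => j /andP[_ jM].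
  rewrite [leRHS]mulrCA; apply: ler_wpM2l => //.
  by rewrite (exprM _ 2 2) expr2; apply: ler_wpM2r; [exact: sqr_ge0|exact: py].
have v0 : 0 <= v.
  by rewrite -pv; apply: sumr_ge0 => j _; rewrite mulr_ge0// sqr_ge0.
have E2 := iexp_sqr p1 pm pv k 0.
have E2' := iexp_sqr p1 pm pv k 1.
have E4 := iexp_pow4 p1 pm pv k 0 erefl (erefl : x4 = x4).
pose Z (t : nat) : R := t%:R - k%:R * m.
have e2 : iexp p M k (fun t => Z t ^+ 2) = s ^+ 2.
  rewrite sE -[RHS]add0r -[X in X + _](expr0n _ 2) -E2.
  by apply: eq_iexp => t; rewrite add0r.
have e1 : iexp p M k Z = 0.
  have := iexpD p M k (fun t => (1 + t%:R - k%:R * m) ^+ 2)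
    (fun t => (-1) * Z t ^+ 2).
  rewrite iexpZ e2 E2' -sE (@eq_iexp _ _ _ _ _ (fun t => 1 + 2 * Z t)); last first.
    by move=> t; rewrite /Z; ring.
  rewrite iexpD iexpZ iexp1// => /eqP; rewrite -subr_eq0 => /eqP; lra.
have e4 : iexp p M k (fun t => Z t ^+ 4) <= 4 * s ^+ 4.
  rewrite (@eq_iexp _ _ _ _ _ (fun t => (0 + t%:R - k%:R * m) ^+ 4)); last first.
    by move=> t; rewrite add0r.
  rewrite E4 (_ : s ^+ 4 = (k%:R * v) ^+ 2); last by rewrite -sE -exprM.
  have h1 : k%:R * x4 <= (k%:R * v) ^+ 2.
    rewrite expr2 -mulrA; apply: ler_wpM2l; first exact: ler0n.
    apply: le_trans x4le _; rewrite mulrC; apply: ler_wpM2l => //.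
  have h2 : 0 <= k%:R * v ^+ 2 by rewrite mulr_ge0// sqr_ge0.
  nra.
have s4 : 0 < s ^+ 4 by exact: exprn_gt0.
have s2 : 0 < s ^+ 2 by exact: exprn_gt0.
pose Q (t : nat) : R := s^-1 * Z t + ((2 * s ^+ 2)^-1 * Z t ^+ 2
  + (- (40 * s ^+ 4)^-1 * Z t ^+ 4 + - 4^-1)).
have EQ : 6 * 40^-1 <= iexp p M k Q.
  rewrite /Q !iexpD !iexpZ e1 e2 iexp_cst p1 expr1n mulr1 mulr0 add0r.
  have -> : (2 * s ^+ 2)^-1 * s ^+ 2 = 2^-1.
    by rewrite invfM -mulrA mulVf ?mulr1// gt_eqF.
  have : (40 * s ^+ 4)^-1 * iexp p M k (fun t => Z t ^+ 4) <= 10^-1.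
    rewrite mulrC ler_pdivrMr; last by rewrite mulr_gt0.
    apply: le_trans e4 _; lra.
  rewrite mulNr; lra.
suff : iexp p M k Q <= 6 * iexp p M k (fun t => (x <= t%:R)%R%:R) by lra.
rewrite -iexpZ; apply: le_iexp => // t.
have [z zE] : exists z, Z t = s * z by exists (Z t / s); field; rewrite gt_eqF.
have -> : Q t = z + z ^+ 2 / 2 - z ^+ 4 / 40 - 4^-1.
  by rewrite /Q zE; field; rewrite gt_eqF.
case: (leP x _) => xt.
  rewrite mulr1.
  have : 0 <= (z ^+ 2 - 12) ^+ 2 by exact: sqr_ge0.
  have : 0 <= (z - 5) ^+ 2 by exact: sqr_ge0.
  nra.
rewrite mulr0.
have z5 : z < 5^-1.
  have : s * z < s * 5^-1 by rewrite -zE /Z; lra.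
  by rewrite ltr_pM2l.
have [z0|z0] := leP 0 z.
  have : 0 <= z ^+ 4 by exact: exprn_ge0.
  nra.
have : 0 <= (z ^+ 2 - 6) ^+ 2 by exact: sqr_ge0.
have : 0 <= (z + 2) ^+ 2 by exact: sqr_ge0.
nra.
Qed.

End Law.
End LowerBounds.

(** * The first large summand *)

Section BigJump.
Context {R : realType}.
Variables (p : nat -> R) (B J : nat).
Hypothesis p0 : forall j, 0 <= p j.
Hypothesis p1 : forall N, \sum_(0 <= j < N) p j <= 1.
Hypothesis BJ : (0 < B <= J)%N.

Let a : R := \sum_(0 <= j < J) p j.
Hypothesis a0 : 0 < a.

(** The law [p] conditioned on values [< J], with values in [[B, J)] then
    replaced by [0]. *)
Definition nojump (j : nat) : R :=
  truncp (fun i => if (i < J)%N then p i / a else 0) B j.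

Let pt (i : nat) : R := if (i < J)%N then p i / a else 0.

Let a1 : a <= 1. Proof. exact: p1. Qed.

Let pt0 i : 0 <= pt i.
Proof. by rewrite /pt; case: ifP => // _; rewrite divr_ge0// ltW. Qed.

Let sum_pt (H : nat -> R) :
  \sum_(0 <= j < J) pt j * H j = a^-1 * \sum_(0 <= j < J) p j * H j.
Proof.
rewrite mulr_sumr big_nat [RHS]big_nat; apply: eq_bigr => j /andP[_ jJ].
by rewrite /pt jJ; ring.
Qed.

Let pt1 N : \sum_(0 <= j < N) pt j <= 1.
Proof.
have e : \sum_(0 <= j < J) pt j = 1.
  transitivity (\sum_(0 <= j < J) pt j * 1).
    by apply: eq_bigr => j _; rewrite mulr1.
  rewrite sum_pt; under eq_bigr do rewrite mulr1.
  by rewrite mulVf// gt_eqF.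
have [NJ|JN] := leqP N J.
  by rewrite -e [leRHS](@big_cat_nat _ _ _ N)//= lerDl sumr_ge0.
rewrite (@big_cat_nat _ _ _ J)//= ?(ltnW JN)// e big_nat big1 ?addr0// => j.
by rewrite /pt => /andP[Jj _]; rewrite ltnNge Jj.
Qed.

Lemma nojump_ge0 j : 0 <= nojump j.
Proof. exact: truncp_ge0. Qed.

Lemma nojump1 : \sum_(0 <= j < B) nojump j = 1.
Proof. by apply: truncp1 => //; case/andP: BJ. Qed.

Let sum_nojump (H : nat -> R) : (forall t, 0 <= H t) ->
  (forall s t, (s <= t)%N -> H t <= H s) -> forall N,
  \sum_(0 <= j < N) p j * H j <=
  a * \sum_(0 <= j < B) nojump j * H j + (1 - a) * H J.
Proof.
move=> H0 Hdec N.
have h1 : \sum_(0 <= j < J) p j * H j <=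
    a * \sum_(0 <= j < B) nojump j * H j.
  have /andP[B0 _] := BJ.
  have := @iexp_le_truncp R pt pt0 pt1 B J 1 H B0 H0 Hdec.
  rewrite /= => h; rewrite mulrC -ler_pdivrMr// mulrC -sum_pt.
  move: h; under eq_bigr do rewrite addn0.
  by under [leRHS]eq_bigr do rewrite addn0.
have [NJ|JN] := leqP N J.
  have h2 : 0 <= (1 - a) * H J by rewrite mulr_ge0// subr_ge0.
  apply: (@le_trans _ _ (\sum_(0 <= j < J) p j * H j)); last by lra.
  rewrite [leRHS](@big_cat_nat _ _ _ N)//= lerDl sumr_ge0// => j _.
  exact: mulr_ge0.
rewrite (@big_cat_nat _ _ _ J)//= ?(ltnW JN)//; apply: lerD => //.
apply: (@le_trans _ _ (\sum_(J <= j < N) p j * H J)).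
  rewrite big_nat [leRHS]big_nat; apply: ler_sum => j /andP[Jj _].
  by apply: ler_wpM2l => //; apply: Hdec.
rewrite -mulr_suml ler_wpM2r//.
have := p1 N; rewrite (@big_cat_nat _ _ _ J)//= ?(ltnW JN)// -/a; lra.
Qed.

Let domin N k (F : nat -> R) : (forall t, 0 <= F t) ->
  (forall s t, (s <= t)%N -> F t <= F s) ->
  iexp p N k F <= iexp nojump B k F.
Proof.
move=> F0 Fdec; apply: iexp_domin => //; first exact: nojump_ge0.
move=> H H0 Hdec; apply: le_trans (sum_nojump H0 Hdec _) _.
suff : H J <= \sum_(0 <= j < B) nojump j * H j.
  move=> hJ; rewrite -subr_ge0 in hJ; have a1' := a1; rewrite -subr_ge0 in a1'.
  have := mulr_ge0 a1' hJ; lra.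
rewrite -[leLHS]mul1r -nojump1 mulr_suml big_nat [leRHS]big_nat.
apply: ler_sum => j /andP[_ jB]; apply: ler_wpM2l; first exact: nojump_ge0.
by apply: Hdec; lia.
Qed.

(** Decompose according to the first summand that is at least [J], and then
    forget how large the summands after it are. *)
Lemma iexp_big_jump N k (F : nat -> R) : (forall t, 0 <= F t) ->
  (forall s t, (s <= t)%N -> F t <= F s) ->
  iexp p N k F <= a ^+ k * iexp nojump B k F +
    (1 - a ^+ k) * iexp nojump B k.-1 (fun t => F (J + t)%N).
Proof.
elim: k F => [|k IH] F F0 Fdec; first by rewrite /= expr0 subrr mul0r addr0 mul1r.
rewrite iexpS.
apply: le_trans (@sum_nojump (fun j => iexp p N k (fun t => F (j + t)%N)) _ _ _) _.
- by move=> t; apply: iexp_ge0.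
- by move=> s t st; apply: le_iexp => // u; apply: Fdec; lia.
have h1 : iexp p N k (fun t => F (J + t)%N) <=
    iexp nojump B k (fun t => F (J + t)%N).
  by apply: domin => // s t st; apply: Fdec; lia.
have h2 : \sum_(0 <= j < B) nojump j * iexp p N k (fun t => F (j + t)%N) <=
   a ^+ k * iexp nojump B k.+1 F +
   (1 - a ^+ k) * iexp nojump B k (fun t => F (J + t)%N).
  apply: (@le_trans _ _ (\sum_(0 <= j < B) (a ^+ k * (nojump j *
      iexp nojump B k (fun t => F (j + t)%N)) + (1 - a ^+ k) * (nojump j *
      iexp nojump B k.-1 (fun t => F (j + (J + t))%N))))).
    apply: ler_sum => j _; rewrite !(mulrCA _ (nojump j)) -mulrDr.
    apply: ler_wpM2l; first exact: nojump_ge0.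
    by apply: IH => // s t st; apply: Fdec; lia.
  rewrite big_split/= -!mulr_sumr -iexpS.
  case: k {IH h1} => [|k]; first by rewrite expr0 subrr !mul0r.
  rewrite iexpS lerD2l le_eqVlt; apply/orP; left; apply/eqP; congr (_ * _).
  rewrite [in RHS]iexpS; apply: eq_bigr => j _; congr (_ * _).
  by apply: eq_iexp => t; congr F; lia.
apply: le_trans (lerD (ler_wpM2l (ltW a0) h2) (ler_wpM2l _ h1)) _.
  by rewrite subr_ge0.
by rewrite [k.+1.-1]/= exprS le_eqVlt; apply/orP; left; apply/eqP; ring.
Qed.

Lemma nojump_mean : \sum_(0 <= j < B) nojump j * j%:R =
  a^-1 * \sum_(0 <= j < B) p j * j%:R.
Proof.
have /andP[B0 bj] := BJ; rewrite truncp_mean// mulr_sumr big_nat [RHS]big_nat.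
apply: eq_bigr => j /andP[_ jB]; rewrite (_ : (j < J)%N); last by lia.
by ring.
Qed.

Lemma nojump_var m : m = \sum_(0 <= j < B) nojump j * j%:R ->
  \sum_(0 <= j < B) nojump j * (j%:R - m) ^+ 2 <=
  a^-1 * \sum_(0 <= j < B) p j * j%:R ^+ 2.
Proof.
have /andP[B0 bj] := BJ; move=> mE; rewrite truncp_var//; last first.
  by rewrite mE truncp_mean.
apply: (@le_trans _ _ (\sum_(0 <= j < B)
   (if (j < J)%N then p j / a else 0) * j%:R ^+ 2)).
  by rewrite gerBl sqr_ge0.
rewrite mulr_sumr big_nat [leRHS]big_nat; apply: ler_sum => j /andP[_ jB].
by rewrite (_ : (j < J)%N); [rewrite mulrAC mulrC|lia].
Qed.

End BigJump.

(** * The renewal theorem *)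

Section NonnegSeries.
Context {R : realType}.
Implicit Types (u : nat -> R) (s e : R).

Lemma ler_eps (x y : R) : (forall e : R, 0 < e -> x <= y + e) -> x <= y.
Proof. by move=> h; apply/ler_addgt0Pr. Qed.

Lemma series_ge0_le u s N : (forall j, 0 <= u j) ->
  series u @ \oo --> s -> \sum_(0 <= j < N) u j <= s.
Proof.
move=> u0 us; have nd : nondecreasing_seq (series u).
  by apply/nondecreasing_seqP => n; rewrite !seriesEnat/= big_nat_recr//= lerDl.
have := nondecreasing_cvgn_le nd (cvgP _ us) N.
by rewrite (cvg_lim _ us).
Qed.

Lemma series_near u s e : series u @ \oo --> s -> 0 < e ->
  exists N, forall n, (N <= n)%N -> s - e < \sum_(0 <= j < n) u j.
Proof.
move=> us e0; have /cvgrPdist_lt/(_ e e0) := us.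
move=> [N _ NH]; exists N => n Nn; have := NH n Nn; rewrite seriesEnat/=.
by rewrite ltr_norml => /andP[_]; rewrite ltrBlDr -ltrBlDl.
Qed.

End NonnegSeries.

(** A set of naturals with greatest common divisor 1 generates all large
    naturals: the least positive difference of two generated numbers divides
    everything, hence two generated numbers are consecutive. *)
Lemma gcd1_closed_add (S G : set nat) : is_gcd S 1 -> S `<=` G -> G 0%N ->
  (forall a b, G a -> G b -> G (a + b)%N) ->
  exists k0, forall k, (k0 <= k)%N -> G k.
Proof.
move=> [_ gS] SG G0 GD.
have GM a n : G a -> G (n * a)%N.
  by move=> Ga; elim: n => [|n IH]; rewrite ?mul0n// mulSn; exact: GD.
pose D d := `[< exists a b, [/\ G a, G b & (a = b + d)%N] >].
have exD : exists d, (0 < d)%N && D d.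
  have [s [Ss s0]] : exists s, S s /\ (0 < s)%N.
    apply: contrapT => /forallNP h.
    suff : (0 %| 1)%N by [].
    apply: gS => n Sn; case: n Sn => // n Sn.
    by exfalso; apply: (h n.+1).
  exists s; rewrite s0/=; apply/asboolP; exists s, 0%N; split => //.
  exact: SG.
case: (ex_minnP exD) => d /andP[d0 /asboolP[a [b [Ga Gb abE]]]] dmin.
have dS s : S s -> (d %| s)%N.
  move=> Ss; rewrite /dvdn; apply/negPn/negP => h.
  have : (d <= s %% d)%N.
    apply: dmin; rewrite lt0n h; apply/asboolP.
    exists (s + (s %/ d) * b)%N, ((s %/ d) * a)%N; split.
    - by apply: GD; [exact: SG|exact: GM].
    - exact: GM.
    - by rewrite {1}(divn_eq s d) abE mulnDr; lia.
  by rewrite leqNgt ltn_mod d0.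
have {}d0 : d = 1%N by apply/eqP; rewrite -dvdn1; exact: gS.
exists (b * b)%N => k bk.
have [b0|b0] := posnP b.
  by rewrite -[k]muln1 (_ : 1 = a)%N; [exact: GM|lia].
have -> : k = ((k %/ b - k %% b) * b + (k %% b) * a)%N.
  have h1 : (k %% b < b)%N by rewrite ltn_mod.
  have h2 : (b <= k %/ b)%N by rewrite leq_divRL.
  rewrite {1}(divn_eq k b) abE d0 mulnBl mulnDr muln1.
  have : (k %% b * b <= k %/ b * b)%N by apply: leq_mul => //; lia.
  lia.
by apply: GD; exact: GM.
Qed.

Section Renewal.
Context {R : realType}.
Variables (p : nat -> R) (mu : R).
Hypothesis p0 : forall j, 0 <= p j.
Hypothesis p1 : series p @ \oo --> (1 : R).
Hypothesis pmu : series (fun j => p j * j%:R) @ \oo --> mu.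
Hypothesis pgcd : is_gcd [set n | 0 < p n] 1.

Lemma law_le1 N : \sum_(0 <= j < N) p j <= 1.
Proof. exact: series_ge0_le. Qed.

Lemma law_mean_le N : \sum_(0 <= j < N) p j * j%:R <= mu.
Proof. by apply: series_ge0_le => // j; rewrite mulr_ge0. Qed.

(** [P (X >= H)] *)
Definition ptail H : R := 1 - \sum_(0 <= j < H) p j.

Lemma ptail_ge0 H : 0 <= ptail H.
Proof. by rewrite subr_ge0 law_le1. Qed.

Lemma ptail_nonincr H K : (H <= K)%N -> ptail K <= ptail H.
Proof.
by move=> HK; rewrite lerB// [leRHS](@big_cat_nat _ _ _ H)//= lerDl sumr_ge0.
Qed.

Lemma ptailS H : ptail H.+1 = ptail H - p H.
Proof. by rewrite /ptail big_nat_recr//= opprD addrA. Qed.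

Lemma ptail1 : ptail 1 = 1 - p 0%N.
Proof. by rewrite /ptail big_nat1. Qed.

(** Markov's inequality on the part of the mean beyond [H]. *)
Lemma ptail_mean H :
  H%:R * ptail H <= mu - \sum_(0 <= j < H) p j * j%:R.
Proof.
apply: ler_eps => e e0.
have d0 : 0 < e / H.+1%:R by rewrite divr_gt0.
have [N Nh] := series_near p1 d0.
set n := maxn N H; have := Nh n (leq_maxl _ _) => hn.
have Hn : (H <= n)%N by exact: leq_maxr.
have h1 : H%:R * (\sum_(0 <= j < n) p j - \sum_(0 <= j < H) p j) <=
   mu - \sum_(0 <= j < H) p j * j%:R.
  have := law_mean_le n.
  rewrite !(@big_cat_nat _ _ _ H 0 n)//= addrAC subrr add0r mulr_sumr.
  suff : \sum_(H <= j < n) H%:R * p j <= \sum_(H <= j < n) p j * j%:R by lra.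
  rewrite big_nat [leRHS]big_nat; apply: ler_sum => j /andP[Hj _].
  by rewrite mulrC; apply: ler_wpM2l => //; rewrite ler_nat.
have h2 : H%:R * (1 - \sum_(0 <= j < n) p j) <= e.
  apply: (@le_trans _ _ (H%:R * (e / H.+1%:R))).
    by apply: ler_wpM2l => //; move: hn; set z := e / _; lra.
  rewrite mulrCA; apply: ler_piMr; first exact: ltW.
  by rewrite ler_pdivrMr ?ltr0Sn// mul1r ler_nat leqnSn.
rewrite /ptail; nra.
Qed.

Lemma sum_ptail H : \sum_(0 <= i < H) ptail i.+1 =
  \sum_(0 <= j < H) p j * j%:R + H%:R * ptail H.
Proof.
elim: H => [|H IH]; first by rewrite !big_geq// mul0r addr0.
by rewrite !big_nat_recr//= IH ptailS -natr1; ring.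
Qed.

Lemma sum_ptail_le H : \sum_(0 <= i < H) ptail i.+1 <= mu.
Proof. by rewrite sum_ptail; have := ptail_mean H; lra. Qed.

Lemma law_mean_gt0 : 0 < mu.
Proof.
have [j [j0 pj]] : exists j, (0 < j)%N /\ 0 < p j.
  apply: contrapT => /forallNP h.
  suff : (0 %| 1)%N by [].
  apply: pgcd.2 => -[//|n] pn; by exfalso; apply: (h n.+1).
apply: lt_le_trans (law_mean_le j.+1); rewrite big_nat_recr//=.
by apply: ltr_wpDl; rewrite ?mulr_gt0 ?ltr0n// sumr_ge0// => i _; rewrite mulr_ge0.
Qed.

Lemma law0_lt1 : p 0%N < 1.
Proof.
have [j [j0 pj]] : exists j, (0 < j)%N /\ 0 < p j.
  apply: contrapT => /forallNP h.
  suff : (0 %| 1)%N by [].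
  apply: pgcd.2 => -[//|n] pn; by exfalso; apply: (h n.+1).
have := law_le1 j.+1; rewrite big_nat_recr//= => h.
apply: lt_le_trans h; case: j j0 pj => // j _ pj.
by rewrite big_nat_recl//= -addrA ltrDl ltr_wpDl// sumr_ge0.
Qed.

(** The renewal equation solved for its value at [n], which also occurs on the
    right when [p 0 > 0]; [f] is fuel and any [f > n] gives the same value. *)
Fixpoint renewal_rec (f n : nat) : R :=
  if f is f'.+1 then
    ((n == 0%N)%:R + \sum_(1 <= j < n.+1) p j * renewal_rec f' (n - j))
      / (1 - p 0%N)
  else 0.

(** The expected number of [k] with [S_k = n]. *)
Definition renewal n : R := renewal_rec n.+1 n.

Lemma renewalE n :
  renewal n = (n == 0%N)%:R + \sum_(0 <= j < n.+1) p j * renewal (n - j).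
Proof.
have fuel f g m : (m < f)%N -> (m < g)%N -> renewal_rec f m = renewal_rec g m.
  elim: f g m => // f IH [//|g] m mf mg /=; congr ((_ + _) / _).
  rewrite big_nat [RHS]big_nat; apply: eq_bigr => j /andP[j0 jm].
  by rewrite (IH g)//; lia.
have h : 1 - p 0%N != 0 by rewrite gt_eqF// subr_gt0 law0_lt1.
rewrite big_nat_recl//= subn0.
have -> : \sum_(0 <= i < n) p i.+1 * renewal (n - i.+1) =
    \sum_(1 <= j < n.+1) p j * renewal_rec n (n - j).
  rewrite big_add1/= big_nat [RHS]big_nat; apply: eq_bigr => i /andP[_ ni].
  by congr (_ * _); apply: fuel; lia.
rewrite {1 2}/renewal/=; set a := _ + _.
rewrite [in RHS]addrCA -/a; field; exact: h.
Qed.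

Lemma renewal_ge0 n : 0 <= renewal n.
Proof.
rewrite /renewal; move: n.+1 => f; elim: f n => [//|f IH] n /=.
by rewrite divr_ge0 ?subr_ge0 ?law_le1 ?(ltW law0_lt1)// addr_ge0// sumr_ge0// =>
  j _; rewrite mulr_ge0.
Qed.

(** Exactly one [k] satisfies [S_k <= N < S_(k+1)]. *)
Lemma sum_ptail_renewal N :
  \sum_(0 <= i < N.+1) ptail i.+1 * renewal (N - i) = 1.
Proof.
elim: N => [|N IH].
  rewrite big_nat1 subnn ptail1.
  have := renewalE 0; rewrite big_nat1 subnn eqxx => h.
  by rewrite mulrBl mul1r {1}h addrK.
rewrite big_nat_recl// subn0.
have -> : \sum_(0 <= i < N.+1) ptail i.+2 * renewal (N.+1 - i.+1) =
    1 - \sum_(0 <= i < N.+1) p i.+1 * renewal (N.+1 - i.+1).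
  rewrite -IH -sumrB; apply: eq_bigr => i _.
  by rewrite subSS (ptailS i.+1) mulrBl.
have := renewalE N.+1; rewrite big_nat_recl//= subn0 add0r.
set x := \sum_(0 <= i < _) _ => h.
rewrite ptail1.
by rewrite mulrBl mul1r {1}h; ring.
Qed.

Let bound : R := (1 - p 0%N)^-1.

Let bound_gt0 : 0 < bound.
Proof. by rewrite invr_gt0 subr_gt0 law0_lt1. Qed.

Lemma renewal_le n : renewal n <= bound.
Proof.
rewrite -[bound]mul1r ler_pdivlMr; last by rewrite subr_gt0 law0_lt1.
have := sum_ptail_renewal n; rewrite big_nat_recl// subn0 ptail1.
move=> h; rewrite -[leRHS]h mulrC lerDl sumr_ge0// => i _.
by rewrite mulr_ge0 ?ptail_ge0 ?renewal_ge0.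
Qed.

Let deficit K n := renewal n - \sum_(0 <= k < K) conv p k n.

Let deficitS K n :
  deficit K.+1 n = \sum_(0 <= j < n.+1) p j * deficit K (n - j).
Proof.
rewrite /deficit renewalE [X in _ - X = _]big_nat_recl// conv0.
under [X in _ = X]eq_bigr do rewrite mulrBr mulr_sumr.
rewrite [RHS]sumrB [X in _ = _ - X]exchange_big.
under [X in _ = _ - X]eq_bigr do rewrite -convS.
by ring.
Qed.

Lemma sum_conv_le K n : \sum_(0 <= k < K) conv p k n <= renewal n.
Proof.
rewrite -subr_ge0 -/(deficit K n); elim: K n => [|K IH] n.
  by rewrite /deficit big_geq// subr0 renewal_ge0.
by rewrite deficitS sumr_ge0// => j _; rewrite mulr_ge0.
Qed.

(** Exponential bound for [S_K <= n] with large [K], by Markov's inequality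
    for [2 ^ - S_K]. *)
Lemma sum_conv_ge K n : renewal n - bound * 2 ^+ n * ((1 + p 0%N) / 2) ^+ K <=
  \sum_(0 <= k < K) conv p k n.
Proof.
suff : deficit K n <= bound * 2 ^+ n * ((1 + p 0%N) / 2) ^+ K.
  by rewrite /deficit; lra.
elim: K n => [|K IH] n.
  rewrite /deficit big_geq// subr0 expr0 mulr1.
  apply: le_trans (renewal_le n) _; apply: ler_peMr; first exact: ltW.
  by rewrite exprn_ege1// ler1n.
rewrite deficitS.
apply: (@le_trans _ _ (\sum_(0 <= j < n.+1)
   bound * 2 ^+ n * ((1 + p 0%N) / 2) ^+ K * (p j * 2^-1 ^+ j))).
  rewrite big_nat [leRHS]big_nat; apply: ler_sum => j /andP[_ jn].
  rewrite [leRHS]mulrCA; apply: ler_wpM2l => //; apply: le_trans (IH _) _.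
  rewrite le_eqVlt; apply/orP; left; apply/eqP.
  rewrite -[in RHS](@subnK j n)// exprD exprVn; field.
  by rewrite expf_neq0// pnatr_eq0.
rewrite -mulr_sumr exprSr mulrA; apply: ler_wpM2l.
  rewrite mulr_ge0//; first by rewrite mulr_ge0// ?exprn_ge0// ltW.
  by rewrite exprn_ge0// divr_ge0// addr_ge0.
rewrite big_nat_recl//= expr0 mulr1.
have h : \sum_(0 <= i < n) p i.+1 * 2^-1 ^+ i.+1 <=
   (\sum_(0 <= i < n) p i.+1) / 2.
  rewrite mulr_suml; apply: ler_sum => i _; apply: ler_wpM2l => //.
  rewrite exprS ler_piMr// exprn_ile1//; lra.
have := law_le1 n.+1; rewrite big_nat_recl//=; lra.
Qed.

Section LimitSuperior.
Variables (h : nat -> R) (B : R).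
Hypothesis hB : forall n, `|h n| <= B.
Hypothesis hrec : forall n, (0 < n)%N ->
  h n = \sum_(0 <= j < n.+1) p j * h (n - j).

Let ub := [set y : R | exists N, forall n, (N <= n)%N -> h n <= y].
Definition limsup_of : R := inf ub.
Let lambda := limsup_of.

Let has_inf_ub : has_inf ub.
Proof.
split.
  by exists B, 0%N => n _; apply: le_trans (hB n); exact: ler_norm.
exists (- B) => y [N Nh]; apply: le_trans (Nh N (leqnn N)).
by have := hB N; rewrite ler_norml => /andP[].
Qed.

Lemma limsup_of_ub (e : R) : 0 < e ->
  exists N, forall n, (N <= n)%N -> h n <= lambda + e.
Proof.
move=> e0; have [y [N Nh] ylt] := inf_adherent e0 has_inf_ub.
by exists N => n Nn; apply: le_trans (Nh n Nn) (ltW ylt).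
Qed.

Lemma limsup_of_often (e : R) N : 0 < e ->
  exists n, (N <= n)%N /\ lambda - e < h n.
Proof.
move=> e0; apply: contrapT => /forallNP H.
suff : lambda <= lambda - e by lra.
apply: ge_inf; first by case: has_inf_ub.
exists N => n Nn; rewrite leNgt; apply/negP => hn; exact: (H n).
Qed.

Let lambda_bound : `|lambda| <= B.
Proof.
rewrite ler_norml; apply/andP; split.
  apply: lb_le_inf; first by case: has_inf_ub.
  move=> y [N Nh]; apply: le_trans (Nh N (leqnn N)).
  by have := hB N; rewrite ler_norml => /andP[].
apply: ge_inf; first by case: has_inf_ub.
by exists 0%N => n _; apply: le_trans (hB n); exact: ler_norm.
Qed.

Let sticky k := forall e : R, 0 < e -> exists (d : R) N, 0 < d /\
  forall n, (N <= n)%N -> lambda - d < h n -> lambda - e < h (n - k)%N.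

(** [h n] is, up to a small tail, an average of the [h (n - j)], none of which
    exceeds [lambda] by much; a deficit at [j = k] would cost [p k] times its
    size. *)
Let sticky_step k : 0 < p k -> sticky k.
Proof.
move=> pk e e0.
have B0 : 0 <= B by apply: le_trans (hB 0).
have [C [C0 CE]] : exists C : R, 0 < C /\ C = 3 * B + 5.
  by exists (3 * B + 5); split=> //; lra.
have [d [d0 d1 dC]] : exists d : R, [/\ 0 < d, d <= 1 & C * d <= p k * e].
  exists (Num.min 1 (p k * e / C)); split.
  - by rewrite lt_min ltr01 divr_gt0// mulr_gt0.
  - by rewrite ge_min lexx.
  - by rewrite mulrC -ler_pdivlMr// ge_min lexx orbT.
have [N1 h1] := limsup_of_ub d0.
have [N2 h2] := series_near p1 d0.
exists d, (N1 + N2 + k + 1)%N; split=> // n Nn hn.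
rewrite ltNge; apply/negP => hk.
have [n0 kn nN1 nN2 N2n] : [/\ (0 < n)%N, (k < (n - N1).+1)%N,
    ((n - N1).+1 <= n.+1)%N, (N2 <= (n - N1).+1)%N & (N2 <= n.+1)%N].
  by clear -Nn; split; lia.
pose x := lambda + d.
have key : h n - x * \sum_(0 <= j < n.+1) p j <=
    p k * (h (n - k)%N - x) + (2 * B + 1) * d.
  rewrite (hrec n0) mulr_sumr -sumrB.
  rewrite (@big_cat_nat _ _ _ (n - N1).+1)//=.
  apply: lerD.
    rewrite big_mkord.
    rewrite (bigD1 (Ordinal kn))//= mulrBr [x * _]mulrC gerDl.
    apply: sumr_le0 => -[j jn] _ /=; rewrite [x * _]mulrC -mulrBr.
    by apply: mulr_ge0_le0 => //; rewrite subr_le0; apply: h1; clear -jn Nn; lia.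
  apply: (@le_trans _ _ (\sum_((n - N1).+1 <= j < n.+1) p j * (2 * B + 1))).
    apply: ler_sum => j _; rewrite [x * _]mulrC -mulrBr; apply: ler_wpM2l => //.
    have := hB (n - j)%N; have := lambda_bound.
    by rewrite /x !ler_norml => /andP[? ?] /andP[? ?]; lra.
  rewrite -mulr_suml mulrC ler_wpM2l//; first by lra.
  have := law_le1 n.+1.
  rewrite (@big_cat_nat _ _ _ (n - N1).+1)//=.
  have := h2 (n - N1).+1.
  by move=> /(_ nN2); lra.
have s1 := law_le1 n.+1.
have s2 : 1 - d < \sum_(0 <= j < n.+1) p j by exact: h2.
move: key; set S := \sum_(0 <= j < _) _ in s1 s2 *.
have xB : `|x| <= B + 1.
  by have := lambda_bound; rewrite /x !ler_norml => /andP[? ?]; lra.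
have xS : x * S <= x + (B + 1) * d.
  have : `|x * (1 - S)| <= (B + 1) * d.
    rewrite normrM; apply: ler_pM => //.
    by rewrite ger0_norm; lra.
  rewrite ler_norml => /andP[? ?]; lra.
have : p k * (h (n - k)%N - x) <= p k * (- e - d).
  by apply: ler_wpM2l => //; rewrite /x; lra.
have : 0 <= p k * d by rewrite mulr_ge0// ltW.
rewrite CE in dC; rewrite /x in xS *; nra.
Qed.

Let sticky_add a b : sticky a -> sticky b -> sticky (a + b)%N.
Proof.
move=> sa sb e e0; have [d [N [d0 H]]] := sb e e0.
have [d' [N' [d'0 H']]] := sa d d0.
exists d', (N' + N + a)%N; split=> // n nN hn; rewrite subnDA; apply: H; first by lia.
by apply: H' => //; lia.
Qed.

(** Stickiness is additive in [k] and holds on the support of [p], so it holds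
    for all large [k]; a common shift then produces a window. *)
Lemma limsup_window H (e : R) N : 0 < e ->
  exists n, [/\ (N <= n)%N, (H <= n)%N &
    forall i, (i <= H)%N -> lambda - e < h (n - i)%N].
Proof.
move=> e0.
have [k0 hk0] : exists k0, forall k, (k0 <= k)%N -> sticky k.
  apply: (gcd1_closed_add pgcd) => [k /sticky_step//||].
    by move=> e' e'0; exists e', 0%N; split=> // n _; rewrite subn0.
  exact: sticky_add.
have [d [M [d0 HM]]] : exists (d : R) M, 0 < d /\ forall n, (M <= n)%N ->
    lambda - d < h n -> forall i, (i < H.+1)%N -> lambda - e < h (n - (k0 + i))%N.
  elim: H.+1 => [|K [d [M [d0 IH]]]]; first by exists 1, 0%N.
  have [d' [M' [d'0 IH']]] := hk0 (k0 + K)%N (leq_addr _ _) e e0.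
  exists (Num.min d d'), (M + M')%N; split; first by rewrite lt_min d0.
  move=> n nM hn i; rewrite ltnS leq_eqVlt => /predU1P[->|iK].
    by apply: IH'; [lia|apply: le_lt_trans hn; rewrite lerB// ge_min lexx orbT].
  by apply: IH => //; [lia|apply: le_lt_trans hn; rewrite lerB// ge_min lexx].
have [n [nM hn]] := limsup_of_often (M + N + k0 + H) d0.
exists (n - k0)%N; split; [lia|lia|] => i iH.
by rewrite -subnDA; apply: HM => //; lia.
Qed.

End LimitSuperior.

Let renewal_bound n : `|renewal n| <= bound.
Proof. by rewrite ger0_norm ?renewal_le ?renewal_ge0. Qed.

Let renewalN_bound n : `|- renewal n| <= bound.
Proof. by rewrite normrN. Qed.

Let renewal_rec1 n : (0 < n)%N ->
  renewal n = \sum_(0 <= j < n.+1) p j * renewal (n - j).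
Proof. by move=> n0; rewrite {1}renewalE eqn0Ngt n0 add0r. Qed.

Let renewalN_rec1 n : (0 < n)%N ->
  - renewal n = \sum_(0 <= j < n.+1) p j * - renewal (n - j).
Proof.
by move=> n0; rewrite {1}renewal_rec1// -sumrN; apply: eq_bigr => j _; rewrite mulrN.
Qed.

(** The renewal theorem of Erdos, Feller and Pollard. Along times at which the
    renewal sequence comes close to its limit superior [l] it does so on whole
    windows; inserting such a window into [sum_i P(X > i) G(N - i) = 1] gives
    [l * mu <= 1], and likewise for the limit inferior. *)
Theorem renewal_theorem (e : R) : 0 < e ->
  exists N, forall n, (N <= n)%N -> `|renewal n - mu^-1| <= e.
Proof.
move=> e0; have mu0 := law_mean_gt0.
have near_mu (d : R) : 0 < d ->
    exists H, mu - d <= \sum_(0 <= i < H.+1) ptail i.+1.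
  move=> d0; have [N Nh] := series_near pmu d0.
  exists N; rewrite sum_ptail; have := Nh N.+1 (leqnSn _).
  have : 0 <= N.+1%:R * ptail N.+1 by rewrite mulr_ge0// ptail_ge0.
  lra.
pose l1 := limsup_of renewal.
pose l2 := limsup_of (fun n => - renewal n).
have split_sum n H : (H <= n)%N ->
    \sum_(0 <= i < H.+1) ptail i.+1 * renewal (n - i) +
    \sum_(H.+1 <= i < n.+1) ptail i.+1 * renewal (n - i) = 1.
  by move=> Hn; rewrite -big_cat_nat//= sum_ptail_renewal.
have U : l1 <= mu^-1.
  apply: ler_eps => d d0; rewrite -lerBlDr -[leRHS]mul1r ler_pdivlMr//.
  have [h0|h0] := leP (l1 - d) 0.
    by apply: le_trans (ler01); rewrite mulr_le0_ge0// ltW.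
  apply: ler_eps => c c0.
  have c1 : 0 < c / (l1 - d) by rewrite divr_gt0.
  have [H Hh] := near_mu _ c1.
  have [n [_ Hn win]] := limsup_window renewal_bound renewal_rec1 H 0 d0.
  have := split_sum n H Hn.
  have : 0 <= \sum_(H.+1 <= i < n.+1) ptail i.+1 * renewal (n - i).
    by rewrite sumr_ge0// => i _; rewrite mulr_ge0 ?ptail_ge0 ?renewal_ge0.
  have : (l1 - d) * \sum_(0 <= i < H.+1) ptail i.+1 <=
      \sum_(0 <= i < H.+1) ptail i.+1 * renewal (n - i).
    rewrite mulr_sumr big_nat [leRHS]big_nat; apply: ler_sum => i /andP[_ iH].
    by rewrite mulrC; apply: ler_wpM2l; rewrite ?ptail_ge0// ltW// win.
  have : (l1 - d) * (mu - c / (l1 - d)) <=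
      (l1 - d) * \sum_(0 <= i < H.+1) ptail i.+1 by rewrite ler_wpM2l// ltW.
  rewrite mulrBr [_ * (c / _)]mulrC divfK ?gt_eqF//; lra.
have L : l2 <= - mu^-1.
  apply: ler_eps => d d0.
  pose c := d * mu / (2 * bound).
  have c0 : 0 < c by rewrite divr_gt0// ?mulr_gt0.
  have [H Hh] := near_mu c c0.
  have d2 : 0 < d / 2 by rewrite divr_gt0.
  have [n [_ Hn win]] := limsup_window renewalN_bound renewalN_rec1 H 0 d2.
  have E := split_sum n H Hn.
  have t1 : \sum_(H.+1 <= i < n.+1) ptail i.+1 * renewal (n - i) <= c * bound.
    apply: (@le_trans _ _ ((\sum_(H.+1 <= i < n.+1) ptail i.+1) * bound)).
      rewrite mulr_suml; apply: ler_sum => i _.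
      by apply: ler_wpM2l; rewrite ?ptail_ge0 ?renewal_le.
    apply: ler_wpM2r; first exact: ltW.
    have := sum_ptail_le n.+1; rewrite (@big_cat_nat _ _ _ H.+1)//=; lra.
  have w0 : 0 <= - l2 + d / 2.
    have := win 0%N (leq0n _); rewrite -/l2.
    by have := renewal_ge0 (n - 0); lra.
  have t2 : \sum_(0 <= i < H.+1) ptail i.+1 * renewal (n - i) <=
      (- l2 + d / 2) * mu.
    apply: (@le_trans _ _ ((- l2 + d / 2) * \sum_(0 <= i < H.+1) ptail i.+1)).
      rewrite mulr_sumr big_nat [leRHS]big_nat; apply: ler_sum => i /andP[_ iH].
      rewrite [leRHS]mulrC; apply: ler_wpM2l; rewrite ?ptail_ge0//.
      by have := win i iH; rewrite -/l2; lra.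
    by apply: ler_wpM2l => //; exact: sum_ptail_le.
  have cb : c * bound = d / 2 * mu by rewrite /c; field; rewrite gt_eqF.
  have : 1 <= (- l2 + d) * mu by rewrite cb in t1; nra.
  rewrite -ler_pdivrMr// mul1r; lra.
have [N1 h1] := limsup_of_ub renewal_bound e0.
have [N2 h2] := limsup_of_ub renewalN_bound e0.
exists (N1 + N2)%N => n Nn; rewrite ler_norml; apply/andP; split.
  have : - renewal n <= l2 + e by apply: h2; lia.
  lra.
have : renewal n <= l1 + e by apply: h1; lia.
lra.
Qed.

End Renewal.

(** * The uniform convergence theorem for slowly varying functions *)

Section UniformConvergence.
Context {R : realType}.

Lemma lebesgue_measure_shift (u : R) (A : set R) : measurable A ->
  lebesgue_measure [set x : R | A (x - u)] = lebesgue_measure A.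
Proof.
move=> mA; pose f (x : R) : measurableTypeR R := x - u.
have mf : measurable_fun [set: R] f by exact: measurable_funB.
change (pushforward (@lebesgue_measure R) f A = lebesgue_measure A).
apply/esym/lebesgue_measure_unique => //= _ [[a b]] _ <-.
rewrite /pushforward.
have -> : f @^-1` `]a, b] = `]a + u, b + u]%classic.
  by apply/seteqP; split=> x; rewrite /f/= !in_itv/= ltrBrDr lerBlDr.
rewrite !lebesgue_measure_itv/= !lte_fin ltrD2r.
by case: ifP => // _; congr (_%:E); ring.
Qed.

(** Pointwise convergence [f (y + t) - f y -> 0] is convergence in measure on
    bounded sets of [t]. *)
Lemma slow_variation_in_measure (f : R -> R) (y : nat -> R) (e : R) :
  measurable_fun setT f ->
  (forall t : R, f (y n + t) - f (y n) @[n --> \oo] --> (0 : R)) -> 0 < e ->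
  lebesgue_measure [set t : R | 0 <= t <= 2 /\ e <= `|f (y n + t) - f (y n)|]
    @[n --> \oo] --> 0%E.
Proof.
move=> mf fy e0.
pose E n := [set t : R | 0 <= t <= 2 /\ e <= `|f (y n + t) - f (y n)|].
have mE n : measurable (E n).
  rewrite (_ : E n = `[0, 2] `&`
      (fun t => `|f (y n + t) - f (y n)|) @^-1` `[e, +oo[).
    have mg : measurable_fun (`[0%R, 2%R] : set R)
        (fun t => `|f (y n + t) - f (y n)|).
      apply: measurableT_comp => //; apply: measurable_funB => //.
      apply: measurableT_comp => //; apply: measurable_funTS.
      exact: measurable_funD.
    exact: mg.
  by apply/seteqP; split=> t; rewrite /E/= !in_itv/= andbT.
pose F n := \bigcup_(k in [set k | (n <= k)%N]) E k.
have mF n : measurable (F n) by apply: bigcup_measurable => k _.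
have F2 n : F n `<=` `[0, 2] by move=> t [k _ [t2 _]]; rewrite /= in_itv.
have capF : \bigcap_n F n = set0.
  apply/seteqP; split=> // t /= tF.
  have /cvgrPdist_lt/(_ e e0) [N _ NH] := fy t.
  have [k /= Nk [_ ek]] := tF N I.
  by have := NH k Nk; rewrite sub0r normrN ltNge ek.
have F_cvg : lebesgue_measure (F n) @[n --> \oo] --> 0%E.
  rewrite -(@measure0 _ _ _ (@lebesgue_measure R)) -capF.
  apply: nonincreasing_cvg_mu => //.
  - apply: (@le_lt_trans _ _ (lebesgue_measure (`[0%R, 2%R] : set R))).
      by apply: le_measure; rewrite ?inE//; exact: mF.
    by rewrite lebesgue_measure_itv/=; case: ifP => _; rewrite ltry.
  - by rewrite capF.
  - by move=> m n mn; rewrite subsetEset => t [k /= nk Ek]; exists k => //=; exact: leq_trans nk.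
apply: (@squeeze_cvge _ _ _ _ (fun=> 0%E) _ (fun n => lebesgue_measure (F n))).
- apply: nearW => n; rewrite measure_ge0/=; apply: le_measure; rewrite ?inE//.
  + exact: mE.
  + exact: mF.
  + by move=> t Et; exists n => /=.
- exact: cvg_cst.
- exact: F_cvg.
Qed.

(** The uniform convergence theorem for slowly varying functions, in additive
    form. If it failed at [x n] and [x n + u n], every [t]
    of [[1, 2]] would be exceptional for [x n] or, translated by [u n], for
    [x n + u n]; but both exceptional sets have small measure. *)
Lemma uniform_convergence (f : R -> R) (e : R) : measurable_fun setT f ->
  (forall t : R, f (x + t) - f x @[x --> +oo] --> (0 : R)) -> 0 < e ->
  exists M : R, forall x u, M <= x -> 0 <= u <= 1 -> `|f (x + u) - f x| <= e.
Proof.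
move=> mf sv e0; apply: contrapT => /forallNP H.
have {H} /choice[xu xuP] : forall n : nat, exists xu : R * R,
    [/\ n%:R <= xu.1, 0 <= xu.2 <= 1 & e < `|f (xu.1 + xu.2) - f xu.1|].
  move=> n; apply: contrapT => /forallNP K; apply: (H n%:R) => x u nx u01.
  rewrite leNgt; apply/negP => eh; exact: (K (x, u)).
have e2 : 0 < e / 2 by rewrite divr_gt0.
have cvg_seq (y : nat -> R) : (forall n, n%:R <= y n) ->
    forall t : R, f (y n + t) - f (y n) @[n --> \oo] --> (0 : R).
  move=> ny t.
  have yoo : y n @[n --> \oo] --> +oo.
    apply/cvgryPge => A; near=> n; apply: le_trans (ny n).
    by near: n; exact: nbhs_infty_ger.
  exact: (cvg_comp _ _ yoo (sv t)).
pose x n := (xu n).1; pose u n := (xu n).2.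
have nx n : n%:R <= x n by have [] := xuP n.
have u01 n : 0 <= u n <= 1 by have [] := xuP n.
have nxu n : n%:R <= x n + u n.
  by rewrite (le_trans (nx n))// lerDl; have /andP[] := u01 n.
have mB (y : nat -> R) n : measurable
    [set t : R | 0 <= t <= 2 /\ e / 2 <= `|f (y n + t) - f (y n)|].
  rewrite (_ : mkset _ = `[0, 2] `&`
      (fun t => `|f (y n + t) - f (y n)|) @^-1` `[e / 2, +oo[).
    have mg : measurable_fun (`[0%R, 2%R] : set R)
        (fun t => `|f (y n + t) - f (y n)|).
      apply: measurableT_comp => //; apply: measurable_funB => //.
      apply: measurableT_comp => //; apply: measurable_funTS.
      exact: measurable_funD.
    exact: mg.
  by apply/seteqP; split=> t; rewrite /= !in_itv/= andbT.
have A0 := slow_variation_in_measure mf (cvg_seq _ nx) e2.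
have B0 := slow_variation_in_measure mf (cvg_seq _ nxu) e2.
have half : 0 < (4^-1 : R) by [].
have nb : nbhs (0%E : \bar R) [set y : \bar R | (y < (4^-1 : R)%:E)%E].
  by apply: open_nbhs_nbhs; split; [exact: open_ereal_lt_ereal|rewrite /= lte_fin].
pose A n := [set t : R | 0 <= t <= 2 /\ e / 2 <= `|f (x n + t) - f (x n)|].
pose B n := [set t : R | 0 <= t <= 2 /\
  e / 2 <= `|f (x n + u n + t) - f (x n + u n)|].
have [n [An Bn]] : exists n, (lebesgue_measure (A n) < (4^-1 : R)%:E)%E /\
    (lebesgue_measure (B n) < (4^-1 : R)%:E)%E.
  near \oo => n; exists n; split; near: n.
  - exact: (A0 _ nb).
  - exact: (B0 _ nb).
have := xuP n; rewrite -/(x n) -/(u n) => -[_ _ big].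
pose C := [set t : R | B n (t - u n)].
have sub : `[1, 2] `<=` A n `|` C.
  move=> t /=; rewrite in_itv/= => t12.
  have [h|h] := leP (e / 2) `|f (x n + t) - f (x n)|.
    by left; split=> //; lra.
  right; split; first by have := u01 n; lra.
  rewrite leNgt; apply/negP; rewrite (_ : x n + u n + (t - u n) = x n + t); last by ring.
  move=> h'; move: big; rewrite ltNge => /negP; apply.
  rewrite (_ : _ - _ = (f (x n + t) - f (x n)) - (f (x n + t) - f (x n + u n))); last by ring.
  by apply: le_trans (ler_normB _ _) _; lra.
have mBs : measurable C.
  have : measurable_fun [set: R] (fun t => t - u n) by exact: measurable_funB.
  by move=> /(_ measurableT _ (mB (fun n => x n + u n) n)); rewrite setTI.
have : (lebesgue_measure (`[1%R, 2%R] : set R) <=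
    lebesgue_measure (A n) + lebesgue_measure C)%E.
  apply: le_trans (measureU2 _ _ _) => //; last exact: mB.
  by apply: le_measure; rewrite ?inE//; apply: measurableU => //; exact: mB.
rewrite /C lebesgue_measure_shift; last exact: (mB (fun n => x n + u n) n).
rewrite lebesgue_measure_itv/= lte_fin ltr1n/=.
rewrite leNgt => /negP; apply.
apply: (@lt_le_trans _ _ ((4^-1 : R)%:E + (4^-1 : R)%:E)%E).
  by apply: lteD.
by rewrite -EFinD -EFinB lee_fin; lra.
Unshelve. all: by end_near.
Qed.

End UniformConvergence.

(** * Regularly varying sequences *)

Section RegularVariation.
Context {R : realType}.
Implicit Types (q : nat -> R) (e s y : R) (n k x : nat).

Lemma le_exp_half y : 0 <= y <= 1 -> expR (- y) <= 1 - y / 2.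
Proof.
move=> /andP[y0 y1]; rewrite expRN.
have h : 1 + y <= expR y by exact: expR_ge1Dx.
apply: (@le_trans _ _ (1 + y)^-1); first by rewrite lef_pV2 ?posrE ?expR_gt0//; lra.
rewrite -[leLHS]mul1r ler_pdivrMr; last by lra.
nra.
Qed.

Lemma exists_natr_ge y : exists n : nat, y <= n%:R.
Proof. by exists (Num.truncn y).+1; exact: ltW (truncnS_gt y). Qed.

Lemma powR_natdiv n k s : (0 < n)%N -> (0 < k)%N ->
  ((k%:R / n%:R : R)) `^ s = (k%:R : R) `^ s / (n%:R : R) `^ s.
Proof.
move=> n0 k0; rewrite /powR !gt_eqF ?divr_gt0 ?ltr0n//.
rewrite lnM ?posrE ?invr_gt0 ?ltr0n// lnV ?posrE ?ltr0n//.
by rewrite -expRN -expRD; congr expR; ring.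
Qed.

Lemma natr_powR_gt0 n s : (0 < n)%N -> 0 < (n%:R : R) `^ s.
Proof. by move=> n0; rewrite powR_gt0// ltr0n. Qed.

Lemma ln_natr_powR n s : (0 < n)%N -> ln ((n%:R : R) `^ s) = s * ln n%:R.
Proof. by move=> n0; rewrite ln_powR. Qed.

Lemma ln_succ j : (0 < j)%N -> (j.+1%:R : R)^-1 <= ln j.+1%:R - ln j%:R.
Proof.
move=> j0.
have jj : (j%:R : R) / j.+1%:R = 1 + (- j.+1%:R^-1).
  by rewrite -[j.+1%:R]natr1; field; rewrite natr1 pnatr_eq0.
have := @le_ln1Dx R (- j.+1%:R^-1); rewrite -jj lnM ?posrE ?invr_gt0 ?ltr0n//.
rewrite lnV ?posrE ?ltr0n// => h.
have : -1 < - (j.+1%:R : R)^-1 by rewrite ltrN2 invf_lt1 ?ltr0n// ltr1n.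
move=> /h; set z := (j.+1%:R)^-1; lra.
Qed.

(** [c j^(-c-1) <= (j-1)^(-c) - j^(-c)], summed. *)
Lemma sum_powR_tail (c : R) x N : (0 < x)%N -> 0 < c ->
  \sum_(x.+1 <= j < N) (j%:R : R) `^ (- (c + 1)) <= c^-1 * (x%:R : R) `^ (- c).
Proof.
move=> x0 c0.
have step j : (0 < j)%N -> c * (j.+1%:R : R) `^ (- (c + 1)) <=
    (j%:R : R) `^ (- c) - (j.+1%:R : R) `^ (- c).
  move=> j0.
  have hl := ln_succ j0.
  have -> : (j%:R : R) `^ (- c) =
      (j.+1%:R : R) `^ (- c) * expR (c * (ln j.+1%:R - ln j%:R)).
    rewrite /powR !gt_eqF ?ltr0n// -expRD; congr expR; ring.
  have -> : (j.+1%:R : R) `^ (- (c + 1)) = (j.+1%:R : R) `^ (- c) * j.+1%:R^-1.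
    rewrite opprD powRD; last by rewrite pnatr_eq0 implybT.
    by rewrite [_ `^ -1]powR_inv1.
  have e1 : 1 + c * (j.+1%:R : R)^-1 <= expR (c * (ln j.+1%:R - ln j%:R)).
    apply: le_trans (expR_ge1Dx _); rewrite lerD2l ler_wpM2l//; exact: ltW.
  have p0 : 0 < (j.+1%:R : R) `^ (- c) by exact: natr_powR_gt0.
  have := ler_wpM2l (ltW p0) e1; rewrite mulrDr mulr1.
  set a := _ `^ _; set b := _^-1; set d := expR _; lra.
have [Nx|xN] := leqP N x.
  by rewrite big_geq ?(leqW Nx)// mulr_ge0 ?powR_ge0// invr_ge0 ltW.
have tele m : \sum_(x.+1 <= j < x.+1 + m) (j%:R : R) `^ (- (c + 1)) <=
    c^-1 * ((x%:R : R) `^ (- c) - (x + m)%:R `^ (- c)).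
  elim: m => [|m IH]; first by rewrite !addn0 big_geq// subrr mulr0.
  rewrite addnS big_nat_recr ?leq_addr//= addSn.
  have := step (x + m)%N; rewrite addn_gt0 x0 => /(_ isT).
  rewrite -ler_pdivlMl// => h; apply: le_trans (lerD IH h) _.
  by rewrite -mulrDr addnS addrA subrK.
rewrite -(subnKC xN); apply: le_trans (tele _) _.
by rewrite ler_pM2l ?invr_gt0// gerBl powR_ge0.
Qed.

Lemma sum_powR_head s x : 0 < s <= 1 ->
  \sum_(1 <= j < x.+1) (j%:R : R) `^ (s - 1) <= 2 / s * (x%:R : R) `^ s.
Proof.
move=> /andP[s0 s1]; elim: x => [|x IH].
  by rewrite big_geq// mulr_ge0// ?powR_ge0// divr_ge0// ltW.
rewrite big_nat_recr//=; apply: le_trans (lerD IH (lexx _)) _.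
have p0 : 0 < (x.+1%:R : R) `^ s by exact: natr_powR_gt0.
have i0 : 0 <= (x.+1%:R : R)^-1 <= 1.
  by rewrite invr_ge0 ler0n/= invf_le1 ?ltr0n// ler1n.
have -> : (x.+1%:R : R) `^ (s - 1) = (x.+1%:R : R) `^ s * x.+1%:R^-1.
  by rewrite powRD ?pnatr_eq0 ?implybT// [_ `^ -1]powR_inv1.
suff : (x%:R : R) `^ s <= (x.+1%:R : R) `^ s * (1 - s * x.+1%:R^-1 / 2).
  move=> h.
  have h2 : 0 < 2 / s by rewrite divr_gt0.
  have := ler_wpM2l (ltW h2) h.
  have -> : 2 / s * ((x.+1%:R : R) `^ s * (1 - s * x.+1%:R^-1 / 2)) =
     2 / s * x.+1%:R `^ s - x.+1%:R `^ s * x.+1%:R^-1.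
    move: (x.+1%:R `^ s) (x.+1%:R^-1) => P z; field; exact: lt0r_neq0.
  set a := 2 / s * _; set b := 2 / s * _; set d := x.+1%:R `^ s * _; lra.
have sy : 0 <= s * (x.+1%:R : R)^-1 <= 1.
  by case/andP: i0; move: _^-1 => z z0 z1; apply/andP; split; nra.
case: x {IH} p0 i0 sy => [|x] p0 i0 sy.
  rewrite powR0 ?gt_eqF//; rewrite mulr_ge0 ?ltW//.
  by move: sy; set z := _^-1; lra.
apply: le_trans (ler_wpM2l (ltW p0) (le_exp_half sy)).
have -> : (x.+1%:R : R) `^ s = (x.+2%:R : R) `^ s *
   expR (- (s * (ln x.+2%:R - ln x.+1%:R))).
  rewrite /powR !gt_eqF ?ltr0n// -expRD; congr expR; ring.
rewrite ler_pM2l// ler_expR lerN2 ler_pM2l//.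
exact: ln_succ.
Qed.

(** Positive sequences [q n = n ^ (- e) * l n] with [l] slowly varying, in the
    quantitative form of Potter's bounds. *)
Definition regvar q e : Prop :=
  (forall n, (0 < n)%N -> 0 < q n) /\
  forall d : R, 0 < d -> exists2 n0, (0 < n0)%N &
    forall n k, (n0 <= n)%N -> (n <= k)%N ->
      `|ln (q k) - ln (q n) + e * (ln k%:R - ln n%:R)|
        <= d * (1 + (ln k%:R - ln n%:R)).

Lemma regvar_gt0 q e n : regvar q e -> (0 < n)%N -> 0 < q n.
Proof. by move=> [h _]; exact: h. Qed.

Lemma regvar_ge0 q e n : regvar q e -> (0 < n)%N -> 0 <= q n.
Proof. by move=> h n0; exact: ltW (regvar_gt0 h n0). Qed.

Lemma ln_nat_mono n k : (0 < n)%N -> (n <= k)%N -> ln n%:R <= ln k%:R :> R.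
Proof.
by move=> n0 nk; rewrite ler_ln ?posrE ?ltr0n ?ler_nat//; exact: leq_trans nk.
Qed.

(** Halving repeatedly reduces the comparison of [k] with [n] to consecutive
    ratios at most 2, for which convergence is uniform. *)
Lemma slowly_varying_regvar (L : R -> R) : slowly_varying L ->
  regvar (fun n => L n%:R) 0.
Proof.
move=> [Lpos mL Llim]; split; first by move=> n n0; apply: Lpos; rewrite ltr0n.
pose f y := ln (L (expR y)).
have mf : measurable_fun setT f.
  apply: measurableT_comp; first exact: measurable_ln.
  apply: (@measurable_comp _ _ _ _ _ _ (`]0, +oo[ : set R)) => //.
    by move=> _ [x _ <-]; rewrite /= in_itv/= expR_gt0.
have flim (t : R) : f (y + t) - f y @[y --> +oo] --> (0 : R).
  have h : ln (L (expR t * y) / L y) @[y --> +oo] --> (0 : R).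
    rewrite -[X in _ --> X](@ln1 R); apply: (@continuous_cvg _ _ _ _ _ _ (@ln R)).
      exact: continuous_ln.
    by apply: Llim; exact: expR_gt0.
  have expoo : expR y @[y --> +oo] --> (+oo : set_system R).
    apply/cvgryPge => A; near=> y; apply: (@le_trans _ _ y).
      by near: y; apply: nbhs_pinfty_ge; rewrite num_real.
    by apply: le_trans (expR_ge1Dx _); rewrite lerDr.
  have := cvg_comp _ _ expoo h.
  apply: cvg_trans; apply: near_eq_cvg; apply: nearW => y /=.
  rewrite /f expRD [expR y * _]mulrC lnM ?posrE ?invr_gt0 ?Lpos ?mulr_gt0 ?expR_gt0//.
  by rewrite lnV ?posrE ?Lpos ?expR_gt0.
move=> d d0.
have l32 : 0 < ln (3 / 2 : R) by apply: ln_gt0; lra.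
pose e := d * Num.min 1 (ln (3 / 2 : R)).
have e0 : 0 < e by rewrite mulr_gt0// lt_min ltr01.
have ed : e <= d by rewrite ger_pMr// ge_min lexx.
have e32 : e <= d * ln (3 / 2) by rewrite ler_pM2l// ge_min lexx orbT.
clearbody e.
have [M HM] := uniform_convergence mf flim e0.
have [m mM] : exists m : nat, M <= ln m.+1%:R.
  exists (Num.truncn (expR M)).
  rewrite -[leLHS]expRK ler_ln ?posrE ?expR_gt0 ?ltr0n// ltW// truncnS_gt.
  exact.
exists m.+1 => // n k mn.
have step a b : (m.+1 <= a)%N -> (a <= b)%N -> (b <= a.*2)%N ->
    `|ln (L b%:R) - ln (L a%:R)| <= e.
  move=> ma ab ba.
  have a0 : (0 < a)%N by exact: leq_trans ma.
  have b0 : (0 < b)%N by exact: leq_trans ab.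
  have Ma : M <= ln a%:R by apply: le_trans mM _; exact: ln_nat_mono.
  have u01 : 0 <= (ln b%:R - ln a%:R : R) <= 1.
    rewrite subr_ge0 ln_nat_mono//=.
    have : ln b%:R <= ln a.*2%:R :> R by exact: ln_nat_mono.
    rewrite -mul2n natrM lnM ?posrE ?ltr0n// => h.
    have : ln 2 <= 1 :> R.
      by have := @le_ln1Dx R 1; rewrite (_ : 1 + 1 = 2)//; apply; lra.
    lra.
  have := HM _ _ Ma u01; rewrite /f [_ + (_ - _)]addrC subrK !lnK ?posrE ?ltr0n//.
rewrite mul0r addr0.
elim/ltn_ind: k => k IH nk.
have n0 : (0 < n)%N by exact: leq_trans mn.
have [k2n|n2k] := leqP k n.*2.
  apply: le_trans (step _ _ mn nk k2n) _; apply: le_trans ed _.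
  by apply: ler_peMr; [exact: ltW|rewrite lerDl subr_ge0 ln_nat_mono].
have hk' : [/\ (n <= uphalf k)%N, (uphalf k < k)%N, (k <= (uphalf k).*2)%N &
    (3 * uphalf k <= k.*2)%N].
  clear -n2k n0; have := odd_double_half k; rewrite uphalf_half => hk.
  by split; case: (odd k) hk => /=; lia.
case: hk' => nk' k'k kk' k3.
have h1 := IH _ k'k nk'.
have h2 := step _ _ (leq_trans mn nk') (ltnW k'k) kk'.
have k'0 : (0 < uphalf k)%N by exact: leq_trans nk'.
have h3 : ln (3 / 2) <= ln k%:R - ln (uphalf k)%:R :> R.
  have r0 : 0 < (3 / 2 : R) by lra.
  have u0 : 0 < ((uphalf k)%:R : R) by rewrite ltr0n.
  have kr0 : 0 < (k%:R : R) by rewrite ltr0n (leq_trans _ k'k).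
  rewrite lerBrDr -lnM ?posrE// ler_ln ?posrE ?mulr_gt0//.
  have : (3 * uphalf k)%:R <= (k.*2)%:R :> R by rewrite ler_nat.
  rewrite -mul2n !natrM; lra.
rewrite (_ : ln (L k%:R) - ln (L n%:R) = (ln (L k%:R) - ln (L (uphalf k)%:R)) +
  (ln (L (uphalf k)%:R) - ln (L n%:R))); last by ring.
apply: le_trans (ler_normD _ _) _.
have : d * ln (3 / 2) <= d * (ln k%:R - ln (uphalf k)%:R).
  by rewrite ler_pM2l.
lra.
Unshelve. all: by end_near.
Qed.

Lemma eq_regvar q q' e : (forall n, (0 < n)%N -> q n = q' n) ->
  regvar q e -> regvar q' e.
Proof.
move=> E [q0 H]; split; first by move=> n n0; rewrite -E// q0.
move=> d d0; have [n0 n00 Hn] := H d d0; exists n0 => // n k nn nk.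
rewrite -!E; [exact: Hn| |]; exact: leq_trans (leq_trans n00 nn) _.
Qed.

Lemma regvarM q e (c s : R) : 0 < c -> regvar q e ->
  regvar (fun n => c * q n * (n%:R : R) `^ (- s)) (e + s).
Proof.
move=> c0 [q0 H]; split.
  by move=> n n0; rewrite mulr_gt0// ?natr_powR_gt0// mulr_gt0// q0.
move=> d d0; have [n0 n00 Hn] := H d d0; exists n0 => // n k nn nk.
have n1 : (0 < n)%N by exact: leq_trans nn.
have k1 : (0 < k)%N by exact: leq_trans nk.
have E m : (0 < m)%N -> ln (c * q m * (m%:R : R) `^ (- s)) =
    ln c + ln (q m) - s * ln m%:R.
  move=> m0; rewrite !lnM ?posrE ?mulr_gt0 ?natr_powR_gt0 ?q0//.
  by rewrite ln_natr_powR// mulNr.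
rewrite !E// (_ : _ + _ = ln (q k) - ln (q n) + e * (ln k%:R - ln n%:R)).
  exact: Hn.
by ring.
Qed.

Section Consequences.
Variables (q : nat -> R) (e : R).
Hypothesis qe : regvar q e.

Let q0 n : (0 < n)%N -> 0 < q n.
Proof. exact: regvar_gt0 qe. Qed.

Lemma le_of_ln_sub (a b c : R) : 0 < a -> 0 < b -> ln a - ln b <= c ->
  a <= expR c * b.
Proof.
move=> a0 b0 h; rewrite -[leLHS]lnK ?posrE// -[X in _ * X]lnK ?posrE//.
by rewrite -expRD ler_expR; lra.
Qed.

Lemma regvar_potter (d : R) : 0 < d -> exists2 n0, (0 < n0)%N &
  forall n k, (n0 <= n)%N -> (n <= k)%N ->
    q k <= expR d * (k%:R / n%:R) `^ (d - e) * q n /\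
    q n <= expR d * (k%:R / n%:R) `^ (d + e) * q k.
Proof.
move=> d0; have [n0 n00 H] := qe.2 d d0; exists n0 => // n k nn nk.
have n1 : (0 < n)%N by exact: leq_trans nn.
have k1 : (0 < k)%N by exact: leq_trans nk.
have := H n k nn nk; rewrite ler_norml => /andP[h1 h2].
have E s : expR d * (k%:R / n%:R) `^ s = expR (d + s * (ln k%:R - ln n%:R)).
  rewrite expRD /powR gt_eqF ?divr_gt0 ?ltr0n//.
  by rewrite lnM ?posrE ?invr_gt0 ?ltr0n// lnV ?posrE ?ltr0n.
rewrite !E; split; apply: le_of_ln_sub; rewrite ?q0//; lra.
Qed.

Lemma regvar_almost_decreasing (d : R) : 0 < e -> 0 < d -> exists2 n0,
  (0 < n0)%N & forall n k, (n0 <= n)%N -> (n <= k)%N -> q k <= (1 + d) * q n.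
Proof.
move=> e0 d0.
have l0 : 0 < ln (1 + d) by apply: ln_gt0; lra.
have m0 : 0 < Num.min e (ln (1 + d)) by rewrite lt_min e0.
have me : Num.min e (ln (1 + d)) <= e by rewrite ge_min lexx.
have ml : Num.min e (ln (1 + d)) <= ln (1 + d) by rewrite ge_min lexx orbT.
have [n0 n00 H] := qe.2 _ m0; exists n0 => // n k nn nk.
move: (Num.min _ _) m0 me ml H => c m0 me ml H.
have n1 : (0 < n)%N by exact: leq_trans nn.
have k1 : (0 < k)%N by exact: leq_trans nk.
have := H n k nn nk; rewrite ler_norml => /andP[h1 h2].
have l1 : ln n%:R <= ln k%:R :> R by exact: ln_nat_mono.
rewrite -[1 + d]lnK ?posrE; last by lra.
apply: le_of_ln_sub; rewrite ?q0//.
nra.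
Qed.

Lemma regvar_near (d : R) : 0 < d -> exists c : R, exists n0 : nat,
  [/\ 0 < c < 1, (0 < n0)%N & forall n k, (n0 <= n)%N ->
    (1 - c) * n%:R <= k%:R -> k%:R <= (1 + c) * n%:R ->
    q k <= (1 + d) * q n /\ q n <= (1 + d) * q k].
Proof.
move=> d0.
have l0 : 0 < ln (1 + d) by apply: ln_gt0; lra.
have [l l1] : exists l : R, l = ln (1 + d) by exists (ln (1 + d)).
have ll0 : 0 < l by rewrite l1.
have [a [a0 a1 al]] : exists a : R, [/\ 0 < a, a <= 1 & a <= l / 4].
  exists (Num.min 1 (l / 4)); rewrite lt_min ltr01/= divr_gt0//.
  by rewrite !ge_min !lexx orbT.
have [n0 n00 H] := qe.2 _ a0.
have E0 : 0 < `|e| + 1 by have := normr_ge0 e; lra.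
have [c [c0 c1 cl]] : exists c : R, [/\ 0 < c, c <= 2^-1 & 2 * c * (`|e| + 1) <= l / 4].
  exists (Num.min 2^-1 (l / 8 / (`|e| + 1))); split.
  - by rewrite lt_min invr_gt0 ltr0n/= !divr_gt0.
  - by rewrite ge_min lexx.
  - have : Num.min 2^-1 (l / 8 / (`|e| + 1)) <= l / 8 / (`|e| + 1).
      by rewrite ge_min lexx orbT.
    by rewrite ler_pdivlMr//; lra.
exists c, (2 * n0)%N; split; [lra|nlia|].
have key m k : (n0 <= m)%N -> (m <= k)%N -> ln k%:R - ln m%:R <= 2 * c :> R ->
    q k <= (1 + d) * q m /\ q m <= (1 + d) * q k.
  move=> nm mk lkm.
  have m1 : (0 < m)%N by exact: leq_trans nm.
  have k1 : (0 < k)%N by exact: leq_trans mk.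
  have l2 : ln m%:R <= ln k%:R :> R by exact: ln_nat_mono.
  have := H m k nm mk; rewrite ler_norml => /andP[h1 h2].
  have h3 : `|e * (ln k%:R - ln m%:R)| <= l / 4.
    rewrite normrM (@ger0_norm _ (_ - _)) ?subr_ge0//.
    apply: le_trans cl; apply: (@le_trans _ _ (`|e| * (2 * c))).
      exact: ler_wpM2l.
    lra.
  have h4 : a * (ln k%:R - ln m%:R) <= l / 4.
    apply: le_trans cl; apply: (@le_trans _ _ (1 * (2 * c))).
      by apply: ler_pM => //; lra.
    have := normr_ge0 e; nra.
  move: h3; rewrite ler_norml => /andP[h3 h3'].
  rewrite -[1 + d]lnK ?posrE -?l1; last by lra.
  by split; apply: le_of_ln_sub; rewrite ?q0//; nra.
move=> n k nn kl ku.
have n1 : (0 < n)%N by nlia.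
have nr : 0 < (n%:R : R) by rewrite ltr0n.
have k1 : (0 < k)%N by rewrite -(ltr0n R); nra.
have kr : 0 < (k%:R : R) by rewrite ltr0n.
have [nk|kn] := leqP n k.
  apply: key => //; first by nlia.
  have : ln k%:R <= ln ((1 + c) * n%:R) :> R.
    by rewrite ler_ln ?posrE ?mulr_gt0//; lra.
  rewrite lnM ?posrE//; last by lra.
  have : ln (1 + c) <= c by apply: le_ln1Dx; lra.
  lra.
have kn0 : (n0 <= k)%N.
  rewrite -(ler_nat R); apply: le_trans kl.
  have : (2 * n0)%:R <= n%:R :> R by rewrite ler_nat.
  rewrite natrM; nra.
have [|h1 h2] := key k n kn0 (ltnW kn); last by split.
have : ln ((1 - c) * n%:R) <= ln k%:R :> R.
  by rewrite ler_ln ?posrE ?mulr_gt0//; lra.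
rewrite lnM ?posrE//; last by lra.
suff : - ln (1 - c) <= 2 * c by lra.
rewrite -lnV ?posrE; last by lra.
have -> : (1 - c)^-1 = 1 + c / (1 - c) by field; lra.
have c2 : c / (1 - c) <= 2 * c by rewrite ler_pdivrMr; nra.
by apply: le_trans c2; apply: le_ln1Dx; apply: lt_le_trans (_ : 0 <= _);
  [lra|apply: divr_ge0; lra].
Qed.

(** Potter's bound covers [x n <= k <= n], almost monotonicity the rest. *)
Lemma regvar_linear (x : R) : 0 < e -> 0 < x -> exists (C : R) n0,
  [/\ 0 < C, (0 < n0)%N & forall n k, (n0 <= n)%N -> x * n%:R <= k%:R ->
    q k <= C * q n].
Proof.
move=> e0 x0.
have [n0 n00 H] := regvar_almost_decreasing e0 ltr01.
have [n1 n10 P] := regvar_potter ltr01.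
pose C := expR 1 * (x^-1) `^ (1 + e) + 2.
have C0 : 0 < C by rewrite ltr_wpDl// mulr_ge0// ?powR_ge0// expR_ge0.
have [t tP] := exists_natr_ge (n1%:R / x).
exists C, (n0 + n1 + t + 1)%N; split => //; first by nlia.
move=> n k nn xk.
have n2 : (0 < n)%N by nlia.
have [nk|kn] := leqP n k.
  have h : q k <= (1 + 1) * q n by apply: H => //; nlia.
  apply: le_trans h _; rewrite ler_pM2r ?q0//.
  have : 0 <= expR 1 * x^-1 `^ (1 + e) by rewrite mulr_ge0// ?powR_ge0// expR_ge0.
  rewrite /C; lra.
have kn1 : (n1 <= k)%N.
  rewrite -(ler_nat R); apply: le_trans xk.
  rewrite mulrC -ler_pdivrMr//; apply: le_trans tP _.
  by rewrite ler_nat; nlia.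
have k0 : (0 < k)%N by nlia.
have [_ h] := P k n kn1 (ltnW kn); apply: le_trans h _.
rewrite ler_pM2r ?q0//; apply: (@le_trans _ _ (expR 1 * x^-1 `^ (1 + e))).
  rewrite ler_wpM2l ?expR_ge0// ge0_ler_powR// ?nnegrE ?divr_ge0 ?invr_ge0//.
  - lra.
  - exact: ltW.
  - rewrite ler_pdivrMr ?ltr0n// ler_pdivlMl//.
by rewrite lerDl.
Qed.

Lemma regvar_upper (s : R) : s < e ->
  exists2 C : R, 0 < C & forall n, (0 < n)%N -> q n <= C * (n%:R : R) `^ (- s).
Proof.
move=> se; have d0 : 0 < e - s by lra.
have [n0 n00 P] := regvar_potter d0.
pose C1 := expR (e - s) * q n0 * (n0%:R : R) `^ s.
pose C2 := \sum_(0 <= j < n0) `|q j| * (j%:R : R) `^ s.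
have C10 : 0 < C1 by rewrite mulr_gt0 ?natr_powR_gt0// mulr_gt0 ?expR_gt0 ?q0.
have C20 : 0 <= C2 by rewrite sumr_ge0// => j _; rewrite mulr_ge0// powR_ge0.
exists (C1 + C2); first by rewrite ltr_wpDr.
move=> n n1.
have pn : 0 < (n%:R : R) `^ s by exact: natr_powR_gt0.
rewrite powRN ler_pdivlMr//.
have [nn|nn] := leqP n0 n; last first.
  apply: le_trans (_ : C2 <= _); last by rewrite lerDr ltW.
  rewrite /C2 big_mkord (bigD1 (Ordinal nn))//= ler_wpDr//.
    by rewrite sumr_ge0// => j _; rewrite mulr_ge0// powR_ge0.
  by rewrite ler_pM2r// ler_norm.
have [h _] := P n0 n (leqnn _) nn.
apply: le_trans (_ : C1 <= _); last by rewrite lerDl.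
rewrite /C1; have := ler_wpM2r (ltW pn) h.
rewrite (_ : e - s - e = - s); last by ring.
rewrite powR_natdiv// !powRN => H; apply: le_trans H _.
rewrite le_eqVlt; apply/orP; left; apply/eqP; field.
by rewrite !gt_eqF// natr_powR_gt0.
Qed.

Lemma regvar_lower (s : R) : e < s -> exists (c : R) n0,
  [/\ 0 < c, (0 < n0)%N &
    forall n, (n0 <= n)%N -> c * (n%:R : R) `^ (- s) <= q n].
Proof.
move=> es; have d0 : 0 < s - e by lra.
have [n0 n00 P] := regvar_potter d0.
exists ((expR (s - e))^-1 * q n0 * (n0%:R : R) `^ s), n0; split => //.
  by rewrite mulr_gt0 ?natr_powR_gt0// mulr_gt0 ?invr_gt0 ?expR_gt0 ?q0.
move=> n nn; have [_ h] := P n0 n (leqnn _) nn.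
have n1 : (0 < n)%N by exact: leq_trans nn.
have pn : 0 < (n%:R : R) `^ s by exact: natr_powR_gt0.
have pn0 : 0 < (n0%:R : R) `^ s by exact: natr_powR_gt0.
move: h; rewrite (_ : s - e + e = s); last by ring.
rewrite powR_natdiv// powRN => h.
have eg := expR_gt0 (s - e).
rewrite ler_pdivrMr// -[leLHS]mulrA ler_pdivrMl//.
apply: le_trans (ler_wpM2r (ltW pn0) h) _.
rewrite le_eqVlt; apply/orP; left; apply/eqP; field; exact: lt0r_neq0.
Qed.

Lemma regvar_summable : 1 < e -> exists2 C : R, 0 < C &
  forall N, \sum_(1 <= j < N) q j <= C.
Proof.
move=> e1; pose c := (e - 1) / 2.
have c0 : 0 < c by rewrite /c; lra.
have ce : c + 1 < e by rewrite /c; lra.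
have [C C0 H] := regvar_upper ce.
exists (q 1 + C * c^-1).
  by rewrite ltr_wpDr ?q0// mulr_ge0// ?invr_ge0 ltW.
case=> [|[|N]].
- by rewrite big_geq// addr_ge0// ?ltW ?q0// divr_gt0.
- by rewrite big_geq// addr_ge0// ?ltW ?q0// divr_gt0.
rewrite big_ltn// lerD2l.
have := sum_powR_tail N.+2 (ltn0Sn 0) c0; rewrite powR1 mulr1 => h.
apply: le_trans (ler_wpM2l (ltW C0) h); rewrite mulr_sumr big_nat [leRHS]big_nat.
by apply: ler_sum => j /andP[j1 _]; apply: H; nlia.
Qed.

End Consequences.

End RegularVariation.

(** * The normalising sums and the local estimate *)

Section Asymptotics.
Context {R : realType}.

Lemma powR_vanish (s d : R) : 0 < s -> 0 < d -> exists2 n0, (0 < n0)%N &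
  forall n, (n0 <= n)%N -> (n%:R : R) `^ (- s) <= d.
Proof.
move=> s0 d0; have [m mP] := exists_natr_ge (expR (- ln d / s)).
exists m.+1 => // n mn; have n0 : (0 < n)%N by exact: leq_trans mn.
have : expR (- ln d / s) <= n%:R.
  by apply: le_trans mP _; rewrite ler_nat; exact: ltnW.
rewrite -[leRHS]lnK ?posrE ?ltr0n// ler_expR ler_pdivrMr// => h.
rewrite /powR gt_eqF ?ltr0n// -[leRHS]lnK ?posrE// ler_expR; lra.
Qed.

Lemma ln_le_powR (a : R) n : 0 < a -> (0 < n)%N ->
  ln n%:R <= a^-1 * (n%:R : R) `^ a.
Proof.
move=> a0 n0; rewrite ler_pdivlMl// /powR gt_eqF ?ltr0n//.
by apply: le_trans (expR_ge1Dx _); rewrite lerDr.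
Qed.

Lemma expR_le_quad (y : R) : 0 <= y -> expR y <= 1 + y + y ^+ 2 * expR y.
Proof.
move=> y0; have e0 := expR_gt0 y.
have h : expR y <= 1 + y * expR y.
  have := expR_ge1Dx (- y); rewrite expRN => h.
  have := ler_wpM2r (ltW e0) h; rewrite mulVf ?gt_eqF//; lra.
have := ler_wpM2l y0 h; nra.
Qed.

Lemma sum_eqn (N a : nat) : \sum_(0 <= j < N) (j == a)%:R = (a < N)%N%:R :> R.
Proof.
elim: N => [|N IH]; first by rewrite big_geq.
rewrite big_nat_recr//= IH -natrD; congr (_%:R).
by case: eqP; lia.
Qed.

End Asymptotics.

Section LocalLimit.
Context {R : realType}.
Variables (p q : nat -> R) (mu b eta C2 : R).
Hypothesis p0 : forall j, 0 <= p j.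
Hypothesis p1 : series p @ \oo --> (1 : R).
Hypothesis pmu : series (fun j => p j * j%:R) @ \oo --> mu.
Hypothesis pgcd : is_gcd [set n | 0 < p n] 1.
Hypothesis eta01 : 0 < eta <= 1.
Hypothesis pT : forall M, (0 < M)%N ->
  \sum_(0 <= j < M) p j * j%:R ^+ 2 <= C2 * (M%:R : R) `^ (1 - eta).

Let mu0 : 0 < mu. Proof. exact: law_mean_gt0 p0 pmu pgcd. Qed.
Let ple1 N : \sum_(0 <= j < N) p j <= 1. Proof. exact: law_le1 p0 p1 N. Qed.

Let C20 : 0 <= C2.
Proof.
by have := pT (ltn0Sn 0); rewrite big_nat1 expr0n mulr0 powR1 mulr1.
Qed.

(** Exponential Markov inequality; the moment generating function of a
    truncated summand is expanded to second order. *)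
Lemma chernoff_truncated M k n (h : R) : 0 <= h ->
  iexp p M k (fun t => (t == n)%:R) <= expR (- (h * n%:R) + k%:R * (h * mu +
    h ^+ 2 * expR (h * M%:R) * \sum_(0 <= j < M) p j * j%:R ^+ 2)).
Proof.
move=> h0; set T := \sum_(0 <= j < M) _; set E := expR (h * M%:R).
apply: (@le_trans _ _
    (iexp p M k (fun t => expR (- (h * n%:R)) * expR h ^+ t))).
  apply: le_iexp => // t; case: eqP => [->|_]; last first.
    by rewrite mulr_ge0 ?exprn_ge0 ?expR_ge0.
  by rewrite -expRM_natr -expRD addNr expR0.
rewrite iexpZ iexp_exp expRD ler_pM2l ?expR_gt0// expRM_natl.
apply: lerXn2r; rewrite ?nnegrE ?expR_ge0//.
  by rewrite sumr_ge0// => j _; rewrite mulr_ge0// exprn_ge0// expR_ge0.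
apply: le_trans (expR_ge1Dx _).
apply: (@le_trans _ _ (\sum_(0 <= j < M) (p j + h * (p j * j%:R) +
    h ^+ 2 * E * (p j * j%:R ^+ 2)))).
  rewrite big_nat [leRHS]big_nat; apply: ler_sum => j /andP[_ jM].
  rewrite -expRM_natr (_ : _ + _ = p j * (1 + h * j%:R +
     (h * j%:R) ^+ 2 * E)); last by ring.
  apply: ler_wpM2l => //.
  apply: le_trans (expR_le_quad _) _; first by rewrite mulr_ge0.
  rewrite lerD2l; apply: ler_wpM2l; first exact: sqr_ge0.
  by rewrite ler_expR; apply: ler_wpM2l => //; rewrite ler_nat ltnW.
rewrite !big_split/= -!mulr_sumr -/T addrA; apply: lerD => //.
apply: lerD; first exact: ple1.
by apply: ler_wpM2l => //; exact: law_mean_le p0 pmu M.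
Qed.

(** Large deviations without large summands: if all summands are at most
    [e * n], then [S_k = n] with [k * mu <= (1 - x) * n] has probability
    [O (n ^ (- s))] for any prescribed [s], if [e] is small enough. *)
Lemma no_jump_deviation (x s : R) : 0 < x -> 0 < s -> exists (e : R) n0,
  [/\ 0 < e <= 1, (0 < n0)%N & forall n k M, (n0 <= n)%N ->
    k%:R * mu <= (1 - x) * n%:R -> M%:R <= e * n%:R ->
    iexp p M k (fun t => (t == n)%:R) <= expR 1 * (n%:R : R) `^ (- s)].
Proof.
move=> x0 s0; case/andP: eta01 => eta0 eta1.
have [l [l0 lE]] : exists l : R, 0 < l /\ l * x = s.
  by exists (s / x); rewrite divr_gt0// divfK// gt_eqF.
have [e [e0 e1 le]] : exists e : R, [/\ 0 < e, e <= 1 & l * e <= eta / 2].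
  exists (Num.min 1 (eta / 2 / l)); split.
  - by rewrite lt_min ltr01/= !divr_gt0.
  - by rewrite ge_min lexx.
  - by rewrite mulrC -ler_pdivlMr// ge_min lexx orbT.
pose A := l ^+ 2 * C2 / mu * (8 / eta) ^+ 2.
have A0 : 0 <= A.
  by rewrite /A mulr_ge0 ?sqr_ge0// divr_ge0// ?(ltW mu0)// mulr_ge0// sqr_ge0.
have d0 : 0 < (A + 1)^-1 by rewrite invr_gt0; lra.
have s4 : 0 < eta / 4 by rewrite divr_gt0.
have [n0 n00 H] := powR_vanish s4 d0.
exists e, n0; split=> //; first by rewrite e0.
move=> n k M nn kmu Men.
have n1 : (0 < n)%N by exact: leq_trans nn.
have N0 : 0 < (n%:R : R) by rewrite ltr0n.
have N1 : 1 <= (n%:R : R) by rewrite ler1n.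
have ln0 : 0 <= ln (n%:R : R) by exact: ln_ge0.
(* the tilt [h] makes [exp (- h x n)] equal to [n ^ (- s)] *)
pose h := l * ln n%:R / n%:R.
have h0 : 0 <= h by rewrite /h divr_ge0// mulr_ge0// ltW.
apply: le_trans (chernoff_truncated _ _ _ h0) _.
rewrite /powR gt_eqF// -expRD ler_expR.
have hn : h * n%:R = l * ln n%:R by rewrite /h divfK// gt_eqF.
have hk : k%:R * (h * mu) <= l * ln n%:R - s * ln n%:R.
  have := ler_wpM2l h0 kmu; rewrite [h * ((1 - x) * _)]mulrCA hn -lE; lra.
suff : k%:R * (h ^+ 2 * expR (h * M%:R) *
    \sum_(0 <= j < M) p j * j%:R ^+ 2) <= 1 by rewrite hn; lra.
have kN : k%:R <= n%:R / mu.
  rewrite ler_pdivlMr//; apply: le_trans kmu _; nra.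
have E1 : expR (h * M%:R) <= n%:R `^ (eta / 2).
  rewrite /powR gt_eqF// ler_expR; apply: (@le_trans _ _ (h * (e * n%:R))).
    exact: ler_wpM2l.
  by rewrite mulrCA hn mulrA; apply: ler_wpM2r => //; lra.
have T1 : \sum_(0 <= j < M) p j * j%:R ^+ 2 <= C2 * n%:R `^ (1 - eta).
  case: M Men {E1} => [|M] Men.
    by rewrite big_geq// mulr_ge0// powR_ge0.
  apply: le_trans (pT (ltn0Sn M)) _; apply: ler_wpM2l => //.
  apply: ge0_ler_powR; rewrite ?nnegrE//; first by lra.
  by apply: le_trans Men _; rewrite ler_piMl.
have T0 : 0 <= \sum_(0 <= j < M) p j * j%:R ^+ 2.
  by rewrite sumr_ge0// => j _; rewrite mulr_ge0// sqr_ge0.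
apply: (@le_trans _ _ (n%:R / mu * (h ^+ 2 * n%:R `^ (eta / 2) *
    (C2 * n%:R `^ (1 - eta))))).
  apply: ler_pM => //.
    by rewrite mulr_ge0// mulr_ge0 ?sqr_ge0 ?expR_ge0.
  apply: ler_pM => //; first by rewrite mulr_ge0 ?sqr_ge0 ?expR_ge0.
  by apply: ler_wpM2l => //; exact: sqr_ge0.
have PE : (n%:R : R) `^ (eta / 2) * n%:R `^ (1 - eta) =
    n%:R * n%:R `^ (- (eta / 2)).
  rewrite -{3}[n%:R](@powRr1 R)// -!powRD ?(gt_eqF N0) ?implybT//.
  by congr (_ `^ _); field.
have -> : n%:R / mu * (h ^+ 2 * n%:R `^ (eta / 2) * (C2 * n%:R `^ (1 - eta))) =
    l ^+ 2 * C2 / mu * (ln n%:R ^+ 2 * n%:R `^ (- (eta / 2))).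
  have -> : h ^+ 2 * n%:R `^ (eta / 2) * (C2 * n%:R `^ (1 - eta)) =
     h ^+ 2 * C2 * (n%:R * n%:R `^ (- (eta / 2))) by rewrite -PE; ring.
  by rewrite /h; field; rewrite !gt_eqF.
have Ln : ln n%:R ^+ 2 * n%:R `^ (- (eta / 2)) <=
    (8 / eta) ^+ 2 * (n%:R : R) `^ (- (eta / 4)).
  have h8 : 0 < eta / 8 by rewrite divr_gt0.
  have := ln_le_powR h8 n1; rewrite invf_div => hl.
  have h2 : ln n%:R ^+ 2 <= (8 / eta * n%:R `^ (eta / 8)) ^+ 2 :> R.
    by rewrite ler_pXn2r ?nnegrE// mulr_ge0 ?powR_ge0// divr_ge0// ltW.
  apply: le_trans (ler_wpM2r (powR_ge0 _ _) h2) _.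
  rewrite exprMn -mulrA [(_ `^ _) ^+ 2]expr2 -!powRD ?(gt_eqF N0) ?implybT//.
  rewrite le_eqVlt; apply/orP; left; apply/eqP; congr (_ * _ `^ _).
  by field.
have LC : 0 <= l ^+ 2 * C2 / mu.
  by rewrite divr_ge0// ?(ltW mu0)// mulr_ge0// sqr_ge0.
apply: le_trans (ler_wpM2l LC Ln) _.
rewrite mulrA -/A; apply: le_trans (ler_wpM2l A0 (H n nn)) _.
by rewrite ler_pdivrMr; lra.
Qed.

Hypothesis b1 : 1 < b.
Hypothesis qb : regvar q b.
Hypothesis pq : forall A x d : R, 0 < A -> 0 < x -> 0 < d -> exists n0,
  forall n K j, (n0 <= n)%N -> K%:R <= A * n%:R -> x * n%:R <= j%:R ->
  (\sum_(1 <= k < K) q k * k%:R) * p j <= d * q n.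

Let b0 : 0 < b. Proof. exact: lt_trans ltr01 b1. Qed.
Let q0 n : (0 < n)%N -> 0 < q n. Proof. exact: regvar_gt0 qb. Qed.

(** A sum of [k <= (1 - x) n / mu] summands that reaches [n] either contains a
    summand of size at least [e n], which [pq] controls, or falls under the large
    deviation bound. *)
Lemma few_summands_negligible (x d : R) : 0 < x < 1 -> 0 < d -> exists n0,
  forall n K, (n0 <= n)%N -> K%:R * mu <= (1 - x) * n%:R ->
  \sum_(1 <= k < K.+1) q k * conv p k n <= d * q n.
Proof.
move=> /andP[x0 x1] d0.
have bb : b < b + 1 by lra.
have [c [m [c0 m0 ql]]] := regvar_lower qb bb.
have s0 : 0 < b + 2 by rewrite addr_gt0.
have [e [n1 [/andP[e0 e1] n10 dev]]] := no_jump_deviation x0 s0.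
have [Cq Cq0 qC] := regvar_summable qb b1.
have E0 : 0 < expR 1 :> R by exact: expR_gt0.
have [D [D0 DE]] : exists D : R, 0 < D /\ D * (expR 1 * Cq) = d / 2 * c.
  exists (d / 2 * c / (expR 1 * Cq)); split; first by rewrite !divr_gt0 ?mulr_gt0 ?divr_gt0.
  by rewrite divfK// gt_eqF// mulr_gt0.
have [n2 n20 van] := powR_vanish ltr01 D0.
have A0 : 0 < mu^-1 + 1 by rewrite ltr_wpDl// invr_ge0 ltW.
have e20 : 0 < e / 2 by rewrite divr_gt0.
have d20 : 0 < d / 2 by rewrite divr_gt0.
have [n3 jump] := pq A0 e20 d20.
have [n4 n4e] := exists_natr_ge (2 / e).
exists (m + n1 + n2 + n3 + n4 + 1)%N => n K nn Kmu.
have nr : (1 : R) <= n%:R by rewrite ler1n; nlia.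
have n40 : 2 / e <= n%:R by apply: le_trans n4e _; rewrite ler_nat; nlia.
have en2 : 2 <= e * n%:R by rewrite -ler_pdivrMl// mulrC.
pose M := Num.truncn (e * n%:R).
have Me : M%:R <= e * n%:R by rewrite truncn_le; lra.
have Me' : e * n%:R < M.+1%:R by exact: truncnS_gt.
have Mn : (M <= n.+1)%N.
  by rewrite -(ler_nat R) -natr1; apply: le_trans Me _; nra.
have KA : K.+1%:R <= (mu^-1 + 1) * n%:R.
  rewrite -natr1 mulrDl mul1r; apply: lerD => //.
  rewrite ler_pdivlMl// mulrC; apply: le_trans Kmu _; nra.
case: K Kmu KA => [|K] Kmu KA.
  by rewrite big_geq// mulr_ge0// ?(ltW d0)// ltW// q0//; nlia.
pose W := \sum_(1 <= k < K.+2) q k * k%:R.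
have W0 : 0 < W.
  rewrite /W big_ltn// mulr1 ltr_pwDl ?q0// big_nat sumr_ge0// => k /andP[k1 _].
  by rewrite mulr_ge0// ltW// q0//; nlia.
pose sg := d / 2 * q n / W.
have qn0 : 0 < q n by apply: q0; nlia.
have sg0 : 0 <= sg by rewrite /sg !mulr_ge0 ?invr_ge0// ltW.
have psg j : (M <= j < n.+1)%N -> p j <= sg.
  move=> /andP[Mj _]; rewrite /sg ler_pdivlMr// mulrC; apply: jump => //.
    by nlia.
  have : (M.+1%:R : R) <= j%:R + 1 by rewrite natr1 ler_nat ltnS.
  lra.
have convle k : (1 <= k < K.+2)%N ->
    conv p k n <= expR 1 * n%:R `^ (- (b + 2)) + k%:R * sg.
  move=> /andP[k1 kK]; apply: le_trans (iexp_one_jump _ _ _ _ _ _ _ _) _.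
  - exact: p0.
  - exact: ple1.
  - exact: Mn.
  - exact: psg.
  - exact: sg0.
  - by move=> t; exact: ler0n.
  - move=> t; apply: (@le_trans _ _ (\sum_(0 <= j < n.+1) (j == n - t)%N%:R)).
      apply: ler_sum => j _; rewrite ler_nat; case: eqP => // jt.
      by rewrite -jt addnK eqxx.
    by rewrite sum_eqn; case: (_ < _)%N.
  rewrite lerD2r; apply: dev => //; first by nlia.
  apply: le_trans Kmu; rewrite ler_pM2r// ler_nat; nlia.
apply: (@le_trans _ _ (\sum_(1 <= k < K.+2) (q k * (expR 1 * n%:R `^ (- (b + 2)))
    + sg * (q k * k%:R)))).
  rewrite big_nat [leRHS]big_nat; apply: ler_sum => k k1.
  rewrite (_ : _ + _ = q k * (expR 1 * n%:R `^ (- (b + 2)) + k%:R * sg)); last by ring.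
  apply: ler_wpM2l; last exact: convle.
  by rewrite ltW// q0//; case/andP: k1.
rewrite big_split/= -mulr_suml -mulr_sumr -/W.
have -> : sg * W = d / 2 * q n by rewrite /sg divfK// gt_eqF.
suff : (\sum_(1 <= k < K.+2) q k) * (expR 1 * n%:R `^ (- (b + 2))) <=
   d / 2 * q n by lra.
have P0 : 0 <= (n%:R : R) `^ (- (b + 2)) by exact: powR_ge0.
apply: (@le_trans _ _ (Cq * (expR 1 * n%:R `^ (- (b + 2))))).
  by apply: ler_wpM2r; [rewrite mulr_ge0// ltW|exact: qC].
have -> : (n%:R : R) `^ (- (b + 2)) = n%:R `^ (- (b + 1)) * n%:R `^ (- 1).
  rewrite -powRD; first by congr (_ `^ _); ring.
  by apply/implyP => _; rewrite gt_eqF//; lra.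
have B0 : 0 <= (n%:R : R) `^ (- (b + 1)) by exact: powR_ge0.
have v := van n (_ : (n2 <= n)%N); have {}v := v ltac:(nlia).
apply: (@le_trans _ _ (D * (expR 1 * Cq) * n%:R `^ (- (b + 1)))).
  rewrite (_ : Cq * _ = n%:R `^ (- 1) * (expR 1 * Cq) * n%:R `^ (- (b + 1))); last by ring.
  by apply: ler_wpM2r => //; apply: ler_wpM2r => //; rewrite mulr_ge0// ltW.
rewrite DE -mulrA; apply: ler_wpM2l; first exact: ltW.
by apply: ql; nlia.
Qed.

Lemma truncn_large (N0 : nat) : exists n0, forall n, (n0 <= n)%N ->
  (N0 <= Num.truncn (n%:R / mu))%N.
Proof.
have [m mP] := exists_natr_ge (N0%:R * mu); exists m => n mn.
rewrite truncn_ge_nat; last by rewrite divr_ge0// ltW.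
by rewrite ler_pdivlMr//; apply: le_trans mP _; rewrite ler_nat.
Qed.

Lemma truncn_bounds n : (Num.truncn (n%:R / mu))%:R * mu <= n%:R /\
  n%:R < (Num.truncn (n%:R / mu))%:R * mu + mu.
Proof.
have h : 0 <= n%:R / mu by rewrite divr_ge0// ltW.
have /andP[h1 h2] := truncn_itv h.
rewrite -ler_pdivlMr//; split=> //.
by move: h2; rewrite -natr1 ltr_pdivrMr// mulrDl mul1r.
Qed.

(** The normalisation [sum_k q k * P (S_k = n)]: indices [k >= (1 - c) n / mu]
    see an almost decreasing weight and together the renewal mass
    [1 / mu]. *)
Lemma normalisation_upper (d : R) : 0 < d -> exists n0, forall n K, (n0 <= n)%N ->
  \sum_(1 <= k < K) q k * conv p k n <=
  (1 + d) * q (Num.truncn (n%:R / mu)) / mu.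
Proof.
move=> d0.
have [C [m0 [C0 m00 lin]]] := regvar_linear qb b0 mu0.
have F0 : 0 < mu^-1 + 2 + C by rewrite ltr_wpDl// ?ltr_wpDl// addr_ge0// invr_ge0 ltW.
have [t [t0 t1 tE]] : exists t : R, [/\ 0 < t, t <= 1 &
    t * (mu^-1 + 2 + C) <= d / mu].
  exists (Num.min 1 (d / mu / (mu^-1 + 2 + C))); split.
  - by rewrite lt_min ltr01/= !divr_gt0.
  - by rewrite ge_min lexx.
  - by rewrite -ler_pdivlMr// ge_min lexx orbT.
have [c [m1 [c01 m10 near]]] := regvar_near qb t0.
have [m2 m20 dec] := regvar_almost_decreasing qb b0 t0.
have [m3 few] := few_summands_negligible c01 t0.
have [m4 ren] := renewal_theorem p0 p1 pmu pgcd t0.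
have [m5 large] := truncn_large (m0 + m1 + m2).
case/andP: c01 => c0 c1.
exists (m3 + m4 + m5 + 1)%N => n K nn.
set N := Num.truncn _.
have Nl : (m0 + m1 + m2 <= N)%N by apply: large; nlia.
have [Nmu muN] := truncn_bounds n; rewrite -/N in Nmu muN.
have qN : 0 < q N by apply: q0; nlia.
have nr : 0 <= (n%:R : R) by [].
pose K0 := Num.truncn ((1 - c) * n%:R / mu).
have K00 : 0 <= (1 - c) * n%:R / mu by rewrite divr_ge0// ?(ltW mu0)// mulr_ge0//; lra.
have /andP[K0a K0b] := truncn_itv K00; rewrite -/K0 in K0a K0b.
have cv0 k : 0 <= conv p k n by exact: conv_ge0.
apply: (@le_trans _ _ (\sum_(1 <= k < maxn K K0.+1) q k * conv p k n)).
  case: K => [|K].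
    rewrite big_geq// big_nat sumr_ge0// => k /andP[k1 _].
    by rewrite mulr_ge0// ltW// q0.
  rewrite [leRHS](@big_cat_nat _ _ _ K.+1)//=; last by rewrite leq_maxl.
  rewrite lerDl big_nat sumr_ge0// => k /andP[k1 _].
  by rewrite mulr_ge0// ltW// q0//; nlia.
rewrite (@big_cat_nat _ _ _ K0.+1)//=; last by rewrite leq_maxr.
have h1 : \sum_(1 <= k < K0.+1) q k * conv p k n <= t * q n.
  apply: few; first by nlia.
  by rewrite -ler_pdivlMr.
have h2 : q n <= C * q N by apply: lin; [nlia|rewrite mulrC].
have h3 k : (K0 < k)%N -> q k <= (1 + t) * q N.
  move=> Kk; have [Nk|kN] := leqP N k.
    by apply: dec => //; nlia.
  have a1 : (m1 <= N)%N by nlia.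
  have a2 : (1 - c) * N%:R <= k%:R.
    have : (1 - c) * n%:R / mu < k%:R.
      by apply: lt_le_trans K0b _; rewrite ler_nat.
    rewrite ltr_pdivrMr// => hk.
    rewrite -(ler_pM2r mu0); apply: le_trans (ltW hk).
    by rewrite -mulrA; apply: ler_wpM2l => //; lra.
  have a3 : k%:R <= (1 + c) * N%:R.
    have : (k%:R : R) <= N%:R by rewrite ler_nat ltnW.
    have : 0 <= c * (N%:R : R) by rewrite mulr_ge0// ltW.
    lra.
  by have [] := near N k a1 a2 a3.
have h4 : \sum_(K0.+1 <= k < maxn K K0.+1) q k * conv p k n <=
   (1 + t) * q N * (mu^-1 + t).
  apply: (@le_trans _ _ ((1 + t) * q N *
      \sum_(K0.+1 <= k < maxn K K0.+1) conv p k n)).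
    rewrite mulr_sumr big_nat [leRHS]big_nat; apply: ler_sum => k /andP[Kk _].
    by apply: ler_wpM2r => //; exact: h3.
  apply: ler_wpM2l; first by rewrite mulr_ge0 ?ltW//; lra.
  apply: (@le_trans _ _ (renewal p n)); last first.
    have := ren n ltac:(nlia); rewrite ler_norml => /andP[_]; lra.
  apply: le_trans (sum_conv_le p0 p1 pgcd (maxn K K0.+1) n).
  rewrite [leRHS](@big_cat_nat _ _ _ K0.+1)//=; last by rewrite leq_maxr.
  by rewrite lerDr sumr_ge0.
have h5 := ler_wpM2l (ltW t0) h2.
apply: le_trans (lerD (le_trans h1 h5) h4) _.
rewrite (_ : t * (C * q N) + _ = q N * (t * C + (1 + t) * (mu^-1 + t)));
  last by ring.
rewrite (_ : _ / mu = q N * ((1 + d) / mu)); last by ring.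
apply: ler_wpM2l; first exact: ltW.
have t2 : t * t <= t by rewrite ger_pMr.
move: tE; move: (mu^-1) => z; lra.
Qed.

Lemma expr_vanish (z d : R) : 0 <= z < 1 -> 0 < d ->
  exists n0, forall n, (n0 <= n)%N -> z ^+ n <= d.
Proof.
move=> /andP[z0 z1] d0.
have : (fun n => z ^+ n) @ \oo --> (0 : R) by apply: cvg_expr; rewrite ger0_norm.
move=> /cvgrPdist_le/(_ d d0)[n0 _ H]; exists n0 => n nn.
by have := H n nn; rewrite sub0r normrN ger0_norm// exprn_ge0.
Qed.

(** Ratio between the mass of completions of a prefix of length [m] and the
    normalisation. The partial sum of the renewal series at [r] up to
    [J = A r] is already complete, and [q] is nearly constant on
    [[m, m + J)] when [r] is small compared with [n]. *)
Theorem local_ratio (d : R) : 0 < d -> exists (r0 : nat) (x : R) (n0 : nat),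
  0 < x /\ forall n m r, (n0 <= n)%N ->
    `|m%:R - (Num.truncn (n%:R / mu))%:R| <= x * n%:R ->
    (r0 <= r)%N -> r%:R <= x * n%:R -> exists J, forall K,
    (1 - d) * \sum_(1 <= k < K) q k * conv p k n <=
    \sum_(0 <= j < J) q (m + j)%N * conv p j r.
Proof.
move=> d0.
have [t [t0 t1 td]] : exists t : R, [/\ 0 < t, t <= 4^-1 & 4 * t <= d].
  exists (Num.min 1 d / 4); split.
  - by rewrite divr_gt0// lt_min ltr01.
  - by rewrite -[leRHS]mul1r ler_pM2r ?invr_gt0// ge_min lexx.
  - by rewrite mulrC divfK// ge_min lexx orbT.
pose u := t / (2 * mu).
have u0 : 0 < u by rewrite divr_gt0// mulr_gt0.
have [m0 up] := normalisation_upper t0.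
have [c [m1 [/andP[c0 c1] m10 near]]] := regvar_near qb t0.
have [m2 ren] := renewal_theorem p0 p1 pmu pgcd u0.
pose phi := (1 + p 0%N) / 2.
have phi01 : 0 <= phi < 1.
  have := law0_lt1 p0 p1 pgcd; have := p0 0.
  by rewrite /phi => ? ?; apply/andP; split; lra.
have q4 : 0 < (4^-1 : R) by [].
(* [phi ^ A <= 1 / 4] beats the factor [2 ^ r] in the truncated renewal sum *)
have [A hA] := expr_vanish phi01 q4.
have h01 : 0 <= (2^-1 : R) < 1 by apply/andP; split; lra.
have p01 : 0 < 1 - p 0%N by rewrite subr_gt0; exact: law0_lt1 p0 p1 pgcd.
have up0 : 0 < u * (1 - p 0%N) by rewrite mulr_gt0.
have [m3 hm3] := expr_vanish h01 up0.
have [m5 large] := truncn_large (m1 + 1).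
have A1 : 0 < 2 * mu * (1 + A%:R) by rewrite !mulr_gt0// ltr_pwDl.
exists (m2 + m3)%N, (c / (2 * mu * (1 + A%:R))), (m0 + m5)%N.
split; first by rewrite divr_gt0.
set x := c / _.
have xE : x * (1 + A%:R) * (2 * mu) = c by rewrite /x; field; rewrite !gt_eqF// ltr_pwDl.
have x0 : 0 < x by rewrite /x divr_gt0.
clearbody x.
move=> n m r nn mN rr rn; exists (A * r)%N => K.
set N := Num.truncn _ in mN *.
have Nl : (m1 + 1 <= N)%N by apply: large; nlia.
have [Nmu muN] := truncn_bounds n; rewrite -/N in Nmu muN.
have qN : 0 < q N by apply: q0; nlia.
have nN : n%:R <= 2 * mu * N%:R.
  have : 1 <= (N%:R : R) by rewrite ler1n; nlia.
  nra.
have window j : (j < A * r)%N -> q N <= (1 + t) * q (m + j)%N.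
  move=> jA.
  have jr : j%:R <= A%:R * (x * n%:R) :> R.
    apply: le_trans (_ : (A * r)%:R <= _); first by rewrite ler_nat ltnW.
    by rewrite natrM; apply: ler_wpM2l.
  have cN : (1 + A%:R) * (x * n%:R) <= c * N%:R.
    rewrite -xE (_ : x * (1 + A%:R) * (2 * mu) * N%:R =
      (1 + A%:R) * (x * (2 * mu * N%:R))); last by ring.
    by rewrite ler_pM2l ?ler_pM2l// ltr_pwDl.
  have j0 : 0 <= (j%:R : R) by [].
  have xn0 : 0 <= x * n%:R by rewrite mulr_ge0// ltW.
  have Axn0 : 0 <= A%:R * (x * n%:R) by rewrite mulr_ge0.
  move: mN; rewrite ler_norml => /andP[mN1 mN2].
  have a1 : (m1 <= N)%N by nlia.
  have a2 : (1 - c) * N%:R <= (m + j)%:R by rewrite natrD; lra.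
  have a3 : (m + j)%:R <= (1 + c) * N%:R by rewrite natrD; lra.
  by have [_ ] := near N (m + j)%N a1 a2 a3.
set S := \sum_(1 <= k < K) _; set T := \sum_(0 <= j < _) _.
have S0 : 0 <= S.
  rewrite /S big_nat sumr_ge0// => k /andP[k1 _].
  by rewrite mulr_ge0 ?conv_ge0// ltW// q0.
have SU : S <= (1 + t) * q N / mu by apply: up; nlia.
have TL : q N * ((1 - t) / mu) <= (1 + t) * T.
  apply: (@le_trans _ _ (q N * \sum_(0 <= j < A * r) conv p j r)).
    apply: ler_wpM2l; first exact: ltW.
    apply: le_trans (sum_conv_ge p0 p1 pgcd (A * r) r).
    have := ren r ltac:(nlia); rewrite ler_norml => /andP[rl _].
    have : (1 - p 0%N)^-1 * 2 ^+ r * phi ^+ (A * r) <= u.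
      rewrite -mulrA exprM -exprMn mulrC ler_pdivrMr//.
      apply: le_trans (hm3 r ltac:(nlia)); apply: lerXn2r; rewrite ?nnegrE//.
        by rewrite mulr_ge0// exprn_ge0//; case/andP: phi01.
      have := hA A (leqnn A); lra.
    rewrite -/phi; have -> : (1 - t) / mu = mu^-1 - u - u.
      by rewrite /u; field; rewrite gt_eqF.
    lra.
  rewrite /T !mulr_sumr big_nat [leRHS]big_nat; apply: ler_sum => j /andP[_ jA].
  by rewrite mulrA; apply: ler_wpM2r; [exact: conv_ge0|exact: window].
have h1 : (1 - d) * S <= (1 - 4 * t) * S by apply: ler_wpM2r => //; lra.
apply: le_trans h1 _.
have h2 : (1 - 4 * t) * S <= (1 - 4 * t) * ((1 + t) * q N / mu).
  by apply: ler_wpM2l => //; lra.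
apply: le_trans h2 _.
have tp : 0 < 1 + t by lra.
rewrite -(ler_pM2l tp); apply: le_trans TL.
have -> : (1 + t) * ((1 - 4 * t) * ((1 + t) * q N / mu)) =
  q N / mu * ((1 - 4 * t) * (1 + t) ^+ 2) by ring.
have -> : q N * ((1 - t) / mu) = q N / mu * (1 - t) by ring.
by apply: ler_wpM2l; [rewrite divr_ge0// ltW|nra].
Qed.

End LocalLimit.

(** * Concentration of the remainder *)

Lemma cvg0_near {R : realType} (f : nat -> R) (e : R) :
  f n @[n --> \oo] --> (0 : R) -> 0 < e ->
  exists n0, forall n, (n0 <= n)%N -> f n <= e.
Proof.
move=> /cvgrPdist_le H e0; have [n0 _ h] := H e e0; exists n0 => n nn.
by have := h n nn; rewrite sub0r normrN; apply: le_trans; exact: ler_norm.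
Qed.

Section Concentration.
Context {R : realType}.
Variables (p : nat -> R) (mu : R).
Hypothesis p0 : forall j, 0 <= p j.
Hypothesis p1 : series p @ \oo --> (1 : R).
Hypothesis pmu : series (fun j => p j * j%:R) @ \oo --> mu.
Hypothesis mu0 : 0 < mu.

Let ple1 N : \sum_(0 <= j < N) p j <= 1. Proof. exact: law_le1 p0 p1 N. Qed.

Definition moment2 M : R := \sum_(0 <= j < M) p j * j%:R ^+ 2.

Let truncp_var_le M : (0 < M)%N ->
  \sum_(0 <= j < M) truncp p M j *
    (j%:R - \sum_(0 <= i < M) p i * i%:R) ^+ 2 <= moment2 M.
Proof. by move=> M0; rewrite (truncp_var M0 erefl) gerBl sqr_ge0. Qed.

(** Chebyshev's inequality for the summands truncated at [n]: replacing the
    larger ones by [0] only decreases the sum, and costs [m P (X >= n)] in the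
    other direction. *)
Lemma sum_conv_lower_tail m n (x : R) (a : nat) : (0 < n)%N -> 0 < x ->
  a%:R <= m%:R * (\sum_(0 <= j < n) p j * j%:R) - x ->
  \sum_(0 <= t < a.+1) conv p m t <= m%:R * moment2 n / x ^+ 2.
Proof.
move=> n0 x0 ax; rewrite -(@iexp_le_conv _ _ a.+1)//.
apply: le_trans (iexp_le_truncp p0 ple1 (M := n) _ m n0 _ _) _.
- by move=> t; exact: ler0n.
- move=> s t st; rewrite ler_nat; case: (leqP t a) => // ta.
  by rewrite (leq_trans st ta).
have h := chebyshev_lower (truncp1 p n0) (truncp_mean p n0) erefl
  (truncp_ge0 p0 ple1 n) x0 ax.
apply: le_trans h _.
apply: ler_wpM2r; first by rewrite invr_ge0 sqr_ge0.
by apply: ler_wpM2l => //; exact: truncp_var_le.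
Qed.

Lemma sum_conv_upper_tail m n (x : R) (a : nat) : (a < n)%N -> 0 < x ->
  m%:R * (\sum_(0 <= j < n) p j * j%:R) + x <= a.+1%:R ->
  1 - m%:R * moment2 n / x ^+ 2 - m%:R * ptail p n <=
  \sum_(0 <= t < a.+1) conv p m t.
Proof.
move=> an x0 ax; have n0 : (0 < n)%N by exact: leq_ltn_trans an.
rewrite -(@iexp_le_conv _ _ n)//.
have h := iexp_truncp_le p0 ple1 m n0 (F := fun t => (t <= a)%N%:R).
have {}h := h (fun t => (_ : 0 <= (t <= a)%N%:R <= 1)).
have h1 := h ltac:(by move=> t; case: leqP; rewrite ?lexx ?ler01).
have h2 : iexp (truncp p n) n m (fun t => (a.+1 <= t)%N%:R) <=
    m%:R * moment2 n / x ^+ 2.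
  have h2 := chebyshev_upper (truncp1 p n0) (truncp_mean p n0) erefl
    (truncp_ge0 p0 ple1 n) x0 ax.
  apply: le_trans h2 _.
  apply: ler_wpM2r; first by rewrite invr_ge0 sqr_ge0.
  by apply: ler_wpM2l => //; exact: truncp_var_le.
have h3 : iexp (truncp p n) n m (fun t => (t <= a)%N%:R) +
    iexp (truncp p n) n m (fun t => (a.+1 <= t)%N%:R) = 1.
  rewrite -iexpD -[RHS](iexp1 (truncp1 p n0) m); apply: eq_iexp => t.
  by case: leqP; rewrite /= ?addr0 ?add0r.
rewrite /ptail; lra.
Qed.

(** If the gap [s n] exceeds the fluctuations of [S_m], the remainder
    [n - S_m] left by [m = n / mu - s n] summands is unbounded but [o(n)] with
    probability tending to one. *)
Theorem remainder_concentrates (s : nat -> nat) :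
  (forall n, (0 < n)%N -> (0 < s n)%N) ->
  (s n)%:R / n%:R @[n --> \oo] --> (0 : R) ->
  n%:R * moment2 n / (s n)%:R ^+ 2 @[n --> \oo] --> (0 : R) ->
  (exists j, (0 < j)%N /\ 0 < p j) ->
  forall (r0 : nat) (x d : R), (0 < r0)%N -> 0 < x -> 0 < d ->
  exists n0, forall n, (n0 <= n)%N ->
  exists lo, [/\ (lo <= n)%N, (n - lo)%:R <= x * n%:R, (lo + r0 <= n)%N &
   1 - d <= \sum_(lo <= t < (n - r0).+1)
     conv p (Num.truncn (n%:R / mu) - s n) t].
Proof.
move=> s_gt0 so sT [j0 [j00 pj0]] r0 x d r00 x0 d0.
have [y [y0 yx y1]] : exists y : R, [/\ 0 < y, y <= x & y <= 1].
  exists (Num.min 1 x); rewrite lt_min ltr01 x0; split=> //.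
    by rewrite ge_min lexx orbT.
  by rewrite ge_min lexx.
have d6 : 0 < d / 6 by rewrite divr_gt0.
(* thresholds that turn every error term into a small multiple of [d] *)
have e1 : 0 < y / (8 * mu) by rewrite divr_gt0// mulr_gt0.
have e2 : 0 < d / 6 * mu ^+ 3 / 4 by rewrite !mulr_gt0// ?exprn_gt0.
have e2' : 0 < d / 6 * mu * y ^+ 2 / 64 by rewrite !mulr_gt0// ?exprn_gt0.
have e3 : 0 < y * mu / 8 by rewrite !mulr_gt0.
have e4 : 0 < d / 6 * mu by rewrite mulr_gt0.
have e5 : 0 < p j0 * j0%:R ^+ 2 by rewrite mulr_gt0// exprn_gt0// ltr0n.
have [n1 h1] := cvg0_near so e1.
have [n1' h1'] := cvg0_near so (ltr01 : 0 < (1 : R)).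
have [n2 h2] := cvg0_near sT e2.
have [n2' h2'] := cvg0_near sT e2'.
have [n2'' h2''] := cvg0_near sT (ltr01 : 0 < (1 : R)).
have [n3 h3] := series_near pmu e3.
have [n4 h4] := series_near pmu e4.
have [n5 n5P] := exists_natr_ge (8 * mu / (5 * y) + r0%:R / y + 1 / y).
have [n6 n6P] := exists_natr_ge ((2 * r0%:R / mu) ^+ 2 / (p j0 * j0%:R ^+ 2) + 1).
exists (n1 + n1' + n2 + n2' + n2'' + n3 + n4 + n5 + n6 + j0 + 1)%N => n nn.
have n0 : (0 < n)%N by nlia.
have nr : 0 < (n%:R : R) by rewrite ltr0n.
have sr : 0 < ((s n)%:R : R) by rewrite ltr0n s_gt0.
have s1 := h1 n ltac:(nlia); have s1' := h1' n ltac:(nlia).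
have T2 := h2 n ltac:(nlia); have T2' := h2' n ltac:(nlia).
have T2'' := h2'' n ltac:(nlia).
have M3 := h3 n ltac:(nlia); have M4 := h4 n ltac:(nlia).
have N5 : 8 * mu / (5 * y) + r0%:R / y + 1 / y <= n%:R.
  by apply: le_trans n5P _; rewrite ler_nat; nlia.
have N6 : (2 * r0%:R / mu) ^+ 2 / (p j0 * j0%:R ^+ 2) + 1 <= n%:R.
  by apply: le_trans n6P _; rewrite ler_nat; nlia.
have jn : (j0 < n)%N by nlia.
clear h1 h1' h2 h2' h2'' h3 h4 n5P n6P so sT nn.
rewrite ler_pdivrMr// in s1; rewrite ler_pdivrMr// mul1r in s1'.
have s20 : 0 < ((s n)%:R : R) ^+ 2 by exact: exprn_gt0.
rewrite ler_pdivrMr// in T2; rewrite ler_pdivrMr// in T2'.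
rewrite ler_pdivrMr// mul1r in T2''.
set mn := \sum_(0 <= j < n) p j * j%:R in M3 M4 *.
have mnmu : mn <= mu by exact: law_mean_le p0 pmu n.
have mn0 : 0 <= mn by rewrite sumr_ge0// => j _; rewrite mulr_ge0.
have tau : p j0 * j0%:R ^+ 2 <= moment2 n.
  rewrite /moment2 big_mkord (bigD1 (Ordinal jn))//= lerDl sumr_ge0// => j _.
  by rewrite mulr_ge0// sqr_ge0.
have T0 : 0 <= moment2 n by apply: le_trans tau; exact: ltW.
have sbig : r0%:R <= mu * (s n)%:R / 2.
  rewrite leNgt; apply/negP => h.
  have h' : (s n)%:R < 2 * r0%:R / mu by rewrite ltr_pdivlMr//; lra.
  have h2 : (s n)%:R ^+ 2 < (2 * r0%:R / mu) ^+ 2.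
    by rewrite ltr_pXn2r// nnegrE ?ltW// (lt_trans sr).
  have : (2 * r0%:R / mu) ^+ 2 < n%:R * (p j0 * j0%:R ^+ 2).
    by rewrite -ltr_pdivrMr//; lra.
  have : n%:R * (p j0 * j0%:R ^+ 2) <= n%:R * moment2 n by rewrite ler_pM2l.
  lra.
set N := Num.truncn (n%:R / mu).
have hN : 0 <= n%:R / mu by rewrite divr_ge0// ltW.
have /andP[] := truncn_itv hN; rewrite -/N -natr1 ler_pdivlMr// ltr_pdivrMr// => N1 N2.
have r01 : 1 <= (r0%:R : R) by rewrite ler1n.
have yn : 8 * mu <= 5 * (y * n%:R) /\ r0%:R + 1 <= y * n%:R.
  have a1 : 0 <= 8 * mu / (5 * y) by rewrite divr_ge0// ?mulr_ge0// ltW.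
  have a2 : 0 <= r0%:R / y by rewrite divr_ge0// ltW.
  have a3 : 0 <= 1 / y by rewrite divr_ge0// ltW.
  have b1 : 8 * mu / (5 * y) <= n%:R by lra.
  have b2 : (r0%:R + 1) / y <= n%:R by rewrite mulrDl; lra.
  rewrite ler_pdivrMr ?mulr_gt0// in b1; rewrite ler_pdivrMr// in b2.
  by split; lra.
case: yn => yn1 yn2.
have smu : mu * (s n)%:R <= y * n%:R / 8.
  have := ler_wpM2l (ltW mu0) s1.
  rewrite (_ : mu * (y / (8 * mu) * n%:R) = y * n%:R / 8)//.
  by field; rewrite gt_eqF.
have ynn : y * n%:R <= n%:R by rewrite ler_piMl// ltW.
have sN : (s n <= N)%N.
  rewrite -(ler_nat R) -(ler_pM2r mu0); lra.
set m := (N - s n)%N.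
have mE : (m%:R : R) = N%:R - (s n)%:R by rewrite /m natrB.
have m0 : 0 <= (m%:R : R) by [].
have mN : m%:R * mu <= n%:R - mu * (s n)%:R by rewrite mE; lra.
have mN' : n%:R - mu - mu * (s n)%:R <= m%:R * mu by rewrite mE; lra.
have mle : m%:R * mu <= n%:R.
  have : 0 <= mu * (s n)%:R by rewrite mulr_ge0// ltW.
  lra.
have yn0 : 0 <= y * n%:R by rewrite mulr_ge0// ltW.
have /andP[ty1 ty2] := truncn_itv yn0.
set ty := Num.truncn (y * n%:R) in ty1 ty2; rewrite -natr1 in ty2.
have tyn : (ty <= n)%N by rewrite -(ler_nat R); lra.
have tyr : (r0 <= ty)%N by rewrite -ltnS -(ltr_nat R) -natr1; lra.
exists (n - ty)%N; split; first by rewrite leq_subr.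
- by rewrite subKn//; apply: le_trans ty1 _; apply: ler_wpM2r => //; exact: ltW.
- by clear -tyn tyr; lia.
have mT : m%:R * moment2 n <= n%:R / mu * moment2 n.
  by apply: ler_wpM2r => //; rewrite ler_pdivlMr.
have lower : \sum_(0 <= t < n - ty) conv p m t <= d / 6.
  have [->|lo0] := posnP (n - ty)%N; first by rewrite big_geq// ltW.
  have X0 : 0 < y * n%:R / 8 by rewrite !mulr_gt0.
  have loE : ((n - ty).-1%:R : R) = n%:R - ty%:R - 1.
    by rewrite -natrB// -[in RHS](prednK lo0) -natr1 addrK.
  rewrite -(prednK lo0).
  have ax : (n - ty).-1%:R <= m%:R * mn - y * n%:R / 8.
    rewrite loE; have : m%:R * (mu - y * mu / 8) <= m%:R * mn.
      by apply: ler_wpM2l => //; exact: ltW.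
    have : (m%:R * mu) * (y / 8) <= n%:R * (y / 8).
      by apply: ler_wpM2r => //; rewrite divr_ge0// ltW.
    lra.
  apply: le_trans (sum_conv_lower_tail n0 X0 ax) _.
  rewrite ler_pdivrMr ?exprn_gt0//; apply: le_trans mT _.
  have h : moment2 n <= d / 6 * mu * y ^+ 2 / 64 * n%:R.
    have : n%:R * moment2 n <= n%:R * (d / 6 * mu * y ^+ 2 / 64 * n%:R).
      apply: le_trans T2' _; rewrite [leRHS]mulrCA; apply: ler_wpM2l; first exact: ltW.
      by rewrite -expr2 ler_pXn2r// nnegrE ltW.
    by rewrite ler_pM2l.
  apply: le_trans (ler_wpM2l hN h) _.
  by rewrite le_eqVlt; apply/orP; left; apply/eqP; field; rewrite gt_eqF.
have upper : 1 - d / 6 - d / 6 <= \sum_(0 <= t < (n - r0).+1) conv p m t.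
  have an : (n - r0 < n)%N by clear -r00 n0; lia.
  have X0 : 0 < mu * (s n)%:R / 2 by rewrite !mulr_gt0.
  have r0n : (r0 <= n)%N by apply: leq_trans tyr tyn.
  have ax : m%:R * mn + mu * (s n)%:R / 2 <= (n - r0).+1%:R.
    rewrite -[(n - r0).+1%:R]natr1 (natrB _ r0n).
    have : m%:R * mn <= m%:R * mu by exact: ler_wpM2l.
    lra.
  apply: le_trans (sum_conv_upper_tail an X0 ax).
  have a1 : m%:R * moment2 n / (mu * (s n)%:R / 2) ^+ 2 <= d / 6.
    rewrite ler_pdivrMr ?exprn_gt0//; apply: le_trans mT _.
    rewrite mulrAC ler_pdivrMr//; apply: le_trans T2 _.
    by rewrite le_eqVlt; apply/orP; left; apply/eqP; field.
  have a2 : m%:R * ptail p n <= d / 6.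
    apply: (@le_trans _ _ (n%:R / mu * ptail p n)).
      by apply: ler_wpM2r; [exact: ptail_ge0 p0 p1 n|rewrite ler_pdivlMr].
    rewrite mulrAC ler_pdivrMr//.
    have := ptail_mean p0 p1 pmu n; rewrite -/mn; lra.
  lra.
have := upper; rewrite (@big_cat_nat _ _ _ (n - ty)%N)//=.
  lra.
by clear -tyr; lia.
Qed.

End Concentration.

(** * Fluctuations of partial sums above the mean *)

Section Fluctuations.
Context {R : realType}.
Variables (p : nat -> R) (mu : R).
Hypothesis p0 : forall j, 0 <= p j.
Hypothesis p1 : series p @ \oo --> (1 : R).
Hypothesis pmu : series (fun j => p j * j%:R) @ \oo --> mu.
Hypothesis mu0 : 0 < mu.

Let ple1 N : \sum_(0 <= j < N) p j <= 1. Proof. exact: law_le1 p0 p1 N. Qed.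

(** [y] does not exceed the order of magnitude of the upward fluctuations of
    [S_m] around its mean, for [m] of the order of [n]. *)
Definition upward_spread (y : nat -> R) : Prop :=
  forall C : R, 0 < C -> exists (c : R) n0, 0 < c /\
  forall n m a, (n0 <= n)%N -> n%:R <= 2 * mu * m%:R -> m%:R * mu <= n%:R ->
    a%:R <= m%:R * mu + C * y n ->
    c <= 1 - \sum_(0 <= t < a.+1) conv p m t.

Let sum_conv_le_truncp M m a : (0 < M)%N ->
  iexp (truncp p M) M m (fun t => (a < t)%N%:R) <=
  1 - \sum_(0 <= t < a.+1) conv p m t.
Proof.
move=> M0; rewrite -(@iexp_le_conv _ _ a.+1)//.
have h : iexp p a.+1 m (fun t => (t <= a)%N%:R) <=
    iexp (truncp p M) M m (fun t => (t <= a)%N%:R).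
  apply: iexp_le_truncp => //.
  move=> s t st; rewrite ler_nat; case: (leqP t a) => // ta.
  by rewrite (leq_trans st ta).
have h3 : iexp (truncp p M) M m (fun t => (t <= a)%N%:R) +
    iexp (truncp p M) M m (fun t => (a < t)%N%:R) = 1.
  rewrite -iexpD -[RHS](iexp1 (truncp1 p M0) m); apply: eq_iexp => t.
  by case: leqP; rewrite /= ?addr0 ?add0r.
lra.
Qed.

Let pmean M : R := \sum_(0 <= j < M) p j * j%:R.

(** Gaussian regime. With the summands truncated at a small multiple of [y n],
    split [S_m] into [k * k] blocks; each exceeds its mean by a fifth of its
    standard deviation with probability at least [1 / 40], and then the total
    excess is of order [k] standard deviations of [S_m]. *)
Theorem spread_of_variance (y : nat -> R) (a0 : R) : 0 < a0 ->
  (forall B : R, exists n0, forall n, (n0 <= n)%N -> B <= y n) ->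
  (forall x : R, 0 < x -> exists n0, forall n, (n0 <= n)%N ->
    let M := Num.truncn (x * y n) in
    a0 * y n ^+ 2 <= n%:R * (moment2 p M - pmean M ^+ 2)) ->
  (forall x : R, 0 < x -> exists n0, forall n, (n0 <= n)%N ->
    n%:R * (mu - pmean (Num.truncn (x * y n))) <= mu * y n) ->
  upward_spread y.
Proof.
move=> a00 yoo yvar ymean C C0.
pose w := Num.sqrt (a0 / (4 * mu)).
have w0 : 0 < w by rewrite sqrtr_gt0 divr_gt0// mulr_gt0.
have wE : w ^+ 2 = a0 / (4 * mu) by rewrite sqr_sqrtr// ltW// divr_gt0// mulr_gt0.
clearbody w.
have [k [k0 kC]] : exists k, (0 < k)%N /\ C + 3 <= k%:R * w / 5.
  have [k kP] := exists_natr_ge (5 * (C + 3) / w).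
  exists k.+1; split=> //; rewrite ler_pdivlMr// -ler_pdivrMr//.
  rewrite [(C + 3) * 5]mulrC; apply: le_trans kP _; rewrite ler_nat; exact: leqnSn.
have kr : 0 < (k%:R : R) by rewrite ltr0n.
pose x := w / k%:R.
have x0 : 0 < x by rewrite divr_gt0.
have xE : x * k%:R = w by rewrite /x divfK// gt_eqF.
clearbody x.
have [n1 h1] := yvar x x0.
have [n2 h2] := ymean x x0.
have [n3 h3] := yoo (Num.max (1 / x) ((k * k)%:R * mu)).
have [n4 n4P] := exists_natr_ge (4 * mu * (k * k)%:R).
exists (40^-1 ^+ (k * k)), (n1 + n2 + n3 + n4 + 1)%N; split.
  by rewrite exprn_gt0.
move=> n m a nn nm mn am.
have {}h1 := h1 n ltac:(nlia); have {}h2 := h2 n ltac:(nlia).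
have := h3 n ltac:(nlia); rewrite ge_max => /andP[yx yk].
have nb : 4 * mu * (k * k)%:R <= n%:R.
  by apply: le_trans n4P _; rewrite ler_nat; nlia.
have n0 : 0 < (n%:R : R) by rewrite ltr0n; nlia.
clear h3 n4P nn yoo yvar ymean.
have y0 : 0 < y n by apply: lt_le_trans yx; rewrite divr_gt0.
set M := Num.truncn (x * y n) in h1 h2.
have xy0 : 0 <= x * y n by rewrite mulr_ge0// ltW.
have /andP[M1 M2] := truncn_itv xy0; rewrite -/M in M1 M2.
have M0 : (0 < M)%N.
  by rewrite /M truncn_gt0 mulrC -ler_pdivrMr.
(* [k * k] blocks of length [l]; truncation below [x * y n] keeps every summand
   within one standard deviation of a block *)
pose l := (m %/ (k * k))%N.
have kk0 : (0 < k * k)%N by rewrite muln_gt0 k0.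
have kkr : 0 < ((k * k)%:R : R) by rewrite ltr0n.
have ml : (m < l.+1 * (k * k))%N by rewrite /l ltn_ceil.
have lm : (l * (k * k) <= m)%N by rewrite leq_trunc_div.
have mlr : m%:R <= (l%:R + 1) * (k * k)%:R :> R.
  by rewrite natr1 -natrM ler_nat ltnW.
have lmr : l%:R * (k * k)%:R <= m%:R :> R by rewrite -natrM ler_nat.
have mk2 : 2 * (k * k)%:R <= m%:R :> R.
  have : 2 * mu * (2 * (k * k)%:R) <= 2 * mu * m%:R by lra.
  by rewrite ler_pM2l// mulr_gt0.
have l2 : m%:R <= 2 * (l%:R * (k * k)%:R) :> R by lra.
set V := moment2 p M - pmean M ^+ 2 in h1.
have VE : \sum_(0 <= j < M) truncp p M j * (j%:R - pmean M) ^+ 2 = V.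
  by rewrite (truncp_var M0 erefl).
have lV : x ^+ 2 * y n ^+ 2 <= l%:R * V.
  have nV0 : 0 <= n%:R * V by apply: le_trans h1; rewrite mulr_ge0 ?sqr_ge0// ltW.
  have V0 : 0 <= V by rewrite pmulr_rge0 in nV0.
  have : a0 * y n ^+ 2 <= 4 * mu * (l%:R * (k * k)%:R) * V.
    apply: le_trans h1 _; apply: ler_wpM2r => //.
    have : mu * m%:R <= mu * (2 * (l%:R * (k * k)%:R)) by rewrite ler_pM2l.
    lra.
  have -> : a0 = w ^+ 2 * (4 * mu) by rewrite wE divfK// gt_eqF// mulr_gt0.
  rewrite -xE exprMn natrM.
  have mk : 0 < 4 * mu * (k%:R * k%:R : R) by rewrite !mulr_gt0.
  rewrite (_ : x ^+ 2 * k%:R ^+ 2 * (4 * mu) * y n ^+ 2 =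
    (4 * mu * (k%:R * k%:R)) * (x ^+ 2 * y n ^+ 2)); last by ring.
  rewrite (_ : 4 * mu * (l%:R * (k%:R * k%:R)) * V =
    (4 * mu * (k%:R * k%:R)) * (l%:R * V)); last by ring.
  by rewrite ler_pM2l.
have xy20 : 0 < x ^+ 2 * y n ^+ 2 by rewrite mulr_gt0// exprn_gt0.
have lV0 : 0 < l%:R * V by apply: lt_le_trans lV.
have s0 : 0 < Num.sqrt (l%:R * V) by rewrite sqrtr_gt0.
have sE : Num.sqrt (l%:R * V) ^+ 2 = l%:R * V by rewrite sqr_sqrtr// ltW.
set s := Num.sqrt _ in s0 sE.
have sx : x * y n <= s.
  rewrite -(@ler_pXn2r _ 2)// ?nnegrE ?(ltW s0)//.
  by rewrite sE exprMn.
have mean_le : 0 <= pmean M <= M%:R.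
  apply/andP; split; first by rewrite sumr_ge0// => j _; rewrite mulr_ge0.
  apply: (@le_trans _ _ (\sum_(0 <= j < M) p j * M%:R)).
    rewrite /pmean big_nat [leRHS]big_nat; apply: ler_sum => j /andP[_ jM].
    by apply: ler_wpM2l => //; rewrite ler_nat ltnW.
  by rewrite -mulr_suml ler_piMl.
have block : 40^-1 <= iexp (truncp p M) M l
    (fun t => (l%:R * pmean M + s / 5 <= t%:R)%R%:R).
  apply: (paley_zygmund (truncp_ge0 p0 ple1 M) (truncp1 p M0)
    (truncp_mean p M0) VE (y := M%:R) _ s0 sE _ (lexx _)).
  - move=> j jM; case/andP: mean_le => m1 m2.
    have j0 : 0 <= (j%:R : R) by [].
    have jM' : (j%:R : R) <= M%:R by rewrite ler_nat ltnW.
    rewrite -real_normK ?num_real// lerXn2r ?nnegrE//.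
    by rewrite ler_norml -/(pmean M); apply/andP; split; lra.
  - apply: le_trans lV; rewrite -exprMn lerXn2r ?nnegrE//.
have h40 : 0 <= (40^-1 : R) by [].
apply: le_trans (sum_conv_le_truncp m a M0).
apply: le_trans (_ : iexp (truncp p M) M l
    (fun t => (l%:R * pmean M + s / 5 <= t%:R)%R%:R) ^+ (k * k) <= _).
  by apply: lerXn2r => //; rewrite nnegrE//; apply: le_trans block.
have hb := @iexp_ge_blocks R (truncp p M) M (truncp_ge0 p0 ple1 M) (k * k) l
  (l%:R * pmean M + s / 5).
apply: le_trans hb _.
have lm' : (k * k * l <= m)%N by rewrite mulnC.
have hm := @iexp_ge_mono R (truncp p M) M (truncp_ge0 p0 ple1 M) (truncp1 p M0)
  _ _ ((k * k)%:R * (l%:R * pmean M + s / 5)) lm'.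
apply: le_trans hm _.
apply: le_iexp; first exact: truncp_ge0.
move=> t; rewrite ler_nat; case: leP => // ht.
suff -> : (a < t)%N by [].
rewrite -(ltr_nat R); apply: le_lt_trans am _; apply: lt_le_trans ht.
have e1 : m%:R * (mu - pmean M) <= y n.
  have d0 : 0 <= mu - pmean M by rewrite subr_ge0; exact: law_mean_le p0 pmu M.
  rewrite -(ler_pM2l mu0); apply: le_trans h2.
  by rewrite mulrA; apply: ler_wpM2r => //; rewrite mulrC.
have e2 : (m%:R - (k * k)%:R) * pmean M <= (k * k)%:R * (l%:R * pmean M).
  case/andP: mean_le => m1 _; rewrite mulrA; apply: ler_wpM2r => //.
  by rewrite [(k * k)%:R * _]mulrC; lra.
have e3 : (k * k)%:R * pmean M <= (k * k)%:R * mu.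
  by apply: ler_wpM2l => //; exact: law_mean_le p0 pmu M.
have e4 : (C + 3) * y n <= (k * k)%:R * (s / 5).
  apply: (@le_trans _ _ (k%:R * w / 5 * y n)).
    by rewrite ler_pM2r.
  rewrite -xE natrM (_ : k%:R * (x * k%:R) / 5 * y n =
    k%:R * k%:R * (x * y n / 5)); last by ring.
  by rewrite ler_pM2l ?mulr_gt0// ler_pM2r.
rewrite mulrDr; lra.
Qed.

(** Stable regime: one summand of order [y n] suffices, and it occurs with
    positive probability while the others stay close to their mean. *)
Theorem spread_of_big_jump (y : nat -> R) (K : R) : 0 < K ->
  (forall B : R, exists n0, forall n, (n0 <= n)%N -> B <= y n) ->
  (forall D : R, 1 <= D -> exists (c : R) n0, 0 < c /\
    forall n, (n0 <= n)%N -> c <= n%:R * ptail p (Num.truncn (D * y n)).+1) ->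
  (exists n0, forall n, (n0 <= n)%N ->
    n%:R * moment2 p (Num.truncn (y n)).+1 <= K * y n ^+ 2 /\
    n%:R * (mu - pmean (Num.truncn (y n)).+1) <= K * y n) ->
  upward_spread y.
Proof.
move=> K0 yoo yjump [n1 ysum] C C0.
(* with probability one half the small summands lose at most [X * y n], by
   Chebyshev's inequality; a jump of [D * y n] makes up for that and for the
   drift *)
pose X := 4 * K / mu + 1.
have Kmu : 0 < K / mu by rewrite divr_gt0.
have X1 : 1 <= X by rewrite /X; lra.
have XX : 4 * K / mu <= X ^+ 2 by rewrite /X; nra.
pose D := C + K / mu + X + 2.
have D1 : 1 <= D by rewrite /D; lra.
have [c [n2 [c0 h2]]] := yjump D D1.
have [n3 h3] := yoo (Num.max mu 1).
have half : 0 < (2^-1 : R) by [].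
have [n4 h4] := series_near p1 half.
have [n5 h5] := yoo n4%:R.
pose E := expR (- (c / (2 * mu))).
have E1 : E < 1 by rewrite /E -expR0 ltr_expR oppr_lt0 divr_gt0// mulr_gt0.
exists ((1 - E) / 2), (n1 + n2 + n3 + n5 + 1)%N; split; first by rewrite divr_gt0// subr_gt0.
move=> n m a nn nm mn am.
have [s1 s2] := ysum n ltac:(nlia); have {}h2 := h2 n ltac:(nlia).
have := h3 n ltac:(nlia); rewrite ge_max => /andP[ymu y1].
have {}h5 := h5 n ltac:(nlia).
have n0 : 0 < (n%:R : R) by rewrite ltr0n; nlia.
have y0 : 0 < y n by lra.
have m0 : (0 < m)%N.
  by rewrite lt0n; apply/negP => /eqP mz; move: nm; rewrite mz mulr0; lra.
clear h3 nn yoo yjump ysum.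
set B := (Num.truncn (y n)).+1 in s1 s2.
set J := (Num.truncn (D * y n)).+1 in h2.
have yD : y n <= D * y n by rewrite ler_peMl// ltW.
have BJ : (0 < B <= J)%N by rewrite /= ltnS; exact: le_truncn.
have JD : D * y n < J%:R by exact: truncnS_gt.
have n4J : (n4 <= J)%N by rewrite -(ler_nat R); lra.
set al := \sum_(0 <= j < J) p j.
have al2 : 2^-1 < al by have := h4 J n4J; rewrite -/al; lra.
have al0 : 0 < al by lra.
have al1 : al <= 1 by exact: ple1.
have alE : al ^+ m <= E.
  apply: (@le_trans _ _ (expR (- ptail p J) ^+ m)).
    apply: lerXn2r; rewrite ?nnegrE ?expR_ge0 ?(ltW al0)//.
    by apply: le_trans (expR_ge1Dx _); rewrite /ptail -/al; lra.
  rewrite -expRM_natl ler_expR mulrN lerN2 ler_pdivrMr ?mulr_gt0//.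
  apply: le_trans h2 _; rewrite mulrAC; apply: ler_wpM2r.
    exact: ptail_ge0 p0 p1 J.
  lra.
rewrite -(@iexp_le_conv _ _ a.+1)//.
have key := @iexp_big_jump R p B J p0 ple1 BJ al0 a.+1 m
  (fun t => (t <= a)%N%:R).
have {}key := key (fun t => ler0n _ _).
have dec s t : (s <= t)%N -> ((t <= a)%N%:R : R) <= (s <= a)%N%:R.
  move=> st; rewrite ler_nat; case: (leqP t a) => // ta.
  by rewrite (leq_trans st ta).
have {key dec} := key dec; rewrite -/al => key.
have r1 := @nojump1 R p B J BJ.
have r0 := @nojump_ge0 R p B J p0 al0.
set r := nojump p B J in key r1 r0.
have f1 : iexp r B m (fun t => (t <= a)%N%:R) <= 1.
  rewrite -[leRHS](iexp1 r1 m); apply: le_iexp => // t.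
  by case: leqP; rewrite ?lexx ?ler01.
have f2 : iexp r B m.-1 (fun t => (J + t <= a)%N%:R) <= 2^-1.
  have [aJ|Ja] := ltnP a J.
    rewrite (@eq_iexp _ _ _ _ _ (fun=> 0)) ?iexp0// => t.
    by rewrite leqNgt (leq_trans aJ) ?leq_addr.
  have rm := nojump_mean ple1 BJ al0; rewrite -/r -/al in rm.
  have rv := nojump_var ple1 BJ al0 (erefl : _ = _).
  set mr := \sum_(0 <= j < B) nojump p B J j * j%:R in rv.
  have mrE : mr = al^-1 * pmean B by rewrite -rm.
  have X0 : 0 < X * y n by rewrite mulr_gt0//; lra.
  have m1 : ((m.-1)%:R : R) = m%:R - 1 by rewrite -[in RHS](prednK m0) -natr1 addrK.
  have pm0 : 0 <= pmean B by rewrite sumr_ge0// => j _; rewrite mulr_ge0.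
  have mr_ge : pmean B <= mr.
    by rewrite mrE ler_peMl// invf_ge1.
  have mr_mean : m%:R * mu - K / mu * y n - mu <= (m.-1)%:R * mr.
    have : (m.-1)%:R * pmean B <= (m.-1)%:R * mr by apply: ler_wpM2l.
    have : pmean B <= mu by exact: law_mean_le p0 pmu B.
    have : m%:R * (mu - pmean B) <= K / mu * y n.
      rewrite mulrAC ler_pdivlMr//; apply: le_trans s2.
      rewrite mulrAC; apply: ler_wpM2r => //.
      by rewrite subr_ge0; exact: law_mean_le p0 pmu B.
    rewrite m1; lra.
  have ax : (a - J)%:R <= (m.-1)%:R * mr - X * y n.
    rewrite natrB//.
    have : D * y n = (C + K / mu + X + 2) * y n by [].
    lra.
  have := chebyshev_lower r1 (erefl : _ = mr) erefl r0 X0 ax.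
  rewrite (@eq_iexp _ _ _ _ _ (fun t => (J + t <= a)%N%:R)); last first.
    by move=> t; congr (_%:R); congr nat_of_bool; clear -Ja; lia.
  move=> h; apply: le_trans h _; rewrite ler_pdivrMr ?exprn_gt0//.
  apply: (@le_trans _ _ (m%:R * (2 * moment2 p B))).
    apply: ler_pM => //.
    - by rewrite sumr_ge0// => j _; rewrite mulr_ge0 ?sqr_ge0//; exact: r0.
    - by rewrite m1; lra.
    - apply: le_trans rv _; apply: ler_wpM2r.
        by rewrite sumr_ge0// => j _; rewrite mulr_ge0 ?sqr_ge0.
      by rewrite -[leRHS]invrK lef_pV2 ?posrE ?invr_gt0// ltW.
  have h6 : m%:R * moment2 p B <= K / mu * y n ^+ 2.
    rewrite mulrAC ler_pdivlMr//; apply: le_trans s1.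
    rewrite mulrAC; apply: ler_wpM2r => //.
    by rewrite sumr_ge0// => j _; rewrite mulr_ge0 ?sqr_ge0.
  have : 4 * K / mu * y n ^+ 2 <= X ^+ 2 * y n ^+ 2.
    by apply: ler_wpM2r => //; exact: sqr_ge0.
  rewrite exprMn; lra.
have al_m0 : 0 <= al ^+ m by rewrite exprn_ge0// ltW.
have al_m1 : al ^+ m <= 1 by rewrite exprn_ile1// ltW.
have : al ^+ m * iexp r B m (fun t => (t <= a)%N%:R) <= al ^+ m by rewrite ler_piMr.
have : (1 - al ^+ m) * iexp r B m.-1 (fun t => (J + t <= a)%N%:R) <=
    (1 - al ^+ m) * 2^-1 by apply: ler_wpM2l => //; rewrite subr_ge0.
lra.
Qed.

End Fluctuations.

(** * Regularly varying laws and single large components *)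

Lemma eq_ler {R : realType} (x y : R) : x = y -> x <= y.
Proof. by move=> ->. Qed.

Section SumsOfRegularSequences.
Context {R : realType}.
Variables (p : nat -> R) (a : R).
Hypothesis pa : regvar p a.

Let p_gt0 n : (0 < n)%N -> 0 < p n. Proof. exact: regvar_gt0 pa. Qed.
Let p_ge0 n : (0 < n)%N -> 0 <= p n. Proof. exact: regvar_ge0 pa. Qed.

Lemma regvar_moment_summable (s : R) : s + 1 < a -> exists2 C : R, 0 < C &
  forall N, \sum_(1 <= j < N) p j * (j%:R : R) `^ s <= C.
Proof.
move=> sa; have h : 1 < a + - s by lra.
have q := regvarM (- s) ltr01 pa.
have [C C0 H] := regvar_summable q h; exists C => // N.
apply: le_trans (H N); apply: ler_sum => j _.
by rewrite mul1r opprK.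
Qed.

(** Potter's bound with a decay exponent still larger than [i + 1] makes the
    tail comparable to its first dyadic block. *)
Lemma regvar_tail_sum (i : nat) : i%:R + 1 < a -> exists (C : R) M0,
  [/\ 0 < C, (0 < M0)%N & forall M N, (M0 <= M)%N ->
    \sum_(M <= j < N) p j * (j%:R : R) ^+ i <= C * (M%:R ^+ i.+1 * p M)].
Proof.
move=> ia; pose c := (a - i%:R - 1) / 2.
have c0 : 0 < c by rewrite /c; lra.
have [M0 M00 H] := regvar_potter pa c0.
exists (1 + expR c * c^-1), M0; split => //.
  by rewrite addr_gt0// mulr_gt0 ?expR_gt0// invr_gt0.
move=> M N MM; have M1 : (0 < M)%N by exact: leq_trans MM.
have Mr : 0 < (M%:R : R) by rewrite ltr0n.
have pM := p_gt0 M1.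
have K0 : 0 < expR c * c^-1 by rewrite mulr_gt0 ?expR_gt0// invr_gt0.
have W0 : 0 <= M%:R ^+ i.+1 * p M by rewrite mulr_ge0 ?exprn_ge0// ltW.
have [NM|MN] := leqP N M.
  by rewrite big_geq// mulr_ge0//; lra.
rewrite big_ltn// mulrDl mul1r; apply: lerD.
  rewrite mulrC; apply: ler_wpM2r; first exact: ltW.
  by rewrite exprS ler_peMl ?exprn_ge0// ler1n.
apply: (@le_trans _ _ (\sum_(M.+1 <= j < N)
   expR c * (M%:R : R) `^ (a - c) * p M * (j%:R : R) `^ (- (c + 1)))).
  rewrite big_nat [leRHS]big_nat; apply: ler_sum => j /andP[Mj _].
  have j1 : (0 < j)%N by exact: leq_trans Mj.
  have [h _] := H M j MM (ltnW Mj).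
  have ji : 0 <= (j%:R : R) ^+ i by rewrite exprn_ge0.
  apply: le_trans (ler_wpM2r ji h) _.
  rewrite powR_natdiv// -powR_mulrn//.
  have -> : - (c + 1) = (c - a) + i%:R by rewrite /c; lra.
  rewrite [_ `^ (c - a + _)]powRD; last by rewrite pnatr_eq0 -lt0n j1 implybT.
  rewrite [a - c](_ : _ = - (c - a)); last by ring.
  rewrite [M%:R `^ - _]powRN; apply: eq_ler; ring.
rewrite -mulr_sumr.
have B0 : 0 <= expR c * (M%:R : R) `^ (a - c) * p M.
  by rewrite !mulr_ge0 ?expR_ge0 ?powR_ge0// ltW.
apply: le_trans (ler_wpM2l B0 (sum_powR_tail N M1 c0)) _.
have -> : (M%:R : R) ^+ i.+1 = M%:R `^ (a - c) * M%:R `^ (- c).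
  rewrite -powRD; last by rewrite pnatr_eq0 -lt0n M1 implybT.
  by rewrite -powR_mulrn// -natr1; congr (_ `^ _); rewrite /c; lra.
apply: eq_ler; ring.
Qed.

(** The terms decay more slowly than [1 / j], so the last dyadic block carries a
    positive fraction of the sum. *)
Lemma regvar_head_sum : 1 < a < 3 -> exists (C : R) t0, [/\ 0 < C, (0 < t0)%N &
  forall t, (t0 <= t)%N ->
    \sum_(0 <= j < t.+1) p j * (j%:R : R) ^+ 2 <= C * (t%:R ^+ 3 * p t)].
Proof.
move=> /andP[a1 a3]; pose c := (3 - a) / 2.
have c0 : 0 < c by rewrite /c; lra.
have c1 : 0 < c <= 1 by rewrite c0/= /c; lra.
have [n0 n00 H] := regvar_potter pa c0.
have as_ : a < (a + 3) / 2 by lra.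
have [d [n1 [d0 n10 low]]] := regvar_lower pa as_.
pose W := \sum_(0 <= j < n0) `|p j| * (j%:R : R) ^+ 2.
have W0 : 0 <= W by rewrite sumr_ge0// => j _; rewrite mulr_ge0// exprn_ge0.
exists (W / d + expR c * (2 / c)), (n0 + n1)%N; split.
- by rewrite ltr_wpDl// ?divr_ge0// ?(ltW d0)// mulr_gt0 ?expR_gt0// divr_gt0.
- by nlia.
move=> t tt; have t1 : (0 < t)%N by nlia.
have tr : 0 < (t%:R : R) by rewrite ltr0n.
have pt := p_gt0 t1.
rewrite (@big_cat_nat _ _ _ n0)//=; last by nlia.
rewrite mulrDl; apply: lerD.
  apply: (@le_trans _ _ W).
    apply: ler_sum => j _; apply: ler_wpM2r; first by rewrite exprn_ge0.
    exact: ler_norm.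
  rewrite mulrAC ler_pdivlMr//; apply: ler_wpM2l => //.
  have h := low t ltac:(nlia).
  have t30 : 0 <= (t%:R : R) ^+ 3 by rewrite exprn_ge0.
  apply: le_trans (ler_wpM2l t30 h).
  rewrite mulrCA -powR_mulrn// -powRD; last by rewrite pnatr_eq0 -lt0n t1 implybT.
  rewrite ler_peMr// ?(ltW d0)//.
  rewrite -[leLHS](powRr0 (t%:R : R)); apply: ler_powR; first by rewrite ler1n.
  lra.
apply: (@le_trans _ _ (\sum_(n0 <= j < t.+1)
   expR c * (t%:R : R) `^ (c + a) * p t * (j%:R : R) `^ (c - 1))).
  rewrite big_nat [leRHS]big_nat; apply: ler_sum => j /andP[n0j jt].
  have j1 : (0 < j)%N by exact: leq_trans n0j.
  have [_ h] := H j t n0j jt.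
  have ji : 0 <= (j%:R : R) ^+ 2 by rewrite exprn_ge0.
  apply: le_trans (ler_wpM2r ji h) _.
  rewrite powR_natdiv// -powR_mulrn//.
  have -> : c - 1 = 2 - (c + a) by rewrite /c; lra.
  rewrite powRB; last by rewrite pnatr_eq0 -lt0n j1 implybT.
  apply: eq_ler; ring.
rewrite -mulr_sumr.
have B0 : 0 <= expR c * (t%:R : R) `^ (c + a) * p t.
  by rewrite !mulr_ge0 ?expR_ge0 ?powR_ge0// ltW.
apply: (@le_trans _ _ (expR c * (t%:R : R) `^ (c + a) * p t *
    \sum_(1 <= j < t.+1) (j%:R : R) `^ (c - 1))).
  apply: ler_wpM2l => //; rewrite [leRHS](@big_cat_nat _ _ _ n0)//=; last by nlia.
  by rewrite lerDr sumr_ge0// => j _; exact: powR_ge0.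
apply: le_trans (ler_wpM2l B0 (sum_powR_head t c1)) _.
have -> : (t%:R : R) ^+ 3 = t%:R `^ (c + a) * t%:R `^ c.
  rewrite -powRD; last by rewrite pnatr_eq0 -lt0n t1 implybT.
  by rewrite -powR_mulrn//; congr (_ `^ _); rewrite /c; lra.
apply: eq_ler; ring.
Qed.

(** On the dyadic block after [t] the values of [p] are comparable to [p t]. *)
Lemma regvar_block_sum (i : nat) : 0 < a -> exists (C : R) t0,
  [/\ 0 < C, (0 < t0)%N & forall t, (t0 <= t)%N ->
    t%:R ^+ i.+1 * p t <=
      C * \sum_(t.+1 <= j < t.+1 + t) p j * (j%:R : R) ^+ i].
Proof.
move=> a0; have half : 0 < (2^-1 : R) by [].
have [C [n0 [C0 n00 H]]] := regvar_linear pa a0 half.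
exists C, n0; split => // t tt.
have t1 : (0 < t)%N by exact: leq_trans tt.
rewrite mulr_sumr.
apply: (@le_trans _ _ (\sum_(t.+1 <= j < t.+1 + t) p t * (t%:R : R) ^+ i)).
  by rewrite sumr_const_nat addKn exprS -mulr_natl; apply: eq_ler; ring.
rewrite big_nat [leRHS]big_nat; apply: ler_sum => j /andP[tj jt].
rewrite mulrA; apply: ler_pM.
- by rewrite p_ge0.
- by rewrite exprn_ge0.
- apply: H; first by nlia.
  have : (j%:R : R) <= (2 * t)%:R by rewrite ler_nat; nlia.
  by rewrite natrM; lra.
- by apply: lerXn2r; rewrite ?nnegrE// ler_nat ltnW.
Qed.

(** For [a = 3] neighbouring dyadic blocks carry comparable second moments, and
    arbitrarily many of them precede [t]. *)
Lemma regvar3_block_negligible (K : R) : a = 3 -> p 0%N >= 0 -> 0 < K ->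
  exists t0, (0 < t0)%N /\ forall t, (t0 <= t)%N ->
    K * (t%:R ^+ 3 * p t) <= moment2 p t.+1.
Proof.
move=> a3 p00 K0.
pose e : R := expR (- (2 * K)) / 2.
have e0 : 0 < e by rewrite divr_gt0 ?expR_gt0.
have e1 : e < 1.
  have : expR (- (2 * K)) <= 1 by rewrite -[leRHS]expR0 ler_expR; lra.
  by rewrite /e; lra.
have le0 : 0 <= - ln e by rewrite oppr_ge0 ln_le0// ltW.
have l2 : 0 < ln 2 :> R by apply: ln_gt0; lra.
pose d : R := ln 2 / (1 - ln e).
have d0 : 0 < d by rewrite divr_gt0//; lra.
have [n0 n00 H] := pa.2 d d0.
have [m mP] := exists_natr_ge ((n0%:R + 1) / e).
exists m.+1; split=> // t tt.
have t1 : (0 < t)%N by exact: leq_trans tt.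
have tr : 0 < (t%:R : R) by rewrite ltr0n.
have et : n0%:R + 1 <= e * t%:R.
  rewrite mulrC -ler_pdivrMr//; apply: le_trans mP _.
  by rewrite ler_nat ltnW.
have et0 : 0 <= e * t%:R by rewrite mulr_ge0// ltW.
have /andP[s1 s2] := truncn_itv et0.
set s := Num.truncn _ in s1 s2.
have st : (s <= t)%N by rewrite -(ler_nat R); nra.
have n0s : (n0 <= s)%N by rewrite -ltnS -(ltr_nat R); lra.
have pt := p_gt0 t1.
rewrite /moment2 (@big_cat_nat _ _ _ s.+1)//= ler_wpDl//.
  rewrite big_nat_recl// expr0n mulr0 add0r sumr_ge0// => j _.
  by rewrite mulr_ge0 ?p_ge0// exprn_ge0.
have term j : (s < j)%N -> (j <= t)%N ->
    2^-1 * (t%:R ^+ 3 * p t) * (ln j.+1%:R - ln j%:R) <= p j * (j%:R : R) ^+ 2.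
  move=> sj jt; have j1 : (0 < j)%N by exact: leq_ltn_trans sj.
  have jr : 0 < (j%:R : R) by rewrite ltr0n.
  have h := H j t (leq_trans n0s (ltnW sj)) jt.
  have ej : e * t%:R <= j%:R.
    by apply: le_trans (ltW s2) _; rewrite ler_nat.
  have lj : ln t%:R - ln j%:R <= - ln e :> R.
    have : ln (e * t%:R) <= ln j%:R.
      by rewrite ler_ln ?posrE// mulr_gt0.
    by rewrite lnM ?posrE//; lra.
  have h2 : t%:R ^+ 3 * p t <= 2 * (j%:R ^+ 3 * p j).
    have j3 : 0 < (j%:R : R) ^+ 3 * p j by rewrite mulr_gt0 ?exprn_gt0 ?p_gt0.
    have t3 : 0 < (t%:R : R) ^+ 3 * p t by rewrite mulr_gt0 ?exprn_gt0.
    rewrite -[2]lnK ?posrE//; apply: le_of_ln_sub => //.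
    rewrite !lnM ?posrE ?mulr_gt0 ?p_gt0//.
    have dl : d * (1 + (ln t%:R - ln j%:R)) <= ln 2.
      apply: (@le_trans _ _ (d * (1 - ln e))).
        by apply: ler_wpM2l; [exact: ltW|lra].
      by rewrite /d divfK//; apply: lt0r_neq0; lra.
    move: h; rewrite a3 ler_norml => /andP[_ h].
    lra.
  have lj1 : ln j.+1%:R - ln j%:R <= (j%:R : R)^-1.
    rewrite -ln_div ?posrE ?ltr0n//.
    have -> : (j.+1%:R / j%:R : R) = 1 + j%:R^-1.
      by rewrite -natr1 mulrDl mul1r divff// gt_eqF.
    by apply: le_ln1Dx; apply: lt_trans (_ : 0 < _); rewrite ?invr_gt0//; lra.
  have l0 : 0 <= ln j.+1%:R - ln j%:R :> R by rewrite subr_ge0 ln_nat_mono.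
  apply: (@le_trans _ _ (j%:R ^+ 3 * p j * j%:R^-1)).
    apply: ler_pM => //; last by lra.
    by rewrite mulr_ge0// mulr_ge0 ?exprn_ge0// ltW.
  by apply: eq_ler; field; rewrite gt_eqF.
apply: (@le_trans _ _ (\sum_(s.+1 <= j < t.+1)
   2^-1 * (t%:R ^+ 3 * p t) * (ln j.+1%:R - ln j%:R))); last first.
  by apply: ler_sum_nat => j /andP[sj jt]; exact: term.
rewrite -mulr_sumr telescope_sumr ?ltnS//.
rewrite (_ : K * _ = 2^-1 * (t%:R ^+ 3 * p t) * (2 * K)); last by field.
apply: ler_wpM2l; first by rewrite !mulr_ge0 ?exprn_ge0 ?invr_ge0// ltW.
have : ln (s.+1%:R : R) <= ln (2 * e * t%:R).
  have et2 : 0 < 2 * e * t%:R by apply: mulr_gt0 => //; apply: mulr_gt0.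
  rewrite ler_ln ?posrE// -[s.+1%:R]natr1.
  have : 0 <= (n0%:R : R) by []. 
  lra.
rewrite /e (_ : 2 * (expR (- (2 * K)) / 2) = expR (- (2 * K))); last by field.
rewrite lnM ?posrE ?expR_gt0// expRK.
have := @ln_nat_mono R t t.+1 t1 (leqnSn t); lra.
Qed.

End SumsOfRegularSequences.

Section RegularLaw.
Context {R : realType}.
Variables (p : nat -> R) (mu a : R).
Hypothesis p0 : forall j, 0 <= p j.
Hypothesis p1 : series p @ \oo --> (1 : R).
Hypothesis pmu : series (fun j => p j * j%:R) @ \oo --> mu.
Hypothesis pa : regvar p a.

Let p_gt0 n : (0 < n)%N -> 0 < p n. Proof. exact: regvar_gt0 pa. Qed.

Lemma series_tail_le (u : nat -> R) (s B : R) M :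
  series u @ \oo --> s -> (forall N, \sum_(M <= j < N) u j <= B) ->
  s - \sum_(0 <= j < M) u j <= B.
Proof.
move=> us uB; apply: ler_eps => e e0; have [N Nh] := series_near us e0.
have := Nh (maxn N M) (leq_maxl _ _).
rewrite (@big_cat_nat _ _ _ M)//=; last by rewrite leq_maxr.
have := uB (maxn N M); lra.
Qed.

Lemma regvar_ptail_le : 1 < a -> exists (C : R) M0, [/\ 0 < C, (0 < M0)%N &
  forall M, (M0 <= M)%N -> ptail p M <= C * (M%:R * p M)].
Proof.
move=> a1; have h : 0%:R + 1 < a by rewrite add0r.
have [C [M0 [C0 M00 H]]] := regvar_tail_sum pa h.
exists C, M0; split => // M MM; apply: (series_tail_le p1) => N.
have := H M N MM; under eq_bigr do rewrite expr0 mulr1.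
by rewrite expr1.
Qed.

Lemma regvar_mean_tail_le : 2 < a -> exists (C : R) M0, [/\ 0 < C, (0 < M0)%N &
  forall M, (M0 <= M)%N ->
    mu - \sum_(0 <= j < M) p j * j%:R <= C * (M%:R ^+ 2 * p M)].
Proof.
move=> a2; have h : 1%:R + 1 < a by lra.
have [C [M0 [C0 M00 H]]] := regvar_tail_sum pa h.
exists C, M0; split => // M MM; apply: (series_tail_le pmu) => N.
by have := H M N MM; under eq_bigr do rewrite expr1.
Qed.

Lemma regvar_ptail_ge : 0 < a -> exists (C : R) t0, [/\ 0 < C, (0 < t0)%N &
  forall t, (t0 <= t)%N -> t%:R * p t <= C * ptail p t.+1].
Proof.
move=> a0; have [C [t0 [C0 t00 H]]] := regvar_block_sum pa 0 a0.
exists C, t0; split => // t tt.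
have := H t tt; rewrite expr1 => h; apply: le_trans h _.
rewrite ler_pM2l//; under eq_bigr do rewrite expr0 mulr1.
have := law_le1 p0 p1 (t.+1 + t); rewrite (@big_cat_nat _ _ _ t.+1)//=.
  by rewrite /ptail; lra.
exact: leq_addr.
Qed.

Lemma moment2_le M N : (M <= N)%N -> moment2 p M <= moment2 p N.
Proof.
move=> MN; rewrite /moment2 [leRHS](@big_cat_nat _ _ _ M)//= lerDl.
by rewrite sumr_ge0// => j _; rewrite mulr_ge0// exprn_ge0.
Qed.

Lemma moment2_ge0 M : 0 <= moment2 p M.
Proof. by rewrite sumr_ge0// => j _; rewrite mulr_ge0// exprn_ge0. Qed.

(** The dyadic blocks already have unbounded second moments. *)
Lemma regvar_moment2_unbounded : 0 < a < 3 -> forall B, exists M, B < moment2 p M.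
Proof.
move=> /andP[a0 a3] B; have [C [t0 [C0 t00 H]]] := regvar_block_sum pa 2 a0.
have as_ : a < (a + 3) / 2 by lra.
have [d [n1 [d0 n10 low]]] := regvar_lower pa as_.
pose r := 3 - (a + 3) / 2.
have r0 : 0 < r by rewrite /r; lra.
pose B' := `|B| + 1.
have B0 : 0 < B' by rewrite /B'; have := normr_ge0 B; lra.
have e0 : 0 < d / (C * B') by rewrite divr_gt0// mulr_gt0.
have [n2 n20 van] := powR_vanish r0 e0.
pose t := (t0 + n1 + n2)%N; exists (t.+1 + t)%N.
have t1 : (0 < t)%N by rewrite /t; nlia.
have tr : 0 < (t%:R : R) by rewrite ltr0n.
have h1 := H t ltac:(rewrite /t; nlia).
have h2 := low t ltac:(rewrite /t; nlia).
have h3 := van t ltac:(rewrite /t; nlia).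
have s1 : \sum_(t.+1 <= j < t.+1 + t) p j * (j%:R : R) ^+ 2 <= moment2 p (t.+1 + t).
  rewrite /moment2 [leRHS](@big_cat_nat _ _ _ t.+1)//= ?leq_addr//.
  by rewrite lerDr sumr_ge0// => j _; rewrite mulr_ge0// exprn_ge0.
have tR : 0 < (t%:R : R) `^ r by rewrite powR_gt0.
have h4 : C * B' <= C * moment2 p (t.+1 + t).
  apply: le_trans (ler_wpM2l (ltW C0) s1); apply: le_trans h1.
  have t30 : 0 <= (t%:R : R) ^+ 3 by rewrite exprn_ge0.
  apply: le_trans (ler_wpM2l t30 h2).
  rewrite mulrCA -powR_mulrn// -powRD; last by rewrite pnatr_eq0 -lt0n t1 implybT.
  rewrite -/r; move: h3; rewrite powRN ler_pdivlMr ?mulr_gt0// mulrC.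
  by rewrite ler_pdivrMr.
move: h4; rewrite ler_pM2l// /B'; have := ler_norm B; lra.
Qed.

(** The terms between [M] and [t] add up to [O (t^3 * p t)], which is negligible
    compared with the whole sum. *)
Lemma regvar3_moment2_slow (x : R) : a = 3 -> 0 < x -> exists t0, forall t M,
  (t0 <= t)%N -> x * t%:R <= M%:R -> moment2 p t.+1 <= 2 * moment2 p M.
Proof.
move=> a3 x0; have a0 : 0 < a by lra.
have [C [n0 [C0 n00 H]]] := regvar_linear pa a0 x0.
have K0 : 0 < 4 * C by lra.
have [t0 [t00 T]] := regvar3_block_negligible pa a3 (p0 0) K0.
exists (n0 + t0)%N => t M tt xM.
have [tM|Mt] := ltnP t M.
  have := moment2_le tM; have := moment2_ge0 M; lra.
have h := T t ltac:(nlia).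
have t1 : (0 < t)%N by nlia.
have pt := p_gt0 t1.
have : \sum_(M <= j < t.+1) p j * (j%:R : R) ^+ 2 <=
    2 * C * (t%:R ^+ 3 * p t).
  apply: (@le_trans _ _ (\sum_(M <= j < t.+1) C * p t * (t%:R : R) ^+ 2)).
    rewrite big_nat [leRHS]big_nat; apply: ler_sum => j /andP[Mj jt].
    apply: ler_pM => //.
      apply: H; first by nlia.
      by apply: le_trans xM _; rewrite ler_nat.
    by apply: lerXn2r; rewrite ?nnegrE// ler_nat.
  rewrite sumr_const_nat -[leLHS]mulr_natl.
  have tk : ((t.+1 - M)%N%:R : R) <= 2 * t%:R by rewrite -natrM ler_nat; nlia.
  have w0 : 0 <= C * p t * (t%:R : R) ^+ 2.
    by rewrite !mulr_ge0 ?exprn_ge0// ltW.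
  apply: le_trans (ler_wpM2r w0 tk) _; apply: eq_ler; ring.
have -> : moment2 p t.+1 = moment2 p M + \sum_(M <= j < t.+1) p j * (j%:R : R) ^+ 2.
  by rewrite /moment2 -big_cat_nat//=; exact: leqW.
move: h; rewrite -/(moment2 p M) {1}/moment2 (@big_cat_nat _ _ _ M)//= -/(moment2 p M); first lra.
exact: leqW.
Qed.

(** The left-hand side is of order [t^3 * p t], a single dyadic block. *)
Lemma regvar3_mean_tail (x A e : R) : a = 3 -> 0 < x -> 0 < A -> 0 < e ->
  exists t0, forall t M, (t0 <= t)%N -> x * t%:R <= M%:R -> M%:R <= A * t%:R ->
  t%:R * (mu - \sum_(0 <= j < M) p j * j%:R) <= e * moment2 p t.+1.
Proof.
move=> a3 x0 A0 e0; have a0 : 0 < a by lra.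
have a2 : 2 < a by lra.
have [C [n0 [C0 n00 H]]] := regvar_linear pa a0 x0.
have [C1 [M0 [C10 M00 H1]]] := regvar_mean_tail_le a2.
have W0 : 0 < C1 * A ^+ 2 * C by rewrite !mulr_gt0// exprn_gt0.
have K0 : 0 < C1 * A ^+ 2 * C / e by rewrite divr_gt0.
have [t0 [t00 T]] := regvar3_block_negligible pa a3 (p0 0) K0.
have [n1 n1P] := exists_natr_ge (M0%:R / x).
exists (n0 + t0 + n1)%N => t M tt xM MA.
have t1 : (0 < t)%N by nlia.
have MM : (M0 <= M)%N.
  rewrite -(ler_nat R); apply: le_trans xM; rewrite mulrC -ler_pdivrMr//.
  by apply: le_trans n1P _; rewrite ler_nat; nlia.
have h := T t ltac:(nlia).
have h1 := H1 M MM.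
have h2 : p M <= C * p t by apply: H; [nlia|].
have h3 : C1 * (M%:R ^+ 2 * p M) <= C1 * ((A * t%:R) ^+ 2 * (C * p t)).
  rewrite ler_pM2l//; apply: ler_pM => //.
  by apply: lerXn2r; rewrite ?nnegrE// mulr_ge0// ltW.
have h4 := ler_wpM2l (ler0n R t) (le_trans h1 h3).
apply: le_trans h4 _.
move: h; rewrite mulrAC ler_pdivrMr// => h; rewrite [leRHS]mulrC.
apply: le_trans h; apply: eq_ler; ring.
Qed.

Lemma regvar_moment2_power : 2 < a -> exists eta C2 : R, 0 < eta <= 1 /\
  forall M, (0 < M)%N -> moment2 p M <= C2 * (M%:R : R) `^ (1 - eta).
Proof.
move=> a2; pose eta := Num.min 1 ((a - 2) / 2).
have eta0 : 0 < eta by rewrite lt_min ltr01/=; lra.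
have eta1 : eta <= 1 by rewrite ge_min lexx.
have eta2 : eta <= (a - 2) / 2 by rewrite ge_min lexx orbT.
clearbody eta.
have h : (1 + eta) + 1 < a by lra.
have [C C0 H] := regvar_moment_summable pa h.
exists eta, C; split; first by rewrite eta0.
case=> // M _; have Mr : 0 < (M.+1%:R : R) by [].
have P0 : 0 <= (M.+1%:R : R) `^ (1 - eta) by exact: powR_ge0.
apply: le_trans (ler_wpM2r P0 (H M.+1)).
rewrite /moment2 big_ltn// expr0n mulr0 add0r mulr_suml big_nat [leRHS]big_nat.
apply: ler_sum => j /andP[j1 jM]; rewrite -mulrA; apply: ler_wpM2l => //.
have jr : 0 < (j%:R : R) by rewrite ltr0n.
apply: (@le_trans _ _ ((j%:R : R) `^ (1 + eta) * j%:R `^ (1 - eta))).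
  rewrite -powRD; last by rewrite pnatr_eq0 -lt0n j1 implybT.
  by rewrite -powR_mulrn//; apply: eq_ler; congr (_ `^ _); lra.
apply: ler_wpM2l; first exact: powR_ge0.
by apply: ge0_ler_powR; rewrite ?nnegrE ?ler_nat ?(ltnW jM)//; lra.
Qed.

End RegularLaw.

Section OneJumpNegligible.
Context {R : realType}.
Variables (p q : nat -> R) (b : R).
Hypothesis p0 : forall j, 0 <= p j.
Hypothesis qb : regvar q b.
Hypothesis b1 : 1 < b.

(** One component of size [j >= x n] among [K <= A n] is unlikely even after
    summing over the number of components: the weight of [n / mu] components
    dominates. *)
Definition one_jump_negligible : Prop := forall A x d : R,
  0 < A -> 0 < x -> 0 < d -> exists n0,
  forall n K j, (n0 <= n)%N -> K%:R <= A * n%:R -> x * n%:R <= j%:R ->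
  (\sum_(1 <= k < K) q k * k%:R) * p j <= d * q n.

Let q0 n : (0 < n)%N -> 0 < q n. Proof. exact: regvar_gt0 qb. Qed.

Let sumq_ge0 K : 0 <= \sum_(1 <= k < K) q k * k%:R.
Proof.
rewrite big_nat sumr_ge0// => k /andP[k1 _]; rewrite mulr_ge0// ltW//.
exact: q0.
Qed.

(** By Potter's bounds the left-hand side is [O (n ^ (max 2 b - b - a + c))] for
    every [c > 0], and [max 2 b < a]. *)
Lemma one_jump_of_lt a : regvar p a -> 2 < a -> b < a -> one_jump_negligible.
Proof.
move=> pa a2 ba A x d A0 x0 d0.
have a0 : 0 < a by lra.
pose m := Num.max 2 b.
have m2 : 2 <= m by rewrite le_max lexx.
have mb : b <= m by rewrite le_max lexx orbT.
have ma : m < a by rewrite gt_max a2.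
clearbody m.
pose c := (a - m) / 4.
have c0 : 0 < c by rewrite /c; lra.
pose be := m - b + c.
have be0 : 0 < be by rewrite /be; lra.
have h1 : (1 - be) + 1 < b by rewrite /be; lra.
have [Cq Cq0 HQ] := regvar_moment_summable qb h1.
have [C [n1 [C0 n10 lin]]] := regvar_linear pa a0 x0.
have ca : a - c < a by lra.
have [C' C'0 up] := regvar_upper pa ca.
have cb : b < b + c by lra.
have [l [n2 [l0 n20 low]]] := regvar_lower qb cb.
pose W := Cq * A `^ be * (C * C').
have W0 : 0 < W by rewrite !mulr_gt0// powR_gt0.
have e0 : 0 < d * l / W by rewrite divr_gt0// mulr_gt0.
have [n3 n30 van] := powR_vanish c0 e0.
exists (n1 + n2 + n3)%N => n K j nn KA xj.
have n0 : (0 < n)%N by nlia.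
have nr : 0 < (n%:R : R) by rewrite ltr0n.
have pj : p j <= C * C' * n%:R `^ (- (a - c)).
  rewrite -mulrA; apply: le_trans (lin n j ltac:(nlia) xj) _.
  by rewrite ler_pM2l//; exact: up.
have sK : \sum_(1 <= k < K) q k * k%:R <= Cq * A `^ be * n%:R `^ be.
  rewrite -mulrA -powRM ?(ltW A0)//.
  apply: (@le_trans _ _ ((\sum_(1 <= k < K) q k * (k%:R : R) `^ (1 - be)) *
      (A * n%:R) `^ be)); last by apply: ler_wpM2r => //; exact: powR_ge0.
  rewrite mulr_suml big_nat [leRHS]big_nat; apply: ler_sum => k /andP[k1 kK].
  rewrite -mulrA; apply: ler_wpM2l; first exact: ltW (q0 k1).
  apply: (@le_trans _ _ ((k%:R : R) `^ (1 - be) * k%:R `^ be)).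
    rewrite -powRD; last by rewrite pnatr_eq0 -lt0n k1 implybT.
    by rewrite subrK powRr1.
  apply: ler_wpM2l; first exact: powR_ge0.
  apply: ge0_ler_powR; rewrite ?nnegrE ?(ltW be0)//.
    by rewrite mulr_ge0// ltW.
  by apply: le_trans KA; rewrite ler_nat ltnW.
apply: le_trans (ler_pM (sumq_ge0 K) (p0 j) sK pj) _.
have h2 := low n ltac:(nlia).
apply: (@le_trans _ _ (d * (l * n%:R `^ (- (b + c))))); last by rewrite ler_pM2l.
have h3 := van n ltac:(nlia).
rewrite (_ : _ * _ * (_ * _) = W * (n%:R `^ be * n%:R `^ (- (a - c))));
  last by rewrite /W; ring.
rewrite -powRD; last by rewrite pnatr_eq0 -lt0n n0 implybT.
have -> : be + - (a - c) = - (b + c) + (- c + - (4 * c - 4 * c)) .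
  by rewrite /be /c; lra.
rewrite subrr oppr0 addr0 powRD; last by rewrite pnatr_eq0 -lt0n n0 implybT.
rewrite mulrCA [leRHS]mulrA [leRHS]mulrC; apply: ler_wpM2l; first exact: powR_ge0.
by rewrite mulrC -ler_pdivlMr.
Qed.

(** For [b > 2] the sum of the [q k * k] converges, so the comparison is between
    [p] and [q] only. *)
Lemma one_jump_of_eq a : regvar p a -> 0 < a -> 2 < b ->
  (forall d : R, 0 < d -> exists n0, forall n, (n0 <= n)%N -> p n <= d * q n) ->
  one_jump_negligible.
Proof.
move=> pa a0 b2 pq A x d A0 x0 d0.
have h1 : 1 + 1 < b by lra.
have [Cq Cq0 HQ] := regvar_moment_summable qb h1.
have [C [n1 [C0 n10 lin]]] := regvar_linear pa a0 x0.
have e0 : 0 < d / (Cq * C) by rewrite divr_gt0// mulr_gt0.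
have [n2 H2] := pq _ e0.
exists (n1 + n2)%N => n K j nn KA xj.
have sK : \sum_(1 <= k < K) q k * k%:R <= Cq.
  by apply: le_trans (HQ K); apply: ler_sum => k _; rewrite powRr1.
have pj : p j <= C * (d / (Cq * C) * q n).
  apply: le_trans (lin n j ltac:(nlia) xj) _.
  by rewrite ler_pM2l//; apply: H2; nlia.
apply: le_trans (ler_pM (sumq_ge0 K) (p0 j) sK pj) _.
by apply: eq_ler; field; rewrite !gt_eqF.
Qed.

Lemma one_jump_of_fast :
  (forall s : R, 0 < s -> exists2 C : R, 0 < C &
    forall j, (0 < j)%N -> p j <= C * (j%:R : R) `^ (- s)) ->
  one_jump_negligible.
Proof.
move=> pf A x d A0 x0 d0.
have [Cq Cq0 HQ] := regvar_summable qb b1.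
have b0 : 0 < b by exact: lt_trans ltr01 b1.
have s0 : 0 < b + 3 by rewrite addr_gt0.
have [C C0 H] := pf _ s0.
have cb : b < b + 1 by lra.
have [l [n2 [l0 n20 low]]] := regvar_lower qb cb.
pose W := Cq * A * (C * x `^ (- (b + 3))).
have W0 : 0 < W by rewrite !mulr_gt0// powR_gt0.
have e0 : 0 < d * l / W by rewrite divr_gt0// mulr_gt0.
have [n3 n30 van] := powR_vanish (ltr01 : 0 < (1 : R)) e0.
exists (n2 + n3)%N => n K j nn KA xj.
have n0 : (0 < n)%N by nlia.
have nr : 0 < (n%:R : R) by rewrite ltr0n.
have xn : 0 < x * n%:R by rewrite mulr_gt0.
have j0 : (0 < j)%N by rewrite -(ltr0n R); lra.
have pj : p j <= C * x `^ (- (b + 3)) * n%:R `^ (- (b + 3)).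
  apply: le_trans (H j j0) _; rewrite -mulrA ler_pM2l// -powRM ?(ltW x0)//.
  rewrite !powRN lef_pV2 ?posrE ?powR_gt0 ?ltr0n//.
  by apply: ge0_ler_powR; rewrite ?nnegrE ?(ltW xn)//; lra.
have sK : \sum_(1 <= k < K) q k * k%:R <= Cq * A * n%:R.
  rewrite -mulrA.
  apply: (@le_trans _ _ ((\sum_(1 <= k < K) q k) * (A * n%:R))); last first.
    by apply: ler_wpM2r => //; rewrite mulr_ge0// ltW.
  rewrite mulr_suml big_nat [leRHS]big_nat; apply: ler_sum => k /andP[k1 kK].
  apply: ler_wpM2l; first exact: ltW (q0 k1).
  by apply: le_trans KA; rewrite ler_nat ltnW.
apply: le_trans (ler_pM (sumq_ge0 K) (p0 j) sK pj) _.
have h2 := low n ltac:(nlia).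
apply: (@le_trans _ _ (d * (l * n%:R `^ (- (b + 1))))); last by rewrite ler_pM2l.
have h3 := van n ltac:(nlia).
rewrite (_ : _ * _ * (_ * _) = W * (n%:R * n%:R `^ (- (b + 3))));
  last by rewrite /W; ring.
have -> : (n%:R : R) * n%:R `^ (- (b + 3)) = n%:R `^ (- (b + 1)) * n%:R `^ (- 1).
  rewrite -{1}[n%:R](@powRr1 R)// -!powRD ?pnatr_eq0 -?lt0n ?n0 ?implybT//.
  by congr (_ `^ _); ring.
rewrite mulrCA [leRHS]mulrA [leRHS]mulrC; apply: ler_wpM2l; first exact: powR_ge0.
by rewrite mulrC -ler_pdivlMr.
Qed.

End OneJumpNegligible.

(** * Nonnegative series and laws on the naturals *)

Section ExtendedSeries.
Context {R : realType}.
Implicit Types (u v : nat -> R).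

Lemma eseries_partial_le u m N : (forall k, (m <= k)%N -> 0 <= u k) ->
  ((\sum_(m <= k < N) u k)%:E <= \sum_(m <= k <oo) (u k)%:E)%E.
Proof.
move=> u0; rewrite -sumEFin; apply: nneseries_lim_ge => k mk _.
by rewrite lee_fin; exact: u0.
Qed.

Lemma eseries_le u m (B : R) : (forall k, (m <= k)%N -> 0 <= u k) ->
  (forall N, \sum_(m <= k < N) u k <= B) ->
  (\sum_(m <= k <oo) (u k)%:E <= B%:E)%E.
Proof.
move=> u0 uB; apply: lime_le.
  by apply: is_cvg_nneseries => k mk _; rewrite lee_fin; exact: u0.
by apply: nearW => N; rewrite sumEFin lee_fin.
Qed.

Lemma eseries_fin u m : (forall k, (m <= k)%N -> 0 <= u k) ->
  (\sum_(m <= k <oo) (u k)%:E < +oo)%E ->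
  (\sum_(m <= k <oo) (u k)%:E = (fine (\sum_(m <= k <oo) (u k)%:E))%:E)%E.
Proof.
move=> u0 h; rewrite fineK// ge0_fin_numE//.
by apply: nneseries_ge0 => k mk _; rewrite lee_fin; exact: u0.
Qed.

Lemma eseries_cvg u (s : R) : (forall k, 0 <= u k) ->
  (\sum_(0 <= k <oo) (u k)%:E = s%:E)%E -> series u @ \oo --> s.
Proof.
move=> u0 us; have nd : nondecreasing_seq (series u).
  by apply/nondecreasing_seqP => n; rewrite !seriesEnat/= big_nat_recr//= lerDl.
have bd N : series u N <= s.
  by rewrite seriesEnat/= -lee_fin -us; apply: eseries_partial_le => k _.
have cv : cvgn (series u).
  apply: nondecreasing_is_cvgn => //; exists s => _ [N _ <-]; exact: bd.
have -> : s = limn (series u).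
  apply/eqP; rewrite -eqe -us eq_le; apply/andP; split.
    by apply: eseries_le => // N; exact: (nondecreasing_cvgn_le nd cv N).
  rewrite us lee_fin; apply: limr_le => //; exact: nearW.
exact: cv.
Qed.

Lemma series_eseries u (s : R) : (forall k, 0 <= u k) ->
  series u @ \oo --> s -> (\sum_(0 <= k <oo) (u k)%:E = s%:E)%E.
Proof.
move=> u0 us; have ub : (\sum_(0 <= k <oo) (u k)%:E <= s%:E)%E.
  by apply: eseries_le => // N; exact: series_ge0_le.
have fin := eseries_fin (fun k _ => u0 k) (le_lt_trans ub (ltry s)).
have := eseries_cvg u0 fin; move=> h; rewrite fin; congr EFin.
by rewrite -(cvg_lim _ h)// (cvg_lim _ us).
Qed.

(** Two power series with nonnegative summable coefficients that agree on
    [(0, 1)] have the same coefficients: compare the first coefficient at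
    which they could differ and let [z] tend to [0]. *)
Lemma pgf_unique u v : (forall j, 0 <= u j) -> (forall j, 0 <= v j) ->
  (forall N, \sum_(0 <= j < N) u j <= 1) ->
  (forall N, \sum_(0 <= j < N) v j <= 1) ->
  (forall z : R, 0 < z < 1 -> exists s : R,
     series (fun j => u j * z ^+ j) @ \oo --> s /\
     series (fun j => v j * z ^+ j) @ \oo --> s) ->
  u =1 v.
Proof.
move=> u0 v0 u1 v1 uv; elim/ltn_ind => j IH.
have key (a b : nat -> R) : (forall j, 0 <= a j) -> (forall j, 0 <= b j) ->
    (forall N, \sum_(0 <= j < N) b j <= 1) ->
    (forall z : R, 0 < z < 1 -> exists s : R,
     series (fun j => a j * z ^+ j) @ \oo --> s /\
     series (fun j => b j * z ^+ j) @ \oo --> s) ->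
    (forall i, (i < j)%N -> a i = b i) -> a j <= b j.
  move=> a0 b0 b1 ab E; apply: ler_eps => e e0.
  pose z := Num.min e 2^-1.
  have z0 : 0 < z by rewrite lt_min e0/= invr_gt0.
  have ze : z <= e by rewrite ge_min lexx.
  have z1 : z < 1 by apply: le_lt_trans (_ : _ <= 2^-1) _; [rewrite ge_min lexx orbT|lra].
  clearbody z.
  have [s [as_ bs]] := ab z (introT andP (conj z0 z1)).
  have zn n : 0 <= z ^+ n by rewrite exprn_ge0// ltW.
  have h1 : \sum_(0 <= i < j.+1) a i * z ^+ i <= s.
    by apply: (series_ge0_le _ _ as_) => i; rewrite mulr_ge0.
  have h2 : s - \sum_(0 <= i < j.+1) b i * z ^+ i <= z ^+ j.+1.
    apply: (series_tail_le bs) => N.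
    have [Nj|jN] := leqP N j.+1; first by rewrite big_geq.
    apply: (@le_trans _ _ (\sum_(j.+1 <= i < N) b i * z ^+ j.+1)).
      apply: ler_sum_nat => i /andP[ji _]; apply: ler_wpM2l => //.
      by apply: ler_wiXn2l => //; exact: ltW.
    rewrite -mulr_suml ler_piMl//; apply: le_trans (b1 N).
    by rewrite [leRHS](@big_cat_nat _ _ _ j.+1)//= ?(ltnW jN)// lerDr sumr_ge0.
  rewrite !big_nat_recr//= in h1 h2.
  have E2 : \sum_(0 <= i < j) a i * z ^+ i = \sum_(0 <= i < j) b i * z ^+ i.
    by apply: eq_big_nat => i /andP[_ ij]; rewrite E.
  have h3 : a j * z ^+ j <= (b j + z) * z ^+ j.
    by move: h1 h2; rewrite E2 exprSr; lra.
  rewrite ler_pM2r in h3; last by rewrite exprn_gt0.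
  lra.
apply/eqP; rewrite eq_le; apply/andP; split; apply: key => //.
  by move=> z z01; have [s [? ?]] := uv z z01; exists s.
by move=> i ij; rewrite IH.
Qed.

End ExtendedSeries.

Section DiscreteLaw.
Context {R : realType} dO (Omega : measurableType dO) (P : probability Omega R).
Variable X : {RV P >-> nat}.

Definition pmf_of (j : nat) : R := fine (P (X @^-1` [set j])).

Lemma measurable_RV_pre (A : set nat) : measurable (X @^-1` A).
Proof. by rewrite -[X in measurable X]setTI; exact: (measurable_funP X). Qed.

Lemma pmf_ofE j : P (X @^-1` [set j]) = (pmf_of j)%:E.
Proof. by rewrite /pmf_of fineK// fin_num_measure//; exact: measurable_RV_pre. Qed.

Lemma pmf_of_ge0 j : 0 <= pmf_of j.
Proof. exact: fine_ge0. Qed.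

Let cover : [set: Omega] = \bigcup_k (X @^-1` [set k]).
Proof. by apply/seteqP; split=> o // _; exists (X o). Qed.

Let disjoint_fibers : trivIset [set: nat] (fun k => X @^-1` [set k]).
Proof. by move=> i j _ _ [w []] /= <- <-. Qed.

Lemma expectation_pmf_of (f : nat -> R) : (forall j, 0 <= f j) ->
  ('E_P[fun o => f (X o)] = \sum_(0 <= j <oo) (f j * pmf_of j)%:E)%E.
Proof.
move=> f0; rewrite unlock cover ge0_integral_bigcup//.
- apply: eq_eseriesr => j _.
  transitivity (\int[P]_(o in X @^-1` [set j]) cst (f j)%:E o)%E.
    by apply: eq_integral => o; rewrite inE => /= ->.
  rewrite integral_cst; last exact: measurable_RV_pre.
  by rewrite EFinM -pmf_ofE.
- by move=> k; exact: measurable_RV_pre.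
- rewrite -cover; apply/measurable_EFinP.
  apply: (measurableT_comp _ (measurable_funP X)) => // _ A mA.
- by move=> o _; rewrite lee_fin.
Qed.

Lemma sum_pmf_of : series pmf_of @ \oo --> (1 : R).
Proof.
apply: eseries_cvg; first exact: pmf_of_ge0.
have := @expectation_pmf_of (fun=> 1) (fun=> ler01).
rewrite (_ : (fun o => _) = cst 1)// expectation_cst => ->.
by apply: eq_eseriesr => j _; rewrite mul1r.
Qed.

End DiscreteLaw.

(** * Random finite sequences and total variation *)

Section Enumeration.
Context {R : realType}.
Implicit Types (p w F : nat -> R) (M k n : nat) (x : seq nat).

Fixpoint seqs M k : seq (seq nat) :=
  if k is k'.+1 then [seq j :: x | j <- iota 0 M, x <- seqs M k'] else [:: [::]].

Lemma mem_seqs M k x : (x \in seqs M k) = (size x == k) && all (gtn M) x.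
Proof.
elim: k x => [|k IH] [|j x]//=.
  by apply/negbTE/negP => /allpairsP[[a b] /= [_ _]].
apply/allpairsP/idP => [[[a b] /= [ha hb [-> ->]]]|/and3P[/eqP[sx] jM xM]].
  move: ha hb; rewrite mem_iota add0n IH => /andP[_ ->] /andP[/eqP -> ->].
  by rewrite eqxx.
exists (j, x); split=> //=; first by rewrite mem_iota.
by rewrite IH sx eqxx.
Qed.

Lemma uniq_seqs M k : uniq (seqs M k).
Proof.
elim: k => //= k IH; apply: allpairs_uniq => //; first exact: iota_uniq.
by move=> [a b] [c d] _ _ /= [-> ->].
Qed.

Lemma sum_seqs p M k F :
  \sum_(x <- seqs M k) (\prod_(y <- x) p y) * F (sumn x) = iexp p M k F.
Proof.
elim: k F => [|k IH] F; first by rewrite big_seq1 big_nil mul1r.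
rewrite iexpS [LHS]big_allpairs_dep /index_iota subn0; apply: eq_bigr => j _.
by rewrite -IH mulr_sumr; apply: eq_bigr => x _; rewrite big_cons mulrA.
Qed.

Lemma sum_seqs_eqn p M k n : (n < M)%N ->
  \sum_(x <- seqs M k | sumn x == n) \prod_(y <- x) p y = conv p k n.
Proof.
move=> nM; rewrite -(iexp_eqn _ _ nM) -sum_seqs big_mkcond/=.
by apply: eq_bigr => x _; case: eqP; rewrite (mulr1, mulr0).
Qed.

Lemma conv_scale p w (c z : R) k n :
  (forall j, w j = c * p j * z ^+ j) -> conv w k n = c ^+ k * conv p k n * z ^+ n.
Proof.
move=> wE; elim: k n => [|k IH] n.
  by rewrite !conv0 mul1r; case: eqP => [->|]; rewrite ?mul0r// mulr1.
rewrite !convS mulr_sumr mulr_suml big_nat [RHS]big_nat.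
apply: eq_bigr => j /andP[_ jn]; rewrite wE IH.
rewrite -[in RHS](@subnKC j n)// exprD exprS; rewrite addKn; ring.
Qed.

(** The coefficients of the [k]-th power of [sum_j w_j X^j], read off in two
    ways. *)
Lemma sum_ffun_conv w k n :
  \sum_(x : {ffun 'I_k -> 'I_n.+1} | (\sum_i x i)%N == n) \prod_i w (x i) =
  conv w k n.
Proof.
have pow t : (t < n.+1)%N -> ((\poly_(j < n.+1) w j) ^+ k)`_t = conv w k t.
  elim: k t => [|k IH] t tn; first by rewrite expr0 coef1 conv0.
  rewrite exprS coefM convS big_mkord; apply: eq_bigr => j _.
  have jt := ltn_ord j.
  by rewrite coef_poly IH ?(leq_ltn_trans (leq_subr _ _))//; case: ltnP => //; nlia.
rewrite -(pow n)// poly_def -[k in _ ^+ k]card_ord -prodr_const bigA_distr_bigA/=.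
rewrite coef_sum big_mkcond/=; apply: eq_bigr => x _.
rewrite (_ : \prod_(i < k) _ =
   (\prod_(i < k) w (x i))%:P * 'X^(\sum_(i < k) x i)).
  by rewrite coefCM coefXn eq_sym; case: eqP; rewrite (mulr1, mulr0).
rewrite rmorph_prod expr_sum -big_split/=; apply: eq_bigr => i _.
by rewrite mul_polyC.
Qed.

Lemma gibbs_uE (v w : nat -> R) n :
  gibbs_u v w n = (\sum_(1 <= k <oo) (v k * conv w k n)%:E)%E.
Proof. by apply: eq_eseriesr => k _; rewrite sum_ffun_conv. Qed.

End Enumeration.

Section RandomSequence.
Context {R : realType} dO (Omega : measurableType dO) (P : probability Omega R).
Variable g : Omega -> seq nat.

Definition pr (A : set (seq nat)) : R := fine (P (g @^-1` A)).

Hypothesis mg : forall A, measurable (g @^-1` A).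

Lemma prE A : P (g @^-1` A) = (pr A)%:E.
Proof. by rewrite /pr fineK// fin_num_measure. Qed.

Lemma pr_ge0 A : 0 <= pr A.
Proof. exact: fine_ge0. Qed.

Lemma pr_le A B : A `<=` B -> pr A <= pr B.
Proof.
by move=> AB; rewrite -lee_fin -!prE le_measure ?inE// => o; exact: AB.
Qed.

Lemma prU A B : A `&` B = set0 -> pr (A `|` B) = pr A + pr B.
Proof.
move=> AB; apply: EFin_inj; rewrite EFinD -!prE preimage_setU measureU//.
by rewrite -preimage_setI AB preimage_set0.
Qed.

Lemma prC A : pr (~` A) = 1 - pr A.
Proof.
apply: EFin_inj; rewrite EFinB -!prE preimage_setC probability_setC//; exact: mg.
Qed.

Lemma pr_le1 A : pr A <= 1.
Proof. by rewrite -lee_fin -prE probability_le1. Qed.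

Lemma pr_seq (l : seq (seq nat)) : uniq l ->
  pr [set` l] = \sum_(z <- l) pr [set z].
Proof.
elim: l => [|z l IH] /= => [_|/andP[zl ul]].
  by rewrite big_nil (_ : [set` _] = set0) ?/pr ?preimage_set0 ?measure0//;
     apply/seteqP; split.
rewrite big_cons -IH// -prU; last first.
  by apply/seteqP; split=> x //= [->]; rewrite (negbTE zl).
congr pr; apply/seteqP; split=> x /=; rewrite inE.
  by case/orP => [/eqP ->|]; [left|right].
by case=> [->|->]; rewrite ?eqxx ?orbT.
Qed.

End RandomSequence.

Section TotalVariation.
Context {R : realType} d1 (O1 : measurableType d1) (P1 : probability O1 R).
Context d2 (O2 : measurableType d2) (P2 : probability O2 R).
Variables (g1 : O1 -> seq nat) (g2 : O2 -> seq nat).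
Hypotheses (mg1 : forall A, measurable (g1 @^-1` A))
           (mg2 : forall A, measurable (g2 @^-1` A)).

(** A one-sided comparison of point masses on a set of large probability is
    enough: summed over an event and over its complement it bounds the
    difference of the two probabilities from both sides. *)
Lemma dTV_le (l : seq (seq nat)) (d : R) : uniq l -> 0 <= d ->
  (forall z, z \in l -> (1 - d) * pr P2 g2 [set z] <= pr P1 g1 [set z]) ->
  1 - d <= pr P2 g2 [set` l] ->
  (dTV (pushforward P1 g1) (pushforward P2 g2) <= (2 * d)%:E)%E.
Proof.
move=> ul d0 hl hd; apply: ge_ereal_sup => _ [A _ <-].
have half B : pr P2 g2 B - 2 * d <= pr P1 g1 B.
  pose lB := [seq z <- l | `[< B z >]].
  have ulB : uniq lB by rewrite filter_uniq.
  have h1 : pr P1 g1 [set` lB] <= pr P1 g1 B.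
    by apply: pr_le => // z /=; rewrite mem_filter => /andP[/asboolP].
  have h2 : (1 - d) * pr P2 g2 [set` lB] <= pr P1 g1 [set` lB].
    rewrite !pr_seq// mulr_sumr big_seq [leRHS]big_seq; apply: ler_sum => z.
    by rewrite mem_filter => /andP[_ zl]; exact: hl.
  have h3 : pr P2 g2 B <= pr P2 g2 [set` lB] + pr P2 g2 (~` [set` l]).
    rewrite -prU//; last first.
      by apply/seteqP; split=> z //= []; rewrite mem_filter => /andP[_ zl].
    apply: pr_le => // z Bz /=; rewrite mem_filter.
    by case: (boolP (z \in l)) => zl; [left; rewrite andbT; exact/asboolP|right].
  have h4 : d * pr P2 g2 [set` lB] <= d by rewrite ler_piMr// pr_le1.
  rewrite prC// in h3; lra.
have h1 := half A; have := half (~` A); rewrite !prC// => h2.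
rewrite /pushforward !prE// -EFinB abse_EFin lee_fin ler_norml; lra.
Qed.

Lemma dTV_ge A :
  ((pr P1 g1 A - pr P2 g2 A)%:E <= dTV (pushforward P1 g1) (pushforward P2 g2))%E.
Proof.
apply: ereal_sup_ge; exists (`|(pr P1 g1 A - pr P2 g2 A)%:E|)%E.
  by exists A => //; rewrite /pushforward !prE.
by rewrite abse_EFin lee_fin ler_norm.
Qed.

End TotalVariation.

Section IndependentCopies.
Context {R : realType} dO (Omega : measurableType dO) (P : probability Omega R).
Variables (Xs : nat -> {RV P >-> nat}) (p : nat -> R).
Hypothesis Xs_law : forall i j, P (Xs i @^-1` [set j]) = (p j)%:E.
Hypothesis Xs_indep : mutually_independent Xs.

Let copies m : Omega -> seq nat := fun o => mkseq (fun i => Xs i o) m.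

Let copies_point m x : copies m @^-1` [set x] =
  if size x == m then
    \bigcap_(i in [set i | (i < m)%N]) (Xs i @^-1` [set nth 0%N x i])
  else set0.
Proof.
case: eqP => [sx|sx]; last first.
  by apply/seteqP; split=> o //= xE; apply: sx; rewrite -xE size_mkseq.
apply/seteqP; split=> o /= => [xE i /= im|h].
  by rewrite -xE nth_mkseq.
apply: (@eq_from_nth _ 0%N); rewrite size_mkseq// => i im.
by rewrite nth_mkseq//; exact: h.
Qed.

Lemma measurable_copies m A : measurable (copies m @^-1` A).
Proof.
have -> : copies m @^-1` A = \bigcup_(x in A) (copies m @^-1` [set x]).
  by apply/seteqP; split=> o /=; [move=> h; exists (copies m o)|by case=> x Ax ->].
rewrite bigcup_mkcond; apply: countable_bigcupT_measurable => [|x].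
  exact: countableP.
case: ifP => // _; rewrite copies_point; case: ifP => // _.
by apply: bigcap_measurableType => i _; exact: measurable_RV_pre.
Qed.

Lemma pr_copies m x : size x = m ->
  pr P (copies m) [set x] = \prod_(y <- x) p y.
Proof.
move=> sx; rewrite /pr copies_point sx eqxx Xs_indep.
rewrite (big_nth 0%N) sx big_mkord -[RHS]/(fine (_%:E)) -prodEFin.
by congr fine; apply: eq_bigr => i _; exact: Xs_law.
Qed.

Lemma pr_copies_seqs (m n : nat) (B : pred nat) :
  (forall t, B t -> (t <= n)%N) ->
  pr P (copies m) [set` [seq x <- seqs n.+1 m | B (sumn x)]] =
  \sum_(0 <= t < n.+1) (B t)%:R * conv p m t.
Proof.
move=> Bn; rewrite -(@iexp_conv _ p n.+1 m n (fun t => (B t)%:R))//; last first.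
  by move=> t nt; case: (boolP (B t)) => // /Bn; nlia.
rewrite -sum_seqs pr_seq.
- rewrite big_filter big_mkcond [LHS]big_seq [RHS]big_seq.
  apply: eq_bigr => x; rewrite mem_seqs => /andP[/eqP sx _].
  by rewrite pr_copies//; case: (B _); rewrite (mulr1, mulr0).
- exact: measurable_copies.
- by rewrite filter_uniq// uniq_seqs.
Qed.

Lemma pr_copies_sum (m n : nat) : pr P (copies m) [set x | (sumn x <= n)%N] =
  \sum_(0 <= t < n.+1) conv p m t.
Proof.
transitivity (\sum_(0 <= t < n.+1) (t <= n)%N%:R * conv p m t); last first.
  rewrite big_nat [RHS]big_nat; apply: eq_bigr => t /andP[_ tn].
  by rewrite -ltnS tn mul1r.
rewrite -(pr_copies_seqs m (B := fun t => (t <= n)%N))//.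
rewrite /pr; congr (fine (P _)); apply/seteqP; split=> o /=; last first.
  by rewrite mem_filter => /andP[].
move=> h; rewrite mem_filter h/= mem_seqs [size _]size_mkseq eqxx/=.
by apply/allP => y yx /=; apply: leq_trans h; rewrite sumnE (big_rem y)//= leq_addr.
Qed.

End IndependentCopies.

(** * Component sizes compared with independent copies *)

Section ComponentSizes.
Context {R : realType} d1 (O1 : measurableType d1) (P1 : probability O1 R).
Context dO (Omega : measurableType dO) (P : probability Omega R).
Variables (K : {RV P1 >-> seq nat}) (n : nat) (p q : nat -> R) (Z : R).
Variable Xs : nat -> {RV P >-> nat}.
Hypotheses (p0 : forall j, 0 <= p j) (q0 : forall k, (0 < k)%N -> 0 <= q k).
Hypotheses (Z0 : 0 < Z)
  (hZ : (\sum_(1 <= k <oo) (q k * conv p k n)%:E = Z%:E)%E).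
Hypothesis hK : forall x, (0 < size x)%N -> sumn x = n ->
  P1 (K @^-1` [set x]) = (q (size x) * (\prod_(y <- x) p y) / Z)%:E.
Hypothesis Xs_law : forall i j, P (Xs i @^-1` [set j]) = (p j)%:E.
Hypothesis Xs_indep : mutually_independent Xs.

Let mK A : measurable (K @^-1` A).
Proof. by rewrite -[X in measurable X]setTI; exact: (measurable_funP K). Qed.

Lemma measurable_take m A : measurable ((fun o => take m (K o)) @^-1` A).
Proof. exact: (mK (take m @^-1` A)). Qed.

(** Summing the weights of all ways to complete the initial segment [x] by
    fewer than [J] further components. *)
Lemma pr_completions (x : seq nat) (i J : nat) :
  (sumn x <= n)%N -> (0 < size x + i)%N ->
  (\prod_(y <- x) p y) / Z *
    \sum_(i <= j < J) q (size x + j)%N * conv p j (n - sumn x)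
  <= pr P1 K [set z | [/\ take (size x) z = x, sumn z = n
                        & (size z < size x + J)%N]].
Proof.
move=> xn mi; elim: J => [|J IH]; first by rewrite big_geq// mulr0 pr_ge0.
have [iJ|Ji] := leqP i J; last by rewrite big_geq// mulr0 pr_ge0.
pose r := (n - sumn x)%N.
pose l := [seq x ++ y | y <- seqs r.+1 J & sumn y == r].
have ul : uniq l.
  rewrite map_inj_in_uniq ?filter_uniq ?uniq_seqs//.
  by move=> y z _ _ /eqP; rewrite eqseq_cat// eqxx => /eqP.
have lP z : z \in l -> [/\ take (size x) z = x, sumn z = n
    & size z = (size x + J)%N].
  case/mapP => y; rewrite mem_filter mem_seqs => /and3P[/eqP sy /eqP ly _] ->.
  by rewrite take_size_cat// sumn_cat sy size_cat ly subnKC.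
rewrite big_nat_recr//= mulrDr.
apply: (@le_trans _ _ (pr P1 K ([set z | [/\ take (size x) z = x, sumn z = n
    & (size z < size x + J)%N]] `|` [set` l]))); last first.
  apply: pr_le => // z /= [[? ?]|/lP[? ? ->]]; last by split=> //; nlia.
  by move=> ?; split=> //; nlia.
rewrite prU//; last first.
  by apply/seteqP; split=> z //= [[_ _ h] /lP[_ _ hz]]; move: h; rewrite hz ltnn.
apply: lerD => //; rewrite pr_seq// big_map -(sum_seqs_eqn p J (ltnSn r)).
rewrite big_filter !mulr_sumr big_seq_cond [leRHS]big_seq_cond.
apply: ler_sum => y; rewrite mem_seqs => /andP[/andP[/eqP sy _] /eqP ry].
rewrite /pr hK/=; last 2 first.
  by rewrite size_cat sy; nlia.
  by rewrite sumn_cat ry subnKC.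
by rewrite size_cat sy big_cat/=; apply: eq_ler; ring.
Qed.

Lemma pr_sumn_sizes : pr P1 K [set z | sumn z = n] = 1.
Proof.
apply/eqP; rewrite eq_le pr_le1// -(ler_pM2r Z0) mul1r -lee_fin -hZ.
have qc k : (0 < k)%N -> 0 <= q k * conv p k n.
  by move=> k0; rewrite mulr_ge0 ?q0 ?conv_ge0.
apply: eseries_le => // N.
have := @pr_completions [::] 1 N (leq0n _) isT.
rewrite big_nil subn0 mul1r mulrC ler_pdivrMr// => h.
apply: le_trans h _; rewrite ler_pM2r//.
by apply: pr_le => // z; case.
Qed.

(** The initial segment is close to independent copies as soon as the weight of
    completing it is almost at least [Z] for all likely values of its sum. *)
Lemma gibbs_tv_le m lo hi (d : R) : (0 < m)%N -> 0 <= d -> (hi <= n)%N ->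
  (forall r, (n - hi <= r <= n - lo)%N -> exists J, forall M,
     (1 - d) * \sum_(1 <= k < M) q k * conv p k n <=
     \sum_(0 <= j < J) q (m + j)%N * conv p j r) ->
  1 - d <= \sum_(lo <= t < hi.+1) conv p m t ->
  (dTV (pushforward P1 (fun o => take m (K o)))
       (pushforward P (fun o => mkseq (fun i => Xs i o) m)) <= (2 * d)%:E)%E.
Proof.
move=> m0 d0 hin hr hs.
have [d_le1|d_gt1] := leP d 1; last first.
  apply: (@dTV_le _ _ _ _ _ _ _ _ _ _ _ [::]) => //.
  - exact: measurable_take.
  - exact: measurable_copies.
  - by apply: le_trans (pr_ge0 _ _ _); rewrite subr_le0 ltW.
pose B t := (lo <= t <= hi)%N.
apply: (@dTV_le _ _ _ _ _ _ _ _ _ _ _ [seq x <- seqs n.+1 m | B (sumn x)]).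
- exact: measurable_take.
- exact: measurable_copies.
- by rewrite filter_uniq// uniq_seqs.
- exact: d0.
- move=> x; rewrite mem_filter mem_seqs => /andP[/andP[lx xh] /andP[/eqP sx _]].
  rewrite (pr_copies Xs_law)//.
  have xn : (sumn x <= n)%N by nlia.
  have [|J hJ] := hr (n - sumn x)%N; first by nlia.
  have sz : (0 < size x + 0)%N by rewrite sx; nlia.
  apply: le_trans (_ : (\prod_(y <- x) p y) / Z *
      \sum_(0 <= j < J) q (m + j)%N * conv p j (n - sumn x)%N <= _); last first.
    rewrite -sx; apply: le_trans (pr_completions J xn sz) _.
    by apply: (pr_le P1 mK (B := take (size x) @^-1` [set x])) => z [].
  have Zle : (1 - d) * Z <= \sum_(0 <= j < J) q (m + j)%N * conv p j (n - sumn x).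
    have [->|dn] := eqVneq d 1.
      rewrite subrr mul0r sumr_ge0// => j _.
      by rewrite mulr_ge0 ?conv_ge0// q0//; nlia.
    have d2 : 0 < 1 - d by rewrite subr_gt0 lt_neqAle dn.
    rewrite mulrC -ler_pdivlMr// -lee_fin -hZ; apply: eseries_le => [k k0|N].
      by rewrite mulr_ge0 ?q0 ?conv_ge0.
    by rewrite ler_pdivlMr// mulrC.
  have pr0 : 0 <= \prod_(y <- x) p y by rewrite prodr_ge0.
  apply: le_trans (_ : (\prod_(y <- x) p y) / Z * ((1 - d) * Z) <= _).
    by apply: eq_ler; field; rewrite gt_eqF.
  by apply: ler_wpM2l => //; rewrite divr_ge0// ltW.
- apply: le_trans hs _; rewrite (pr_copies_seqs Xs_law) ?Xs_indep//; last first.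
    by move=> t; rewrite /B; nlia.
  rewrite (@big_nat_widenl _ _ _ lo 0)// (@big_nat_widen _ _ _ _ hi.+1 n.+1)//.
  rewrite big_mkcond/=; apply: ler_sum => t _; rewrite /B ltnS.
  by case: (_ && _); rewrite ?mul1r ?mul0r.
Qed.

Lemma gibbs_tv_ge m : ((1 - \sum_(0 <= t < n.+1) conv p m t)%:E <=
  dTV (pushforward P1 (fun o => take m (K o)))
      (pushforward P (fun o => mkseq (fun i => Xs i o) m)))%E.
Proof.
apply: le_trans
  (dTV_ge P1 P (measurable_take m) (measurable_copies Xs m) [set x | (sumn x <= n)%N]).
rewrite lee_fin; apply: lerB; last by rewrite (pr_copies_sum Xs_law).
rewrite -pr_sumn_sizes.
apply: (pr_le P1 mK (B := take m @^-1` [set x | (sumn x <= n)%N])) => z /= <-.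
by rewrite -{2}(cat_take_drop m z) sumn_cat leq_addr.
Qed.

End ComponentSizes.

(** * Gaps between the prefix length and its mean *)

Section GapConditions.
Context {R : realType}.
Variables (p : nat -> R) (mu : R).
Hypothesis p0 : forall j, 0 <= p j.
Hypothesis p1 : series p @ \oo --> (1 : R).
Hypothesis pmu : series (fun j => p j * j%:R) @ \oo --> mu.
Hypothesis pgcd : is_gcd [set n | 0 < p n] 1.

Let mu0 : 0 < mu. Proof. exact: law_mean_gt0 p0 pmu pgcd. Qed.

Lemma eventually_small (s : nat -> nat) (e : R) :
  (s n)%:R / n%:R @[n --> \oo] --> (0 : R) -> 0 < e ->
  exists n0, forall n, (n0 <= n)%N -> (s n)%:R <= e * n%:R.
Proof.
move=> sn e0; have [n0 h] := cvg0_near sn e0; exists n0.+1 => n nn.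
by have := h n (ltnW nn); rewrite ler_pdivrMr// ltr0n; nlia.
Qed.

Lemma positive_atom : exists j, (0 < j)%N /\ 0 < p j.
Proof.
apply: contrapT => /forallNP h; suff : (0 %| 1)%N by [].
by apply: pgcd.2 => -[//|n] pn; exfalso; apply: (h n.+1).
Qed.

Section Gap.
Variable s : nat -> nat.
Hypothesis s0 : forall n, (0 < n)%N -> (0 < s n)%N.
Hypothesis sn : (s n)%:R / n%:R @[n --> \oo] --> (0 : R).

Let m n := (Num.truncn (n%:R / mu) - s n)%N.

Lemma gap_prefix_large : exists n0, forall n, (n0 <= n)%N ->
  [/\ (s n <= Num.truncn (n%:R / mu))%N, (0 < m n)%N
    & n%:R <= 2 * mu * (m n)%:R].
Proof.
have e0 : 0 < (8 * mu)^-1 by rewrite invr_gt0 mulr_gt0.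
have [n1 h1] := eventually_small sn e0.
have [n2 h2] := exists_natr_ge (8 * mu).
exists (maxn n1 n2.+1) => n; rewrite geq_max => /andP[/h1 sh nn].
have n8 : 8 * mu <= n%:R by rewrite (le_trans h2)// ler_nat ltnW.
have [_ tb] := truncn_bounds p0 pmu pgcd n.
have nr : 0 < (n%:R : R) by rewrite ltr0n; nlia.
have smu : (s n)%:R * mu <= n%:R / 8.
  rewrite -ler_pdivlMr//; apply: le_trans sh _; apply: eq_ler; field.
  by rewrite gt_eqF.
have st : (s n <= Num.truncn (n%:R / mu))%N.
  by rewrite -(ler_nat R) -(ler_pM2r mu0); lra.
have mE : (m n)%:R * mu = (Num.truncn (n%:R / mu))%:R * mu - (s n)%:R * mu.
  by rewrite /m natrB// mulrBl.
have mn : n%:R <= 2 * mu * (m n)%:R.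
  by rewrite -mulrA [mu * _]mulrC mE; lra.
split=> //; have := lt_le_trans nr mn.
by rewrite pmulr_rgt0 ?mulr_gt0// ltr0n.
Qed.

(** A gap of the order of the fluctuations would leave a positive probability
    that the prefix of independent copies already exceeds [n]. *)
Lemma gap_exceeds_spread (y : nat -> R) : upward_spread p mu y ->
  (forall e : R, 0 < e -> exists n0, forall n, (n0 <= n)%N ->
     1 - \sum_(0 <= t < n.+1) conv p (m n) t <= e) ->
  forall C, 0 < C -> exists n0, forall n, (n0 <= n)%N -> C * y n < (s n)%:R.
Proof.
move=> yS tv C C0.
have [c [n1 [c0 h1]]] := yS (2 * mu * C) ltac:(by rewrite !mulr_gt0).
have [n2 h2] := tv (c / 2) ltac:(by rewrite divr_gt0).
have [n3 h3] := gap_prefix_large.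
exists (maxn (maxn n1 n2) (maxn n3 1)) => n; rewrite !geq_max.
move=> /andP[/andP[nn1 nn2] /andP[nn3 nn4]].
rewrite ltNge; apply/negP => sy.
have [st _ mn] := h3 n nn3; have [tl th] := truncn_bounds p0 pmu pgcd n.
have s1 : 1 <= (s n)%:R :> R by rewrite ler1n; exact: s0.
have mE : (m n)%:R * mu = (Num.truncn (n%:R / mu))%:R * mu - (s n)%:R * mu.
  by rewrite /m natrB// mulrBl.
have smu : (s n)%:R * mu <= C * y n * mu by rewrite ler_pM2r.
have s1mu : mu <= (s n)%:R * mu by rewrite ler_pMl.
have := h1 n (m n) n nn1 mn; rewrite mE => h.
have := h ltac:(lra) ltac:(lra); have := h2 n nn2; lra.
Qed.

Section LocalEstimate.
Variables (q : nat -> R) (b eta C2 : R).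
Hypothesis eta01 : 0 < eta <= 1.
Hypothesis pT : forall M, (0 < M)%N ->
  moment2 p M <= C2 * (M%:R : R) `^ (1 - eta).
Hypothesis b1 : 1 < b.
Hypothesis qb : regvar q b.
Hypothesis pq : one_jump_negligible p q.

(** Both halves of the comparison at once: the remainder lies in a window on
    which the local estimate applies. *)
Lemma gap_window : n%:R * moment2 p n / (s n)%:R ^+ 2 @[n --> \oo] --> (0 : R) ->
  forall d, 0 < d -> exists n0, forall n, (n0 <= n)%N -> exists lo hi,
  [/\ (0 < m n)%N, (hi <= n)%N,
      forall r, (n - hi <= r <= n - lo)%N -> exists J, forall M,
        (1 - d) * \sum_(1 <= k < M) q k * conv p k n <=
        \sum_(0 <= j < J) q (m n + j)%N * conv p j r
    & 1 - d <= \sum_(lo <= t < hi.+1) conv p (m n) t].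
Proof.
move=> sT d d0.
have [r0 [x [n1 [x0 h1]]]] := local_ratio p0 p1 pmu pgcd eta01 pT b1 qb pq d0.
have [n2 h2] := remainder_concentrates p0 p1 pmu mu0 s0 sn sT positive_atom
  (ltn0Sn r0) x0 d0.
have [n3 h3] := eventually_small sn x0.
have [n4 h4] := gap_prefix_large.
exists (maxn (maxn n1 n2) (maxn n3 n4)) => n; rewrite !geq_max.
move=> /andP[/andP[nn1 nn2] /andP[nn3 nn4]].
have [lo [lon lox lor lop]] := h2 n nn2; have [st m0 _] := h4 n nn4.
exists lo, (n - r0.+1)%N; split=> //; first exact: leq_subr.
move=> r /andP[rl rh]; apply: h1 => //.
- rewrite /m natrB// addrAC subrr add0r normrN ger0_norm//; exact: h3.
- by nlia.
- by apply: le_trans lox; rewrite ler_nat.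
Qed.

End LocalEstimate.

End Gap.

(** By the renewal theorem [n] is hit by some [S_k] with positive
    probability. *)
Lemma partition_weight_gt0 (q : nat -> R) (b : R) : regvar q b ->
  exists n0, forall n, (n0 <= n)%N ->
  exists k, (0 < k)%N /\ 0 < q k * conv p k n.
Proof.
move=> qb.
have [N hN] := renewal_theorem p0 p1 pmu pgcd (e := (2 * mu)^-1)
  ltac:(by rewrite invr_gt0 mulr_gt0).
exists N.+1 => n nN; apply: contrapT => no.
have cz k : conv p k n = 0.
  case: k => [|k]; first by rewrite conv0 gtn_eqF//; nlia.
  apply/eqP; apply: contrapT => /negP ck; apply: no; exists k.+1; split=> //.
  by rewrite mulr_gt0 ?(regvar_gt0 qb)// lt_neqAle eq_sym ck conv_ge0.
have := hN n (ltnW nN); rewrite ler_norml => /andP[h _].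
set z := (1 + p 0%N) / 2.
have p01 := law0_lt1 p0 p1 pgcd; have p00 := p0 0.
have z01 : 0 <= z < 1 by rewrite /z; lra.
have B0 : 0 < (1 - p 0%N)^-1 * 2 ^+ n.
  by rewrite mulr_gt0 ?exprn_gt0// invr_gt0 subr_gt0.
have i0 : 0 < mu^-1 by rewrite invr_gt0.
have e0 : 0 < mu^-1 / 4 / ((1 - p 0%N)^-1 * 2 ^+ n) by rewrite !divr_gt0.
have [K hK] := expr_vanish z01 e0.
have := sum_conv_ge p0 p1 pgcd K n; rewrite big1 => [|k _]; last exact: cz.
have := hK K (leqnn K); rewrite -/z ler_pdivlMr// mulrC => h1 h2.
by move: h; rewrite invfM; lra.
Qed.

End GapConditions.

(** * Growth of power series and of convolution powers *)

Section Growth.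
Context {R : realType}.
Implicit Types (p w F : nat -> R) (M N k n : nat) (z s : R).

Lemma geometric_le_powR z s : 0 < z < 1 -> 0 < s ->
  exists2 C : R, 0 < C &
  forall j, (0 < j)%N -> z ^+ j <= C * (j%:R : R) `^ (- s).
Proof.
move=> /andP[z0 z1] s0; pose c := - ln z.
have c0 : 0 < c by rewrite oppr_gt0 ln_lt0// z0.
exists (expR (- (s * ln (c / s)))) => [|j j0]; first exact: expR_gt0.
have jr : 0 < (j%:R : R) by rewrite ltr0n.
rewrite -[z]lnK ?posrE// -expRM_natr /powR gt_eqF// -expRD ler_expR.
have h : ln (j%:R * (c / s)) <= j%:R * (c / s).
  by apply: ltW; apply: ln_sublinear; rewrite mulr_gt0// divr_gt0.
rewrite lnM ?posrE ?divr_gt0// in h.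
have := ler_wpM2l (ltW s0) h; rewrite (_ : s * (j%:R * (c / s)) = j%:R * c).
  by rewrite /c; lra.
by field; rewrite gt_eqF.
Qed.

Lemma iexp_leM p M N k F : (forall j, 0 <= p j) -> (forall t, 0 <= F t) ->
  (M <= N)%N -> iexp p M k F <= iexp p N k F.
Proof.
move=> p0 F0 MN; elim: k F F0 => [//|k IH] F F0; rewrite !iexpS.
rewrite [leRHS](@big_cat_nat _ _ _ M)//= ler_wpDr//.
  by rewrite sumr_ge0// => j _; rewrite mulr_ge0// iexp_ge0.
by apply: ler_sum => j _; apply: ler_wpM2l => //; exact: IH.
Qed.

Lemma eq_iexp_bounded p M k F G : (forall t, (t <= k * M)%N -> F t = G t) ->
  iexp p M k F = iexp p M k G.
Proof.
elim: k F G => [|k IH] F G FG; first exact: FG.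
rewrite !iexpS big_nat [RHS]big_nat; apply: eq_bigr => j /andP[_ jM].
by congr (_ * _); apply: IH => t tk; apply: FG; rewrite mulSn; nlia.
Qed.

(** The generating function of [S_k] dominates the [k]-th power of every
    partial sum of the generating function of one summand. *)
Lemma exp_le_sum_conv p M k z : (forall j, 0 <= p j) -> 0 <= z ->
  exists N, (\sum_(0 <= j < M) p j * z ^+ j) ^+ k <=
    \sum_(0 <= n < N) z ^+ n * conv p k n.
Proof.
move=> p0 z0; pose n := maxn (k * M) M; exists n.+1.
pose F t : R := (t <= n)%N%:R * z ^+ t.
have F0 t : 0 <= F t by rewrite mulr_ge0// exprn_ge0.
rewrite -iexp_exp (@eq_iexp_bounded _ _ _ _ F); last first.
  by move=> t tk; rewrite /F (leq_trans tk (leq_maxl _ _)) mul1r.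
apply: le_trans (iexp_leM k p0 F0 (_ : (M <= n.+1)%N)) _.
  exact: leq_trans (leq_maxr _ _) (leqnSn _).
rewrite (@iexp_conv _ _ _ _ n)//; last first.
  by move=> t nt; rewrite /F leqNgt nt mul0r.
rewrite big_nat [leRHS]big_nat; apply: ler_sum => t /andP[_ tn].
by rewrite /F -ltnS tn mul1r.
Qed.

(** Placing [l] summands equal to [d] and making the others vanish. *)
Lemma conv_ge_binomial w d l k : (forall j, 0 <= w j) -> (0 < d)%N ->
  'C(k, l)%:R * w 0%N ^+ k * w d ^+ l <= conv w k (d * l) * w 0%N ^+ l.
Proof.
move=> w0 d0; elim: k l => [|k IH] [|l].
- by rewrite muln0 conv0 bin0 !expr0 eqxx !mulr1.
- by rewrite bin0n mul0r mul0r mulr_ge0 ?exprn_ge0// conv_ge0.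
- rewrite muln0 bin0 expr0 !mul1r mulr1 mulr1 convS big_nat1 exprS.
  apply: ler_wpM2l => //; have := IH 0%N.
  by rewrite muln0 bin0 expr0 mul1r !mulr1 subn0.
have d1 := leq_pmulr d (ltn0Sn l).
have h : w 0%N * conv w k (d * l.+1) + w d * conv w k (d * l) <=
    conv w k.+1 (d * l.+1).
  rewrite convS big_ltn// subn0 lerD2l.
  rewrite (@big_cat_nat _ _ _ d)//=; last by nlia.
  rewrite (@big_ltn _ _ _ d); last by nlia.
  rewrite (_ : d * l.+1 - d = d * l)%N; last by rewrite mulnS addKn.
  rewrite addrCA lerDl addr_ge0// sumr_ge0// => j _;
  by rewrite mulr_ge0// conv_ge0.
apply: le_trans (ler_wpM2r (exprn_ge0 _ (w0 0%N)) h).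
have h1 := ler_wpM2l (w0 0%N) (IH l.+1).
have h2 := ler_wpM2l (mulr_ge0 (w0 d) (w0 0%N)) (IH l).
apply: le_trans (le_trans (lerD h1 h2) _); last first.
  by apply: eq_ler; rewrite exprS; ring.
by apply: eq_ler; rewrite binS natrD !exprS; ring.
Qed.

Lemma ffact_ge k l : ((k - l) ^ l <= k ^_ l)%N.
Proof.
elim: l k => [//|l IH] k; rewrite ffactnS expnS leq_mul ?leq_subr//.
by rewrite (_ : k - l.+1 = k.-1 - l)%N ?IH//; lia.
Qed.

End Growth.

Section LevelOfPowerSeries.
Context {R : realType}.
Variables (w : nat -> R) (t x1 B c : R).
Hypotheses (w0 : forall j, 0 <= w j) (x10 : 0 <= x1) (x1t : x1 < t)
  (tB : forall N, \sum_(0 <= j < N) w j * t ^+ j <= B).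
Hypotheses (wc : w 0%N < c) (x1c : exists N, c < \sum_(0 <= j < N) w j * x1 ^+ j).

Let W N (x : R) := \sum_(0 <= j < N) w j * x ^+ j.

(** Convexity turns the bound at [t] into a uniform Lipschitz constant on
    [[0, x1]]. *)
Let lipschitz N (x y : R) : 0 <= y -> y <= x -> x <= x1 ->
  W N x - W N y <= (x - y) * (B / (t - x1)).
Proof.
move=> y0 yx xx1; have xt : x < t := le_lt_trans xx1 x1t.
have pw n : (x ^+ n - y ^+ n) * (t - x) <= (x - y) * t ^+ n.
  elim: n => [|n IH]; first by rewrite subrr mul0r expr0 mulr1 subr_ge0.
  have yt : y ^+ n <= t ^+ n by apply: lerXn2r; rewrite ?nnegrE; lra.
  rewrite !exprS.
  have h1 := ler_wpM2l (le_trans y0 yx) IH.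
  have h2 : 0 <= (x - y) * (t - x) * (t ^+ n - y ^+ n).
    by rewrite !mulr_ge0 ?subr_ge0//; lra.
  rewrite -subr_ge0; move: h1; rewrite -subr_ge0 => h1.
  by apply: le_trans (addr_ge0 h1 h2) _; apply: eq_ler; ring.
have tx : 0 < t - x1 by rewrite subr_gt0.
rewrite mulrA ler_pdivlMr//.
have Wle : W N y <= W N x.
  by apply: ler_sum => j _; rewrite ler_wpM2l// lerXn2r ?nnegrE//; lra.
apply: (@le_trans _ _ ((W N x - W N y) * (t - x))).
  by apply: ler_wpM2l; lra.
apply: (@le_trans _ _ ((x - y) * W N t)); last first.
  by apply: ler_wpM2l; [lra|exact: tB].
rewrite /W -sumrB mulr_suml mulr_sumr; apply: ler_sum => j _.
rewrite -mulrBr -mulrA [leRHS]mulrCA; apply: ler_wpM2l => //; exact: pw.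
Qed.

Let B0 : 0 <= B. Proof. by have := tB 0; rewrite big_geq. Qed.

Lemma power_series_level : exists rho, [/\ 0 < rho, rho < t &
  series (fun j => w j * rho ^+ j) @ \oo --> c].
Proof.
pose S := [set x | 0 <= x <= x1 /\ forall N, W N x <= c].
have S0 : S 0.
  split; first by rewrite lexx.
  move=> [|N]; first by rewrite /W big_geq//; exact: le_trans (w0 0) (ltW wc).
  rewrite /W big_nat_recl//= expr0 mulr1 big1 ?addr0 ?(ltW wc)// => j _.
  by rewrite expr0n mulr0.
have Sub : has_ubound S by exists x1 => x [/andP[_ ?] _].
have Ssup : has_sup S by split; [exists 0|].
pose rho := sup S; pose D := B / (t - x1) + 1.
have D0 : 0 < D by rewrite /D ltr_wpDl// divr_ge0// subr_ge0 ltW.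
have lip N (x y : R) : 0 <= y -> y <= x -> x <= x1 -> W N x - W N y <= (x - y) * D.
  move=> y0 yx xx1; apply: le_trans (lipschitz N y0 yx xx1) _.
  by apply: ler_wpM2l; rewrite /D; lra.
have r0 : 0 <= rho by exact: (ub_le_sup Sub S0).
have rx : rho <= x1 by apply: ge_sup; [exists 0|move=> x [/andP[_ ?] _]].
have rc N : W N rho <= c.
  apply: ler_eps => e e0; have eD : 0 < e / D by rewrite divr_gt0.
  have [x Sx xr] := sup_adherent eD Ssup.
  have xr2 : x <= rho by exact: (ub_le_sup Sub).
  have [/andP[x0 _] xc] := Sx.
  have := lip N rho x x0 xr2 rx; have := xc N.
  have : (rho - x) * D <= e.
    by rewrite -ler_pdivlMr//; move: xr; rewrite -/rho; lra.
  lra.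
have nd : nondecreasing_seq (series (fun j => w j * rho ^+ j)).
  apply/nondecreasing_seqP => n; rewrite !seriesEnat/= big_nat_recr//= lerDl.
  by rewrite mulr_ge0// exprn_ge0.
have cv : cvgn (series (fun j => w j * rho ^+ j)).
  apply: nondecreasing_is_cvgn => //; exists c => _ [N _ <-].
  by rewrite seriesEnat/=; exact: rc.
pose l := limn (series (fun j => w j * rho ^+ j)).
have Wl N : W N rho <= l.
  by have := nondecreasing_cvgn_le nd cv N; rewrite seriesEnat.
have lc : l <= c.
  by apply: limr_le => //; apply: nearW => N; rewrite seriesEnat/=; exact: rc.
have {lc} lE : l = c.
  apply/eqP; rewrite eq_le lc/= leNgt; apply/negP => lc2.
  have rx1 : rho < x1.
    rewrite lt_neqAle rx andbT; apply/eqP => E; have [N hN] := x1c.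
    by have := rc N; rewrite E /W leNgt hN.
  pose x := Num.min x1 (rho + (c - l) / D).
  have xr : rho < x by rewrite lt_min rx1 ltrDl divr_gt0// subr_gt0.
  suff : S x by move=> /(ub_le_sup Sub); rewrite -/rho leNgt xr.
  split=> [|N]; first by rewrite (le_trans r0 (ltW xr)) ge_min lexx.
  have xx1 : x <= x1 by rewrite ge_min lexx.
  have := lip N x rho r0 (ltW xr) xx1; have := Wl N.
  have : (x - rho) * D <= c - l.
    by rewrite -ler_pdivlMr// lerBlDl /x ge_min lexx orbT.
  lra.
exists rho; split.
- rewrite lt_neqAle r0 andbT; apply/eqP => E.
  have : l <= w 0%N.
    apply: limr_le => //; apply: nearW => -[|N].
      by rewrite seriesEnat/= big_geq.
    rewrite seriesEnat/= big_nat_recl//= expr0 mulr1 big1 ?addr0// => j _.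
    by rewrite -E expr0n mulr0.
  by rewrite lE; apply/negP; rewrite -ltNge.
- exact: le_lt_trans rx x1t.
- by rewrite -lE; exact: cv.
Qed.

End LevelOfPowerSeries.

(** * Exponential tilting and the radius of convergence of U *)

Section SlowDecay.
Context {R : realType}.
Variables (q : nat -> R) (b : R).
Hypothesis qb : regvar q b.

Lemma regvar_not_geometric (A S : R) : 1 < A ->
  ~ (forall k, (0 < k)%N -> q k * A ^+ k <= S).
Proof.
move=> A1 h; have A0 : 0 < A by exact: lt_trans A1.
pose s := `|b| + 1; have s0 : 0 < s by rewrite ltr_wpDl.
have bs : b < s by have := ler_norm b; rewrite /s; lra.
have [c [n0 [c0 n00 hq]]] := regvar_lower qb bs.
have z01 : 0 < A^-1 < 1 by rewrite invr_gt0 A0 invf_lt1.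
have s10 : 0 < s + 1 by rewrite addr_gt0.
have [C C0 hC] := geometric_le_powR z01 s10.
have [k kP] := exists_natr_ge (`|S| * C / c + 1).
pose j := maxn k n0; have jn : (n0 <= j)%N by exact: leq_maxr.
have j0 : (0 < j)%N by exact: leq_trans jn.
have jr : 0 < (j%:R : R) by rewrite ltr0n.
have js : 0 < (j%:R : R) `^ (- (s + 1)) by rewrite powR_gt0.
have jE : (j%:R : R) `^ (- s) = j%:R * j%:R `^ (- (s + 1)).
  rewrite -{2}[j%:R]powRr1 ?ltW// -powRD; last by rewrite (gt_eqF jr)/= implybT.
  by congr (_ `^ _); ring.
have h1 : q j <= `|S| * A^-1 ^+ j.
  rewrite exprVn ler_pdivlMr ?exprn_gt0//.
  by apply: le_trans (h j j0) _; exact: ler_norm.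
have h2 : c * j%:R <= `|S| * C.
  rewrite -(ler_pM2r js) -!mulrA -jE.
  apply: le_trans (hq j jn) (le_trans h1 _).
  by apply: ler_wpM2l => //; exact: hC.
have : j%:R <= `|S| * C / c by rewrite ler_pdivlMr// mulrC.
have : k%:R <= j%:R :> R by rewrite ler_nat leq_maxl.
lra.
Qed.

(** The binomial coefficient grows like [k ^ l], faster than any [k ^ b] once
    [l] is large. *)
Lemma regvar_not_binomial : exists l : nat,
  forall S : R, ~ (forall k, (0 < k)%N -> q k * 'C(k, l)%:R <= S).
Proof.
have [l0 l0P] := exists_natr_ge (`|b| + 1); pose l := l0.+1; exists l => S h.
have bs : b < (l0%:R : R) by have := ler_norm b; lra.
have [c [n0 [c0 n00 hq]]] := regvar_lower qb bs.
have [k kP] := exists_natr_ge (`|S| * (2 ^+ l * l`!%:R) / c + 1).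
pose j := maxn (maxn k n0) (2 * l).
have jn : (n0 <= j)%N by rewrite /j; nlia.
have jk : (k <= j)%N by rewrite /j; nlia.
have jl : (2 * l <= j)%N by rewrite /j; nlia.
have j0 : (0 < j)%N by exact: leq_trans jn.
have jr : 0 < (j%:R : R) by rewrite ltr0n.
have fl : 0 < 2 ^+ l * (l`!%:R : R) by rewrite mulr_gt0 ?exprn_gt0// ltr0n fact_gt0.
have bin : j%:R ^+ l <= 'C(j, l)%:R * (2 ^+ l * l`!%:R) :> R.
  rewrite mulrCA -natrM bin_ffact -!natrX -natrM ler_nat.
  apply: leq_trans (_ : (2 ^ l * (j - l) ^ l <= _)%N).
    by rewrite -expnMn leq_exp2r//; nlia.
  by rewrite leq_mul2l ffact_ge orbT.
have jE : (j%:R : R) `^ (- l0%:R) * j%:R ^+ l = j%:R.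
  rewrite -powR_mulrn ?ltW// -powRD; last by rewrite (gt_eqF jr)/= implybT.
  by rewrite -[l%:R]natr1 addrA addNr add0r powRr1// ltW.
have h2 : c * j%:R <= `|S| * (2 ^+ l * l`!%:R).
  apply: (@le_trans _ _ (q j * ('C(j, l)%:R * (2 ^+ l * l`!%:R)))).
    rewrite -jE mulrA; apply: ler_pM => //.
    - by rewrite mulr_ge0 ?powR_ge0// ltW.
    - exact: hq.
  rewrite mulrA; apply: ler_wpM2r; first exact: ltW.
  by apply: le_trans (h j j0) _; exact: ler_norm.
have : j%:R <= `|S| * (2 ^+ l * l`!%:R) / c by rewrite ler_pdivlMr// mulrC.
have : k%:R <= j%:R :> R by rewrite ler_nat.
by move=> h3 h4; have := le_trans kP (le_trans h3 h4); rewrite gerDl ler10.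
Qed.

End SlowDecay.

Lemma series_scale {R : realType} (u u' : nat -> R) (c l : R) :
  series u @ \oo --> l -> (forall j, u' j = c * u j) ->
  series u' @ \oo --> c * l.
Proof.
move=> ul E; rewrite (_ : series u' = fun n => c * series u n).
  exact: cvgMl_tmp.
by apply/funext => n; rewrite !seriesEnat/= mulr_sumr; apply: eq_bigr => j _.
Qed.

Lemma eq_eseries_from {R : realType} (f g : nat -> \bar R) m :
  (forall k, (m <= k)%N -> f k = g k) ->
  (\sum_(m <= k <oo) f k = \sum_(m <= k <oo) g k)%E.
Proof.
move=> fg; congr (limn _); apply/funext => N.
by apply: eq_big_nat => k /andP[mk _]; exact: fg.
Qed.

Section Tilting.
Context {R : realType}.
Variables (v w : nat -> R) (rho_v rho b : R).
Hypotheses (rv0 : 0 < rho_v) (r0 : 0 < rho) (w0 : forall j, 0 <= w j).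
Hypothesis hW : series (fun j => w j * rho ^+ j) @ \oo --> rho_v.
Hypothesis hu : forall n, (gibbs_u v w n < +oo)%E.

(** The law of [X], once [rho] is known to be the radius of convergence of
    [U]. *)
Definition tilted_w j : R := w j * rho ^+ j / rho_v.
(** The weights of the number of components after tilting; the arbitrary value
    [v 0] is replaced by [0], so that all weights are nonnegative. *)
Definition tilted_v k : R := (0 < k)%N%:R * (v k * rho_v ^+ k).

Local Notation p := tilted_w.
Local Notation q := tilted_v.

Hypotheses (b1 : 1 < b) (qb : regvar q b).

Lemma tilted_w_ge0 j : 0 <= p j.
Proof. by rewrite divr_ge0 ?mulr_ge0 ?exprn_ge0// ltW. Qed.

Let p0 := tilted_w_ge0.

Lemma tilted_w_sum1 : series p @ \oo --> (1 : R).
Proof.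
rewrite -(mulVf (lt0r_neq0 rv0)); apply: (series_scale hW) => j.
exact: mulrC.
Qed.

Lemma tilted_v_ge0 k : 0 <= q k.
Proof.
case: k => [|k]; first by rewrite /tilted_v mul0r.
exact: ltW (regvar_gt0 qb (ltn0Sn k)).
Qed.

Let q0 := tilted_v_ge0.

Lemma tilted_wE j : w j = rho_v * p j * rho^-1 ^+ j.
Proof.
by rewrite /tilted_w exprVn; field; rewrite !gt_eqF ?exprn_gt0.
Qed.

Lemma tilted_conv k n : (0 < k)%N ->
  q k * conv p k n = v k * conv w k n * rho ^+ n.
Proof.
move=> k0; rewrite (conv_scale _ _ tilted_wE) /tilted_v k0 mul1r exprVn.
by field; rewrite expf_neq0// gt_eqF.
Qed.

Definition tilted_u n : R := fine (gibbs_u v w n) * rho ^+ n.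

Lemma tilted_uE n :
  (\sum_(1 <= k <oo) (q k * conv p k n)%:E = (tilted_u n)%:E)%E.
Proof.
have f0 k : (0 <= (q k * conv p k n)%:E)%E.
  by rewrite lee_fin mulr_ge0 ?conv_ge0.
have uE : gibbs_u v w n =
    ((rho ^- n)%:E * \sum_(1 <= k <oo) (q k * conv p k n)%:E)%E.
  rewrite -nneseriesZl// gibbs_uE; apply: eq_eseries_from => k k0.
  rewrite tilted_conv// -EFinM; congr EFin.
  by rewrite [RHS]mulrC mulfK// gt_eqF// exprn_gt0.
have rn : 0 < rho ^- n by rewrite invr_gt0 exprn_gt0.
set T := (\sum_(1 <= k <oo) _)%E in uE *.
have T0 : (0 <= T)%E by apply: nneseries_ge0 => k _ _; exact: f0.
have Tfin : T \is a fin_num.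
  rewrite ge0_fin_numE// ltey; apply/eqP => TE; have := hu n.
  by rewrite uE TE mulry gtr0_sg// mul1e.
rewrite /tilted_u uE -[in RHS](fineK Tfin) -EFinM/= mulrAC mulVf ?mul1r ?fineK//.
by rewrite gt_eqF// exprn_gt0.
Qed.

Lemma tilted_u_ge n N : \sum_(1 <= k < N) q k * conv p k n <= tilted_u n.
Proof.
rewrite -lee_fin -tilted_uE; apply: eseries_partial_le => k _.
by rewrite mulr_ge0 ?conv_ge0.
Qed.

Lemma tilted_u_ge0 n : 0 <= tilted_u n.
Proof. by have := tilted_u_ge n 0; rewrite big_geq. Qed.

Hypothesis atom : exists j, (0 < j)%N /\ 0 < p j.

Let tilted_u_summable : exists B, forall N, \sum_(0 <= n < N) tilted_u n <= B.
Proof.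
have [B B0 hB] := regvar_summable qb b1; exists B => N.
rewrite -lee_fin -sumEFin.
rewrite (eq_bigr (fun n => (\sum_(1 <= k <oo) (q k * conv p k n)%:E)%E)); last first.
  by move=> n _; rewrite tilted_uE.
rewrite -nneseries_sum_nat; last first.
  by move=> n k; rewrite lee_fin mulr_ge0 ?conv_ge0.
under eq_eseriesr do rewrite sumEFin -mulr_sumr.
apply: eseries_le => [k _|M].
  by rewrite mulr_ge0// sumr_ge0// => n _; rewrite conv_ge0.
apply: le_trans (hB M); apply: ler_sum => k _; rewrite ler_piMr//.
case: N => [|N]; first by rewrite big_geq.
rewrite -(@iexp_le_conv _ p N.+1)//.
apply: le_trans (_ : iexp p N.+1 k (fun=> 1) <= 1).
  by apply: le_iexp => // t; case: leqP.
rewrite iexp_cst mul1r exprn_ile1 ?sumr_ge0//.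
exact: law_le1 p0 tilted_w_sum1 _.
Qed.

Let pgf_exceeds1 (z : R) : 1 < z ->
  exists M, 1 < \sum_(0 <= j < M) p j * z ^+ j.
Proof.
move=> z1; have [j [j0 pj]] := atom.
have e0 : 0 < p j * (z - 1) by rewrite mulr_gt0// subr_gt0.
have [M hM] := series_near tilted_w_sum1 e0.
exists (maxn M j.+1); set M' := maxn _ _.
have jM : (j < M')%N by exact: leq_maxr.
have h : \sum_(0 <= i < M') p i + p j * (z - 1) <=
    \sum_(0 <= i < M') p i * z ^+ i.
  rewrite -lerBrDl -sumrB (eq_bigr (fun i => p i * (z ^+ i - 1))); last first.
    by move=> i _; ring.
  rewrite big_mkord (bigD1 (Ordinal jM))//= ler_wpDr ?sumr_ge0//.
    move=> i _; rewrite mulr_ge0// subr_ge0 exprn_ege1//; exact: ltW.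
  by rewrite ler_pM2l// lerB// ler_eXnr// ltW.
have := hM M' (leq_maxl _ _); lra.
Qed.

(** Beyond [rho] one summand has an exponential moment larger than one, whose
    powers outgrow the subexponential weights [q]. *)
Lemma conv_radius_gibbs : conv_radius (fine \o gibbs_u v w) = rho%:E.
Proof.
have uE x n : fine (gibbs_u v w n) * x ^+ n = tilted_u n * (x / rho) ^+ n.
  rewrite /tilted_u expr_div_n; field; rewrite expf_neq0// gt_eqF//.
apply/eqP; rewrite eq_le; apply/andP; split; last first.
  apply: ereal_sup_ubound; exists rho; last by rewrite ger0_norm// ltW.
  have [B hB] := tilted_u_summable.
  have sE N : pseries (fine \o gibbs_u v w) rho N =
      \sum_(0 <= n < N) tilted_u n.
    rewrite /pseries seriesEnat/=; apply: eq_bigr => n _.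
    by rewrite uE divff ?gt_eqF// expr1n mulr1.
  apply: nondecreasing_is_cvgn.
    by apply/nondecreasing_seqP => n; rewrite !sE big_nat_recr//= lerDl tilted_u_ge0.
  by exists B => _ [N _ <-]; rewrite sE.
apply: ge_ereal_sup => _ [x /= cx <-]; rewrite lee_fin leNgt; apply/negP => rx.
pose y := (rho + `|x|) / 2.
have ry : rho < y by rewrite /y; lra.
have yx : `|y| < `|x| by rewrite (gtr0_norm (lt_trans r0 ry)) /y; lra.
have cy := is_cvg_pseries_inside cx yx.
pose z := y / rho; have z1 : 1 < z by rewrite ltr_pdivlMr// mul1r.
have z0 : 0 < z by exact: lt_trans z1.
have sE N : pseries (fine \o gibbs_u v w) y N =
    \sum_(0 <= n < N) tilted_u n * z ^+ n.
  by rewrite /pseries seriesEnat/=; apply: eq_bigr => n _; rewrite uE.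
have nd : nondecreasing_seq (pseries (fine \o gibbs_u v w) y).
  apply/nondecreasing_seqP => n; rewrite !sE big_nat_recr//= lerDl.
  by rewrite mulr_ge0 ?tilted_u_ge0// exprn_ge0// ltW.
have [M hM] := pgf_exceeds1 z1.
apply: (regvar_not_geometric qb hM) => k k0.
have [N hN] := exp_le_sum_conv M k p0 (ltW z0).
apply: le_trans (nondecreasing_cvgn_le nd cy N); rewrite sE.
apply: le_trans (ler_wpM2l (q0 k) hN) _; rewrite mulr_sumr.
apply: ler_sum => n _; rewrite mulrCA mulrC ler_pM2r ?exprn_gt0//.
have := tilted_u_ge n k.+1; rewrite big_nat_recr//=; apply: le_trans.
by rewrite lerDr sumr_ge0// => i _; rewrite mulr_ge0 ?conv_ge0.
Qed.

Lemma rho_u_tilted : rho_u v w = rho.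
Proof. by rewrite /rho_u conv_radius_gibbs. Qed.

Lemma psum_fin x (s : R) : 0 <= x ->
  series (fun j => w j * x ^+ j) @ \oo --> s -> psum w x%:E = s%:E.
Proof.
move=> x0 h; rewrite -(series_eseries _ h) => [|j]; last first.
  by rewrite mulr_ge0// exprn_ge0.
by apply: eq_eseriesr => j _; rewrite -EFin_expe EFinM.
Qed.

Lemma gibbs_mu_tilted (mu : R) :
  series (fun j => p j * j%:R) @ \oo --> mu -> gibbs_mu v w = mu.
Proof.
move=> h; rewrite /gibbs_mu rho_u_tilted (psum_fin (ltW r0) hW)/=.
have E : (\sum_(1 <= n <oo) (n%:R * w n * rho ^+ n)%:E)%E = (rho_v * mu)%:E.
  have u0 n : 0 <= n%:R * w n * rho ^+ n.
    by rewrite mulr_ge0 ?exprn_ge0 ?(ltW r0)// mulr_ge0.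
  have h1 : series (fun n => n%:R * w n * rho ^+ n) @ \oo --> rho_v * mu.
    apply: (series_scale h) => n; rewrite /tilted_w; field; exact: lt0r_neq0.
  rewrite -(series_eseries u0 h1) [RHS]nneseries_recl ?mul0r ?add0e//.
  by move=> n _; rewrite lee_fin.
by rewrite E/= mulrA mulVf ?mul1r// gt_eqF.
Qed.

Lemma tilted_pmf dO (Omega : measurableType dO) (P : probability Omega R)
  (X : {RV P >-> nat}) : has_gibbs_pgf v w X -> pmf_of X =1 p.
Proof.
move=> hX; apply: pgf_unique.
- exact: pmf_of_ge0.
- exact: p0.
- exact: law_le1 (pmf_of_ge0 X) (sum_pmf_of X).
- exact: law_le1 p0 tilted_w_sum1.
move=> z /andP[z0 z1].
have z01 : 0 <= z <= 1 by rewrite !ltW.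
have := hX z z01; rewrite expectation_pmf_of; last by move=> j; rewrite exprn_ge0// ltW.
rewrite rho_u_tilted (psum_fin (ltW r0) hW)/= => hz.
exists (fine (psum w (rho * z)%:E) / rho_v); split.
  apply: eseries_cvg => [j|].
    by rewrite mulr_ge0 ?pmf_of_ge0// exprn_ge0// ltW.
  by rewrite -hz; apply: eq_eseriesr => j _; rewrite mulrC.
have wz0 j : 0 <= w j * (rho * z) ^+ j.
  by rewrite mulr_ge0 ?exprn_ge0// mulr_ge0// ltW.
have pE : psum w (rho * z)%:E = (\sum_(0 <= j <oo) (w j * (rho * z) ^+ j)%:E)%E.
  by apply: eq_eseriesr => j _; rewrite -EFin_expe EFinM.
have pfin : (psum w (rho * z)%:E < +oo)%E.
  apply: le_lt_trans (ltry rho_v); rewrite pE; apply: eseries_le => // N.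
  apply: le_trans (_ : \sum_(0 <= j < N) w j * rho ^+ j <= _).
    apply: ler_sum => j _; rewrite ler_wpM2l// exprMn ler_piMr ?exprn_ge0//.
    - exact: ltW.
    - by rewrite exprn_ile1// ltW.
  by apply: series_ge0_le hW => j; rewrite mulr_ge0// exprn_ge0// ltW.
rewrite mulrC; apply: (@series_scale _ (fun j => w j * (rho * z) ^+ j)).
  by apply: eseries_cvg => //; rewrite pE in pfin *; exact: eseries_fin.
by move=> j; rewrite /tilted_w exprMn; ring.
Qed.

(** The powers of [rho] and [rho_v] depend on [sumn x = n] and [size x] only. *)
Lemma tilted_gibbs_sizes n dO (Omega : measurableType dO)
  (P : probability Omega R) (K : {RV P >-> seq nat}) :
  is_gibbs_sizes v w n K -> forall x, (0 < size x)%N -> sumn x = n ->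
  P (K @^-1` [set x]) =
  (q (size x) * (\prod_(y <- x) p y) / tilted_u n)%:E.
Proof.
move=> hK x x0 xn; rewrite hK//; congr EFin.
have -> : \prod_(y <- x) w y =
    rho_v ^+ size x * (\prod_(y <- x) p y) * rho^-1 ^+ n.
  rewrite -xn; elim: x {x0 xn} => [|y x IH].
    by rewrite !big_nil !expr0 !mulr1.
  by rewrite !big_cons/= IH {1}tilted_wE exprD exprS; ring.
rewrite /tilted_u /tilted_v x0 mul1r invfM exprVn; ring.
Qed.

Lemma tilted_u_gt0 n : (0 < gibbs_u v w n)%E <-> 0 < tilted_u n.
Proof.
rewrite /tilted_u pmulr_lgt0 ?exprn_gt0//; split=> h.
  by apply: fine_gt0; rewrite h hu.
by case: gibbs_u h => //= ; rewrite ?ltxx.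
Qed.

End Tilting.

(** * The critical and the subcritical case *)

Section Regime.
Context {R : realType}.
Implicit Types (p q : nat -> R).

(** What the limit theorem needs from the law [p] of one component and the
    weights [q] of the number of components. *)
Record regime p q (mu b eta C2 : R) : Prop := Regime {
  regime_ge0 : forall j, 0 <= p j;
  regime_sum1 : series p @ \oo --> (1 : R);
  regime_mean : series (fun j => p j * j%:R) @ \oo --> mu;
  regime_gcd : is_gcd [set n | 0 < p n] 1;
  regime_eta : 0 < eta <= 1;
  regime_moment2 : forall M, (0 < M)%N -> moment2 p M <= C2 * (M%:R : R) `^ (1 - eta);
  regime_b : 1 < b;
  regime_regvar : regvar q b;
  regime_one_jump : one_jump_negligible p q }.

Lemma mean_cvg p (C : R) : (forall j, 0 <= p j) ->
  (forall N, \sum_(0 <= j < N) p j * j%:R <= C) ->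
  exists mu : R, series (fun j => p j * j%:R) @ \oo --> mu.
Proof.
move=> p0 pC; exists (limn (series (fun j => p j * j%:R))).
apply: nondecreasing_is_cvgn.
  apply/nondecreasing_seqP => n; rewrite !seriesEnat/= big_nat_recr//= lerDl.
  by rewrite mulr_ge0.
by exists C => _ [N _ <-]; rewrite seriesEnat/=.
Qed.

Lemma mean_le_moment2 p N : (forall j, 0 <= p j) ->
  \sum_(0 <= j < N) p j * j%:R <= moment2 p N.
Proof.
move=> p0; apply: ler_sum => j _; apply: ler_wpM2l => //.
by rewrite -natrX ler_nat; case: j => // j; rewrite -{1}[j.+1]muln1 leq_mul.
Qed.

Lemma fast_decay_moment2 p : (forall j, 0 <= p j) ->
  (forall s : R, 0 < s -> exists2 C : R, 0 < C &
    forall j, (0 < j)%N -> p j <= C * (j%:R : R) `^ (- s)) ->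
  exists C2 : R, forall M, moment2 p M <= C2.
Proof.
move=> p0 pf; have [C C0 hC] := pf 4 ltac:(by []).
have pj j : (0 < j)%N -> p j * j%:R ^+ 2 <= C * (j%:R : R) `^ (- (1 + 1)).
  move=> j0; have jr : 0 < (j%:R : R) by rewrite ltr0n.
  apply: le_trans (ler_wpM2r (sqr_ge0 _) (hC j j0)) _; rewrite -mulrA.
  rewrite -powR_mulrn ?(ltW jr)// -powRD; last by rewrite (gt_eqF jr)/= implybT.
  by rewrite (_ : - 4 + 2%:R = - (1 + 1))//; ring.
exists (C + C) => -[|[|M]].
- by rewrite /moment2 big_geq// addr_ge0// ltW.
- by rewrite /moment2 big_nat1 expr0n mulr0 addr_ge0// ltW.
rewrite /moment2 big_ltn// expr0n mulr0 add0r big_ltn//.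
apply: lerD.
  by apply: le_trans (pj 1%N isT) _; rewrite powR1 mulr1.
apply: (@le_trans _ _ (C * \sum_(2 <= j < M.+2) (j%:R : R) `^ (- (1 + 1)))).
  rewrite mulr_sumr; apply: ler_sum_nat => j /andP[j2 _].
  by apply: pj; exact: leq_trans j2.
rewrite -[leRHS]mulr1; apply: ler_wpM2l; first exact: ltW.
by have := @sum_powR_tail R 1 1 M.+2 isT ltr01; rewrite invr1 mul1r powR1.
Qed.

Lemma bernoulli (e : R) n : 0 <= e <= 1 -> 1 - n%:R * e <= (1 - e) ^+ n.
Proof.
move=> /andP[e0 e1]; elim: n => [|n IH]; first by rewrite mul0r subr0 expr0.
have h : 0 <= 1 - e by rewrite subr_ge0.
rewrite exprS; apply: le_trans (ler_wpM2l h IH).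
have : 0 <= n%:R * e * e by rewrite !mulr_ge0.
by rewrite -[n.+1%:R]natr1; lra.
Qed.

End Regime.

Section SubcriticalLevel.
Context {R : realType}.
Variables (w : nat -> R) (c : R).
Hypotheses (w0 : forall j, 0 <= w j) (c0 : 0 < c) (wc : w 0%N < c).
Hypothesis wd : exists d, (0 < d)%N /\ 0 < w d.
Hypothesis cr : (c%:E < psum w (conv_radius w))%E.

Let W N (x : R) := \sum_(0 <= j < N) w j * x ^+ j.

Let term_le N j (x : R) : (j < N)%N -> 0 <= x -> w j * x ^+ j <= W N x.
Proof.
move=> jN x0; rewrite /W big_mkord (bigD1 (Ordinal jN))//= lerDl sumr_ge0//.
by move=> i _; rewrite mulr_ge0// exprn_ge0.
Qed.

Let interior_point : exists x1, [/\ 0 <= x1, (x1%:E < conv_radius w)%E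
  & exists N, c < W N x1].
Proof.
have r0 : (0 <= conv_radius w)%E.
  apply: ereal_sup_ubound; exists 0; last by rewrite normr0.
  apply: nondecreasing_is_cvgn.
    apply/nondecreasing_seqP => n; rewrite /pseries !seriesEnat/= big_nat_recr//=.
    by rewrite lerDl mulr_ge0// exprn_ge0.
  exists (w 0%N) => _ [[|N] _ <-]; rewrite /pseries seriesEnat/=.
    by rewrite big_geq.
  by rewrite big_nat_recl//= expr0 mulr1 big1 ?addr0// => j _; rewrite expr0n mulr0.
have [d [d0 pd]] := wd.
move: r0 cr; case: (conv_radius w) => [r| |]//.
- rewrite lee_fin => r0 hr.
  have [N hN] : exists N, c < W N r.
    apply: contrapT => /forallNP h; move: hr; apply/negP; rewrite -leNgt.
    have -> : psum w r%:E = (\sum_(0 <= j <oo) (w j * r ^+ j)%:E)%E.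
      by apply: eq_eseriesr => j _; rewrite -EFin_expe EFinM.
    apply: eseries_le => [j _|N]; first by rewrite mulr_ge0// exprn_ge0.
    by rewrite leNgt; apply/negP; exact: h.
  have {}r0 : 0 < r.
    rewrite lt_neqAle r0 andbT; apply/eqP => E; move: hN; apply/negP.
    rewrite -leNgt -E /W; case: N => [|N]; first by rewrite big_geq// ltW.
    rewrite big_nat_recl//= expr0 mulr1 big1 ?addr0 ?(ltW wc)// => j _.
    by rewrite expr0n mulr0.
  (* by Bernoulli's inequality a partial sum that exceeds [c] at the radius still
     does so at [r * (1 - e)] *)
  have W0 : 0 < W N r by exact: lt_trans hN.
  pose e := (W N r - c) / (W N r * N.+1%:R).
  have e0 : 0 < e by rewrite divr_gt0 ?mulr_gt0 ?ltr0n// subr_gt0.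
  have N1 : 1 <= N.+1%:R :> R by rewrite ler1n.
  have eE : e * (W N r * N.+1%:R) = W N r - c.
    by rewrite /e mulfVK// gt_eqF// mulr_gt0// ltr0n.
  have e1 : e <= 1.
    rewrite /e ler_pdivrMr ?mulr_gt0 ?ltr0n// mul1r.
    apply: le_trans (_ : W N r <= _); first by rewrite gerBl ltW.
    by rewrite ler_pMr.
  exists (r * (1 - e)); split.
  + by rewrite mulr_ge0 ?(ltW r0)// subr_ge0.
  + by rewrite lte_fin gtr_pMr// gtrBl.
  exists N; apply: (@lt_le_trans _ _ ((1 - N%:R * e) * W N r)).
    have : 0 < e * W N r by rewrite mulr_gt0.
    by move: eE; rewrite -[N.+1%:R]natr1; lra.
  rewrite /W mulr_sumr; apply: ler_sum_nat => j /andP[_ jN].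
  rewrite exprMn mulrCA ler_wpM2l// mulrC ler_wpM2l ?exprn_ge0 ?(ltW r0)//.
  apply: le_trans (bernoulli j _); last by rewrite (ltW e0).
  by rewrite lerB// ler_pM2r// ler_nat ltnW.
- move=> _ _; exists (c / w d + 1).
  have x1 : 1 <= c / w d + 1 by rewrite lerDr divr_ge0// ltW.
  have x0 : 0 <= c / w d + 1 by exact: le_trans x1.
  split=> //; first exact: ltry.
  exists d.+1; apply: lt_le_trans (term_le (ltnSn d) x0).
  apply: (@lt_le_trans _ _ (w d * (c / w d + 1))).
    by rewrite mulrDr mulrCA divff ?mulr1 ?ltrDl// gt_eqF.
  by rewrite ler_pM2l// ler_eXnr.
Qed.

Lemma subcritical_level : exists (rho t B : R), [/\ 0 < rho, rho < t,
  series (fun j => w j * rho ^+ j) @ \oo --> c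
  & forall N, \sum_(0 <= j < N) w j * t ^+ j <= B].
Proof.
have [x1 [x10 x1r x1c]] := interior_point.
have [_ [y /= cy <-] x1y] := ereal_sup_gt x1r.
rewrite lte_fin in x1y.
pose t := (x1 + `|y|) / 2.
have x1t : x1 < t by rewrite /t; lra.
have t0 : 0 <= t by exact: le_trans x10 (ltW x1t).
have ct : cvgn (pseries w t).
  by apply: (is_cvg_pseries_inside cy); rewrite ger0_norm// /t; lra.
have tB N : W N t <= limn (pseries w t).
  have nd : nondecreasing_seq (pseries w t).
    apply/nondecreasing_seqP => n; rewrite /pseries !seriesEnat/= big_nat_recr//=.
    by rewrite lerDl mulr_ge0// exprn_ge0.
  by have := nondecreasing_cvgn_le nd ct N; rewrite /pseries seriesEnat.
have [rho [? ? ?]] := power_series_level w0 x10 x1t tB wc x1c.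
by exists rho, t, (limn (pseries w t)).
Qed.

End SubcriticalLevel.

Section TwoCases.
Context {R : realType}.
Variables (v w : nat -> R) (rho_v b : R) (L_v : R -> R).
Hypotheses (w0 : forall i, 0 <= w i) (hu : forall n, (gibbs_u v w n < +oo)%E).
Hypotheses (rv0 : 0 < rho_v) (sv : slowly_varying L_v) (b1 : 1 < b)
  (vE : regularly_decaying v L_v b rho_v).

Lemma regvar_tilted_v : regvar (tilted_v v rho_v) b.
Proof.
have h := regvarM b ltr01 (slowly_varying_regvar sv).
rewrite add0r in h; apply: eq_regvar h => n n0.
rewrite /tilted_v n0 !mul1r vE//; field.
by rewrite gt_eqF// exprn_gt0.
Qed.

Let qb := regvar_tilted_v.

(** Otherwise [u_{dl}] would be infinite for large [l], by the partitions with
    exactly [l] nonempty components, each of size [d]. *)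
Lemma empty_component_weight_lt d : (0 < d)%N -> 0 < w d -> w 0%N < rho_v.
Proof.
move=> d0 wd; rewrite ltNge; apply/negP => rw.
have [l hl] := regvar_not_binomial qb.
pose u := fine (gibbs_u v w (d * l)).
have v0 k : (0 < k)%N -> 0 <= v k.
  move=> k0; have := ltW (regvar_gt0 qb k0).
  by rewrite /tilted_v k0 mul1r pmulr_lge0// exprn_gt0.
have vc0 k : (0 < k)%N -> 0 <= v k * conv w k (d * l).
  by move=> k0; rewrite mulr_ge0 ?v0 ?conv_ge0.
have uE : (\sum_(1 <= k <oo) (v k * conv w k (d * l))%:E = u%:E)%E.
  by rewrite /u gibbs_uE -eseries_fin// -gibbs_uE.
have wl : 0 < w d ^+ l by rewrite exprn_gt0.
apply: (hl (u * w 0%N ^+ l / w d ^+ l)) => k k0.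
rewrite ler_pdivlMr// /tilted_v k0 mul1r.
apply: (@le_trans _ _ (v k * ('C(k, l)%:R * w 0%N ^+ k * w d ^+ l))).
  rewrite -!mulrA; apply: ler_wpM2l; first exact: v0.
  rewrite mulrCA; apply: ler_wpM2l => //; apply: ler_wpM2r; first exact: ltW.
  by apply: lerXn2r; rewrite ?nnegrE// ltW.
apply: le_trans (ler_wpM2l (v0 k k0) (conv_ge_binomial l k w0 d0)) _.
rewrite mulrA; apply: ler_wpM2r; first exact: exprn_ge0.
rewrite -lee_fin -uE; apply: le_trans (eseries_partial_le k.+1 vc0).
rewrite lee_fin big_nat_recr//= lerDr big_nat sumr_ge0// => i /andP[i0 _].
exact: vc0.
Qed.

(** [W] converges beyond [rho], so the law of a component decays geometrically;
    then [eta = 1], as its second moment is finite. *)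
Lemma subcritical_regime : (rho_v%:E < psum w (conv_radius w))%E ->
  is_gcd [set n | 0 < w n] 1 -> exists rho mu C2 : R,
  [/\ 0 < rho, series (fun j => w j * rho ^+ j) @ \oo --> rho_v
    & regime (tilted_w w rho_v rho) (tilted_v v rho_v) mu b 1 C2].
Proof.
move=> hr wg.
have wd : exists d, (0 < d)%N /\ 0 < w d.
  apply: contrapT => /forallNP h; suff : (0 %| 1)%N by [].
  by apply: wg.2 => -[//|n] wn; exfalso; apply: (h n.+1).
have [d [d0 pd]] := wd.
have [rho [t [B [r0 rt hW tB]]]] :=
  subcritical_level w0 rv0 (empty_component_weight_lt d0 pd) wd hr.
have t0 : 0 < t by exact: lt_trans rt.
pose p := tilted_w w rho_v rho.
have p0 : forall j, 0 <= p j by exact: tilted_w_ge0.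
have z01 : 0 < rho / t < 1 by rewrite divr_gt0// ltr_pdivrMr// mul1r.
have pz j : p j <= (`|B| / rho_v) * (rho / t) ^+ j.
  rewrite /p /tilted_w [leRHS]mulrAC ler_pM2r ?invr_gt0//.
  rewrite expr_div_n mulrA ler_pdivlMr ?exprn_gt0// mulrAC.
  apply: ler_wpM2r; first by rewrite exprn_ge0// ltW.
  apply: le_trans (ler_norm B); apply: le_trans (tB j.+1).
  rewrite big_nat_recr//= lerDr sumr_ge0// => i _.
  by rewrite mulr_ge0// exprn_ge0// ltW.
have pf (s : R) : 0 < s -> exists2 C : R, 0 < C &
    forall j, (0 < j)%N -> p j <= C * (j%:R : R) `^ (- s).
  move=> s0; have [C C0 hC] := geometric_le_powR z01 s0.
  exists ((`|B| / rho_v + 1) * C) => [|j j0].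
    by rewrite mulr_gt0// ltr_wpDl// divr_ge0// ltW.
  apply: le_trans (pz j) _; rewrite -[leRHS]mulrA; apply: ler_pM.
  - by rewrite divr_ge0// ltW.
  - by case/andP: z01 => z0 _; rewrite exprn_ge0// ltW.
  - by rewrite lerDl.
  - exact: hC.
have [C2 hC2] := fast_decay_moment2 p0 pf.
have [mu pmu] := mean_cvg p0 (fun N => le_trans (mean_le_moment2 N p0) (hC2 N)).
exists rho, mu, C2; split=> //; split=> //.
- exact: tilted_w_sum1.
- have E : [set n | 0 < p n] = [set n | 0 < w n].
    apply/seteqP; split=> n /=; rewrite /p /tilted_w pmulr_lgt0 ?invr_gt0//;
    by rewrite pmulr_lgt0// exprn_gt0.
  by rewrite E.
- by rewrite ltr01 lexx.
- by move=> M M0; rewrite subrr powRr0 mulr1.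
- exact: (@one_jump_of_fast R p _ b p0 qb b1 pf).
Qed.

Variables (a rho_w : R) (L_w : R -> R).

(** Here [rho = rho_w] and the law of a component is regularly varying with the
    exponent of [w]. *)
Lemma critical_regime : conv_radius w = rho_w%:E -> 0 < rho_w ->
  rho_v%:E = psum w (conv_radius w) ->
  slowly_varying L_w -> 2 < a -> regularly_decaying w L_w a rho_w ->
  b < a \/ b = a /\ L_w n%:R / L_v n%:R @[n --> \oo] --> (0 : R) ->
  exists mu eta C2 : R,
  [/\ series (fun j => w j * rho_w ^+ j) @ \oo --> rho_v,
      regvar (tilted_w w rho_v rho_w) a
    & regime (tilted_w w rho_v rho_w) (tilted_v v rho_v) mu b eta C2].
Proof.
move=> cr rw0 hr sw a2 wE ab; pose p := tilted_w w rho_v rho_w.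
have hW : series (fun j => w j * rho_w ^+ j) @ \oo --> rho_v.
  apply: eseries_cvg => [j|]; first by rewrite mulr_ge0// exprn_ge0// ltW.
  by rewrite hr cr; apply: eq_eseriesr => j _; rewrite -EFin_expe EFinM.
have p0 : forall j, 0 <= p j by exact: tilted_w_ge0.
have pE n : (0 < n)%N -> p n = rho_v^-1 * L_w n%:R * (n%:R : R) `^ (- a).
  move=> n0; rewrite /p /tilted_w wE//; field.
  by rewrite !gt_eqF// exprn_gt0.
have pa : regvar p a.
  have h := regvarM a (_ : 0 < rho_v^-1) (slowly_varying_regvar sw).
  rewrite add0r in h; apply: eq_regvar (h _) => [n n0|]; last by rewrite invr_gt0.
  by rewrite pE.
have [eta [C2 [eta01 hC2]]] := regvar_moment2_power p0 pa a2.
have a11 : 1 + 1 < a by [].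
have [C C0 hC] := regvar_moment_summable pa a11.
have pN N : \sum_(0 <= j < N) p j * j%:R <= C.
  case: N => [|N]; first by rewrite big_geq// ltW.
  rewrite big_ltn// mulr0 add0r; apply: le_trans (hC N.+1).
  by apply: ler_sum_nat => j /andP[j0 _]; rewrite powRr1.
have [mu pmu] := mean_cvg p0 pN.
exists mu, eta, C2; split=> //; split=> //.
- exact: tilted_w_sum1.
- split=> [n _|e he]; first exact: dvd1n.
  by apply: he => /=; exact: regvar_gt0 pa _.
case: ab => [ba|[ba LL]]; first exact: (@one_jump_of_lt R p _ b p0 qb a pa a2 ba).
apply: (@one_jump_of_eq R p _ b p0 qb a pa) => //; first by rewrite (lt_trans _ a2).
  by rewrite ba.
move=> e e0; have er : 0 < e * rho_v by rewrite mulr_gt0.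
have [n0 hn] := cvg0_near LL er; exists n0.+1 => n nn.
have n1 : (0 < n)%N by exact: leq_ltn_trans nn.
have Lv0 : 0 < L_v n%:R by case: sv => h _ _; apply: h; rewrite ltr0n.
have := hn n (ltnW nn); rewrite ler_pdivrMr// => h.
rewrite pE// /tilted_v n1 mul1r vE// ba.
have -> : L_v n%:R * n%:R `^ (- a) * rho_v ^- n * rho_v ^+ n = L_v n%:R * n%:R `^ (- a).
  by field; rewrite gt_eqF// exprn_gt0.
rewrite mulrA; apply: ler_wpM2r; first exact: powR_ge0.
by rewrite mulrC ler_pdivrMr//; move: h; rewrite mulrAC.
Qed.

End TwoCases.

(** * The order of the fluctuations in the three cases *)

Section OrderOfFluctuations.
Context {R : realType}.
Variables (p : nat -> R) (mu : R).
Hypothesis p0 : forall j, 0 <= p j.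
Hypothesis p1 : series p @ \oo --> (1 : R).
Hypothesis pmu : series (fun j => p j * j%:R) @ \oo --> mu.
Hypothesis mu0 : 0 < mu.

Definition unbounded (y : nat -> R) : Prop :=
  forall B : R, exists n0, forall n, (n0 <= n)%N -> B <= y n.

Lemma truncn_ge_half (y : R) : 2 <= y -> y / 2 <= (Num.truncn y)%:R.
Proof.
by move=> y2; have := truncnS_gt y; rewrite -[(Num.truncn y).+1%:R]natr1; lra.
Qed.

Lemma truncn_unbounded (y : nat -> R) (x : R) (N : nat) : unbounded y -> 0 < x ->
  exists n0, forall n, (n0 <= n)%N -> (N <= Num.truncn (x * y n))%N.
Proof.
move=> yoo x0; have [n0 h] := yoo (N%:R / x); exists n0 => n /h.
rewrite ler_pdivrMr// mulrC => hx; rewrite truncn_ge_nat//.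
exact: le_trans hx.
Qed.

Let mean_le M : \sum_(0 <= j < M) p j * j%:R <= mu.
Proof. exact: (law_mean_le p0 pmu M). Qed.

(** The truncation level tends to infinity, so the truncated variance tends to
    [s], and the truncated mean loses only [o (n ^ (- 1 / 2))]. *)
Lemma spread_finite_variance (B s : R) : (forall M, moment2 p M <= B) ->
  series (fun j => p j * (j%:R - mu) ^+ 2) @ \oo --> s -> 0 < s ->
  upward_spread p mu (fun n => Num.sqrt n%:R).
Proof.
move=> pB ps s0.
have yoo : unbounded (fun n => Num.sqrt (n%:R : R)).
  move=> b; have [n0 h] := exists_natr_ge (b ^+ 2); exists n0 => n nn.
  apply: le_trans (ler_norm b) _; rewrite -sqrtr_sqr ler_wsqrtr//.
  by apply: le_trans h _; rewrite ler_nat.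
have [s2 s2P] : exists s2 : R, series (fun j => p j * j%:R ^+ 2) @ \oo --> s2.
  exists (limn (series (fun j => p j * j%:R ^+ 2))).
  apply: nondecreasing_is_cvgn.
    apply/nondecreasing_seqP => n; rewrite !seriesEnat/= big_nat_recr//= lerDl.
    by rewrite mulr_ge0// exprn_ge0.
  by exists B => _ [N _ <-]; rewrite seriesEnat/=; exact: pB.
apply: (@spread_of_variance _ _ _ p0 p1 pmu mu0 _ (s / 2)) => //.
- by rewrite divr_gt0.
- move=> x x0; have s8 : 0 < s / 8 by rewrite divr_gt0.
  pose d := Num.min 1 (s / 8).
  have d0 : 0 < d by rewrite lt_min ltr01.
  have d2 : d ^+ 2 <= s / 8.
    rewrite expr2; apply: le_trans (_ : d * 1 <= _).
      by rewrite ler_pM2l// ge_min lexx.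
    by rewrite mulr1 ge_min lexx orbT.
  have [N1 h1] := series_near ps s8; have [N2 h2] := series_near pmu d0.
  have [n0 h] := truncn_unbounded (maxn N1 N2) yoo x0.
  exists n0 => n /h; rewrite geq_max => /andP[/h1 + /h2 +] /=.
  set M := Num.truncn _; rewrite sqr_sqrtr// => {}h1 {}h2.
  rewrite mulrC; apply: ler_wpM2l => //.
  have e1 : \sum_(0 <= j < M) p j * (j%:R - mu) ^+ 2 =
      moment2 p M - 2 * mu * (\sum_(0 <= j < M) p j * j%:R) +
      mu ^+ 2 * \sum_(0 <= j < M) p j.
    rewrite /moment2 !mulr_sumr -sumrB -big_split/=.
    by apply: eq_bigr => j _; ring.
  have e2 : mu ^+ 2 * \sum_(0 <= j < M) p j <= mu ^+ 2.
    by rewrite ler_piMr ?sqr_ge0//; exact: law_le1 p0 p1 M.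
  have e3 := mean_le M.
  set m := \sum_(0 <= j < M) p j * j%:R in h2 e1 e3 *.
  have e4 : (mu - m) ^+ 2 <= d ^+ 2.
    by apply: lerXn2r; rewrite ?nnegrE; lra.
  have e5 : (mu - m) ^+ 2 = mu ^+ 2 - 2 * mu * m + m ^+ 2 by ring.
  lra.
- move=> x x0; pose e := x * mu / 2.
  have e0 : 0 < e by rewrite divr_gt0// mulr_gt0.
  have [N1 h1] := series_near s2P e0.
  have [n0 h] := truncn_unbounded N1 yoo x0.
  have [n1 hn1] := yoo (2 / x).
  exists (maxn n0 n1) => n; rewrite geq_max => /andP[/h + /hn1 +] /=.
  set y := Num.sqrt _; set M := Num.truncn _ => MN yx.
  have y2 : 2 <= x * y by rewrite mulrC -ler_pdivrMr.
  have y0 : 0 < y by apply: lt_le_trans yx; rewrite divr_gt0.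
  have My : x * y / 2 <= M%:R by exact: truncn_ge_half.
  have M0 : 0 < (M%:R : R) by apply: lt_le_trans My; rewrite divr_gt0// mulr_gt0.
  set m := \sum_(0 <= j < M) p j * j%:R.
  have h3 : mu - m <= e / M%:R.
    apply: (series_tail_le pmu) => N; rewrite ler_pdivlMr//.
    have [NM|MN'] := leqP N M; first by rewrite big_geq// mul0r ltW.
    apply: (@le_trans _ _ (\sum_(M <= j < N) p j * j%:R ^+ 2)).
      rewrite mulr_suml; apply: ler_sum_nat => j /andP[Mj _].
      rewrite expr2 mulrA ler_wpM2l ?mulr_ge0// ler_nat//.
    have := h1 M MN; have := series_ge0_le N (fun j => _) s2P.
    move=> /(_ ltac:(by move=> j; rewrite mulr_ge0// exprn_ge0)).
    rewrite (@big_cat_nat _ _ _ M)//=; last exact: ltnW.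
    lra.
  have h4 : x * y / 2 * (mu - m) <= e.
    rewrite ler_pdivlMr// in h3; apply: le_trans h3; rewrite mulrC.
    by apply: ler_wpM2l => //; rewrite subr_ge0; exact: mean_le.
  have h5 : y * (mu - m) <= mu.
    rewrite -(ler_pM2l x0) -(ler_pM2l (_ : 0 < 2^-1)) ?invr_gt0//.
    by apply: le_trans (le_trans h4 _); apply: eq_ler; rewrite /e; ring.
  rewrite -[n%:R]sqr_sqrtr// expr2 -mulrA [leRHS]mulrC; exact: ler_wpM2l.
Qed.

(** The truncated second moment is slowly varying, hence it does not see the
    factor [x] in the truncation level, and it dominates the squared mean. *)
Lemma spread_borderline (y : nat -> R) : regvar p 3 ->
  (forall B, exists M, B < moment2 p M) -> unbounded y ->
  (exists n0, forall n, (n0 <= n)%N ->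
     n%:R * moment2 p (Num.truncn (y n)).+1 = y n ^+ 2) ->
  upward_spread p mu y.
Proof.
move=> pa pun yoo [n0 yE].
have big x (x0 : 0 < x) : exists n1, forall n, (n1 <= n)%N ->
    let t := Num.truncn (y n) in let M := Num.truncn (x * y n) in
    [/\ 0 < y n, (x / 2) * t%:R <= M%:R, M%:R <= (2 * x) * t%:R & y n / 2 <= t%:R].
  have [n1 h1] := yoo 2; have [n2 h2] := yoo (2 / x).
  exists (maxn n1 n2) => n; rewrite geq_max => /andP[/h1 y2 /h2 yx] t M.
  have xy : 2 <= x * y n by rewrite mulrC -ler_pdivrMr.
  have y0 : 0 < y n by exact: lt_le_trans y2.
  have ty : t%:R <= y n by rewrite truncn_le ltW.
  have ty2 := truncn_ge_half y2; have My2 := truncn_ge_half xy.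
  split=> //; rewrite -/t -/M in ty2 My2.
    by apply: le_trans My2; rewrite mulrAC ler_wpM2r// ler_wpM2l// ltW.
  apply: le_trans (_ : x * y n <= _).
    by rewrite truncn_le mulr_ge0// ltW.
  by rewrite [2 * x]mulrC -mulrA ler_pM2l//; lra.
apply: (@spread_of_variance _ _ _ p0 p1 pmu mu0 _ 4^-1) => //.
- move=> x x0; have x2 : 0 < x / 2 by rewrite divr_gt0.
  have [t0 ht] := regvar3_moment2_slow p0 pa erefl x2.
  have [n1 h1] := big x x0.
  have [n2 h2] := truncn_unbounded t0 yoo ltr01.
  have [M0 hM0] := pun (2 * mu ^+ 2).
  have [n3 h3] := truncn_unbounded M0 yoo x0.
  exists (maxn (maxn n0 n1) (maxn n2 n3)) => n; rewrite !geq_max.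
  move=> /andP[/andP[/yE nn0 /h1[y0 tM _ _]] /andP[/h2 nn2 /h3 nn3]].
  rewrite mul1r in nn2; set M := Num.truncn (x * y n) in tM nn3 *.
  have := ht _ _ nn2 tM => hh.
  have MM : moment2 p M0 <= moment2 p M.
    rewrite /moment2 [leRHS](@big_cat_nat _ _ _ M0)//= lerDl sumr_ge0// => j _.
    by rewrite mulr_ge0// exprn_ge0.
  have mm : (\sum_(0 <= j < M) p j * j%:R) ^+ 2 <= mu ^+ 2.
    by apply: lerXn2r (mean_le M); rewrite nnegrE ?(ltW mu0)// sumr_ge0// => j _; rewrite mulr_ge0.
  rewrite -nn0 mulrCA; apply: ler_wpM2l => //.
  move: hh MM mm hM0; lra.
- move=> x x0; have x2 : 0 < x / 2 by rewrite divr_gt0.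
  have x3 : 0 < 2 * x by rewrite mulr_gt0.
  have m2 : 0 < mu / 2 by rewrite divr_gt0.
  have [t0 ht] := regvar3_mean_tail p0 pmu pa erefl x2 x3 m2.
  have [n1 h1] := big x x0.
  have [n2 h2] := truncn_unbounded t0 yoo ltr01.
  exists (maxn (maxn n0 n1) n2) => n; rewrite !geq_max.
  move=> /andP[/andP[/yE nn0 /h1[y0 tM Mt yt]] /h2 nn2].
  rewrite mul1r in nn2; have := ht _ _ nn2 tM Mt => hh.
  set m := \sum_(_ <= j < _) _ in hh *.
  have mm : 0 <= mu - m by rewrite subr_ge0; exact: mean_le.
  have h3 : y n / 2 * (mu - m) <= mu / 2 * moment2 p (Num.truncn (y n)).+1.
    by apply: le_trans hh; apply: ler_wpM2r.
  have h4 := ler_wpM2l (ler0n R n) h3.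
  rewrite [leRHS]mulrCA nn0 in h4.
  rewrite -(ler_pM2l (_ : 0 < y n / 2)) ?divr_gt0//.
  by apply: le_trans (le_trans _ h4) _; apply: eq_ler; ring.
Qed.

(** By regular variation [n P (X > D y)] stays bounded away from [0] for every
    [D], while the summands below [y] have variance [O (y ^ 2 / n)]. *)
Lemma spread_heavy_tail (a : R) (y : nat -> R) : regvar p a -> 2 < a < 3 ->
  unbounded y ->
  (exists n0, forall n, (n0 <= n)%N ->
     n%:R * ptail p (Num.truncn (y n)).+1 <= 1 /\
     forall x, 0 <= x -> x < y n -> 1 < n%:R * ptail p (Num.truncn x).+1) ->
  upward_spread p mu y.
Proof.
move=> pa /andP[a2 a3] yoo [n0 hy].
have a1 : 1 < a by lra.
have a0 : 0 < a by lra.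
have a13 : 1 < a < 3 by rewrite a1.
have [C1 [t1 [C10 t10 H1]]] := regvar_ptail_ge p0 p1 pa a0.
have [C2 [t2 [C20 t20 H2]]] := regvar_ptail_le p1 pa a1.
have [C3 [t3 [C30 t30 H3]]] := regvar_head_sum pa a13.
have [C4 [t4 [C40 t40 H4]]] := regvar_mean_tail_le pmu pa a2.
pose K := C1 * C3 + C1 * C4.
have K0 : 0 < K by rewrite addr_gt0// mulr_gt0.
have C130 : 0 < C1 * C3 by rewrite mulr_gt0.
have C140 : 0 < C1 * C4 by rewrite mulr_gt0.
apply: (@spread_of_big_jump _ _ _ p0 p1 pmu mu0 _ K) => //.
- move=> D D1; have D0 : 0 < D by exact: lt_le_trans D1.
  have x0 : 0 < (4 * D)^-1 by rewrite invr_gt0 mulr_gt0.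
  have [C [t5 [C0 t50 H5]]] := regvar_linear pa a0 x0.
  have h20 : (0 : R) < 2^-1 by rewrite invr_gt0.
  have [n1 h1] := truncn_unbounded (maxn (maxn t1 t2) t5) yoo h20.
  have [n2 h2] := yoo 4.
  exists (C2 * C * C1)^-1, (maxn (maxn n0 n1) n2).
  split=> [|n]; first by rewrite invr_gt0 !mulr_gt0.
  rewrite !geq_max => /andP[/andP[/hy[_ hx] /h1 nn1] /h2 y4].
  have y0 : 0 < y n by exact: lt_le_trans y4.
  have := hx (2^-1 * y n) ltac:(by rewrite mulr_ge0 ?(ltW h20)// ltW) ltac:(lra).
  set h := Num.truncn (2^-1 * y n) in nn1 *; set k := Num.truncn (D * y n).
  move: nn1; rewrite !geq_max => /andP[/andP[ht1 ht2] ht5] hn.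
  have hk : (h <= k)%N.
    by rewrite /h /k le_truncn// ler_wpM2r ?(ltW y0)//; lra.
  have hk2 : (4 * D)^-1 * k%:R <= h%:R.
    apply: le_trans (_ : (4 * D)^-1 * (D * y n) <= _).
      by rewrite ler_pM2l//; rewrite truncn_le mulr_ge0 ?(ltW D0)// ltW.
    apply: le_trans (@truncn_ge_half (2^-1 * y n) _); last lra.
    by apply: eq_ler; field; rewrite gt_eqF.
  have p5 := H5 k h (leq_trans ht5 hk) hk2.
  have p2 := H2 h ht2; have p1' := H1 k (leq_trans ht1 hk).
  have pS : ptail p h.+1 <= ptail p h by exact: (ptail_nonincr p0).
  have kp : h%:R * p h <= C * (k%:R * p k).
    rewrite mulrCA; apply: ler_pM => //; by rewrite ler_nat.
  rewrite -[leLHS]mul1r ler_pdivrMr ?mulr_gt0//; apply: ltW.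
  apply: (lt_le_trans hn); rewrite -[leRHS]mulrA; apply: ler_wpM2l => //.
  apply: le_trans pS (le_trans p2 _); rewrite [leRHS]mulrC -!mulrA ler_pM2l//.
  by apply: le_trans kp _; rewrite ler_pM2l.
- have [n1 h1] := truncn_unbounded (maxn (maxn t1 t3) t4) yoo ltr01.
  have [n2 h2] := yoo 1.
  exists (maxn (maxn n0 n1) n2) => n.
  rewrite !geq_max => /andP[/andP[/hy[hp _] /h1 nn1] /h2 y1].
  rewrite mul1r in nn1; set t := Num.truncn (y n) in hp nn1 *.
  move: nn1; rewrite !geq_max => /andP[/andP[ht1 ht3] ht4].
  have y0 : 0 < y n by exact: lt_le_trans y1.
  have ty : t%:R <= y n by rewrite truncn_le ltW.
  have tp : n%:R * (t%:R * p t) <= C1.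
    apply: le_trans (ler_wpM2l (ler0n R n) (H1 t ht1)) _.
    by rewrite mulrCA -[leRHS]mulr1 ler_pM2l.
  have t2y : (t%:R : R) ^+ 2 <= y n ^+ 2.
    by apply: lerXn2r; rewrite ?nnegrE// ltW.
  split.
    apply: le_trans (ler_wpM2l (ler0n R n) (H3 t ht3)) _.
    have -> : n%:R * (C3 * (t%:R ^+ 3 * p t)) =
      C3 * t%:R ^+ 2 * (n%:R * (t%:R * p t)) by ring.
    apply: le_trans (_ : C3 * t%:R ^+ 2 * C1 <= _).
      by apply: ler_wpM2l => //; rewrite mulr_ge0 ?exprn_ge0// ltW.
    rewrite mulrAC [C3 * C1]mulrC; apply: ler_pM => //.
    - exact: ltW.
    - by rewrite /K lerDl ltW.
  apply: le_trans (_ : n%:R * (mu - \sum_(0 <= j < t) p j * j%:R) <= _).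
    apply: ler_wpM2l => //; rewrite lerB// big_nat_recr//= lerDl.
    by rewrite mulr_ge0.
  apply: le_trans (ler_wpM2l (ler0n R n) (H4 t ht4)) _.
  have -> : n%:R * (C4 * (t%:R ^+ 2 * p t)) =
    C4 * t%:R * (n%:R * (t%:R * p t)) by ring.
  apply: le_trans (_ : C4 * t%:R * C1 <= _).
    by apply: ler_wpM2l => //; rewrite mulr_ge0// ltW.
  rewrite mulrAC [C4 * C1]mulrC; apply: ler_pM => //.
  - exact: ltW.
  - by rewrite /K lerDr ltW.
Qed.

End OrderOfFluctuations.

(** * Thresholds and moments of the component law *)

Section Thresholds.
Context {R : realType}.
Variables (p : nat -> R) (mu : R).
Hypothesis p0 : forall j, 0 <= p j.
Hypothesis p1 : series p @ \oo --> (1 : R).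
Hypothesis pmu : series (fun j => p j * j%:R) @ \oo --> mu.

Definition moment2_upto (x : R) : R := moment2 p (Num.truncn x).+1.

Lemma moment2_upto_ge0 x : 0 <= moment2_upto x.
Proof. exact: moment2_ge0. Qed.

Lemma moment2_upto_nondecreasing x y : x <= y -> moment2_upto x <= moment2_upto y.
Proof. by move=> xy; apply: (moment2_le p0); rewrite ltnS le_truncn. Qed.

Lemma moment2_upto_le x : 0 <= x -> moment2_upto x <= x * mu.
Proof.
move=> x0; apply: (@le_trans _ _ (x * \sum_(0 <= j < (Num.truncn x).+1) p j * j%:R)).
  rewrite mulr_sumr; apply: ler_sum_nat => j /andP[_ jx].
  rewrite expr2 mulrA mulrC ler_wpM2r ?mulr_ge0//.
  by apply: le_trans (_ : (Num.truncn x)%:R <= _); rewrite ?ler_nat ?truncn_le.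
by apply: ler_wpM2l => //; exact: law_mean_le p0 pmu _.
Qed.

Definition variance_threshold (n : nat) : R :=
  sup [set x | 0 <= x /\ n%:R^-1 <= moment2_upto x / x ^+ 2].

(** Right continuity of the truncated second moment gives one inequality at the
    supremum, monotonicity the other. *)
Lemma variance_thresholdE n (x0 : R) : (0 < n)%N -> 0 < x0 ->
  x0 ^+ 2 <= n%:R * moment2_upto x0 ->
  x0 <= variance_threshold n /\
  n%:R * moment2_upto (variance_threshold n) = variance_threshold n ^+ 2.
Proof.
move=> n0 x00 hx0; have nr : 0 < (n%:R : R) by rewrite ltr0n.
rewrite /variance_threshold; set S := [set x | _]; set b := sup S.
have SE x : 0 < x -> S x <-> x ^+ 2 <= n%:R * moment2_upto x.
  move=> xx; rewrite /S/= ler_pdivlMr ?exprn_gt0// mulrC ler_pdivrMr// mulrC.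
  by split=> [[]//|h]; split=> //; exact: ltW.
have S0 : S x0 by apply/SE.
have Sub : has_ubound S.
  exists (n%:R * mu) => x Sx; have [xx|xx] := ltP 0 x; last first.
    apply: le_trans xx _; rewrite mulr_ge0//.
    by apply: le_trans (law_mean_le p0 pmu 0); rewrite big_geq.
  have /(SE _ xx) := Sx; rewrite expr2 => h.
  rewrite -(ler_pM2l xx); apply: le_trans h _; rewrite mulrCA.
  by apply: ler_wpM2l => //; exact: moment2_upto_le (ltW xx).
have Ssup : has_sup S by split; [exists x0|].
have xb : x0 <= b by exact: (ub_le_sup Sub).
have b0 : 0 < b by exact: lt_le_trans xb.
split=> //; have T0 : 0 <= n%:R * moment2_upto b by rewrite mulr_ge0// moment2_upto_ge0.
suff bE : b = Num.sqrt (n%:R * moment2_upto b) by rewrite [in RHS]bE sqr_sqrtr.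
apply/eqP; rewrite eq_le; apply/andP; split; apply: ler_eps => e e0.
  have [x Sx xb'] := sup_adherent e0 Ssup; rewrite -/b in xb'.
  suff : x <= Num.sqrt (n%:R * moment2_upto b) by lra.
  have [xx|xx] := ltP 0 x; last exact: le_trans xx (sqrtr_ge0 _).
  rewrite -(ger0_norm (ltW xx)) -sqrtr_sqr ler_wsqrtr//.
  have /(SE _ xx) h := Sx; apply: le_trans h _; rewrite ler_wpM2l//.
  by apply: moment2_upto_nondecreasing; exact: (ub_le_sup Sub).
have be : 0 < b + e by rewrite addr_gt0.
rewrite -(ger0_norm (ltW be)) -sqrtr_sqr ler_wsqrtr//.
apply: le_trans (_ : n%:R * moment2_upto (b + e) <= _).
  by rewrite ler_wpM2l// moment2_upto_nondecreasing// lerDl ltW.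
rewrite leNgt; apply/negP => h.
have : S (b + e) by apply/(SE _ be); exact: ltW.
by move=> /(ub_le_sup Sub); rewrite -/b; lra.
Qed.

Definition tail_threshold (n : nat) : R :=
  inf [set x | 0 <= x /\ ptail p (Num.truncn x).+1 <= n%:R^-1].

(** The tail is right continuous, being constant between integers, so the
    infimum is attained. *)
Lemma tail_thresholdP n : (0 < n)%N ->
  [/\ 0 <= tail_threshold n,
      n%:R * ptail p (Num.truncn (tail_threshold n)).+1 <= 1
    & forall x, 0 <= x -> x < tail_threshold n ->
        1 < n%:R * ptail p (Num.truncn x).+1].
Proof.
move=> n0; have nr : 0 < (n%:R : R) by rewrite ltr0n.
rewrite /tail_threshold; set S := [set x | _]; set y := inf S.
have i0 : 0 < (n%:R^-1 : R) by rewrite invr_gt0.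
have [N hN] := series_near p1 i0.
have SN : S N%:R.
  split=> //; rewrite natrK /ptail.
  by have := hN N.+1 (leqnSn N); lra.
have Slb : lbound S 0 by move=> x [].
have Sinf : has_inf S by split; [exists N%:R|exists 0].
have y0 : 0 <= y by apply: lb_le_inf => //; exists N%:R.
split=> //.
  have e0 : 0 < (Num.truncn y).+1%:R - y by rewrite subr_gt0 truncnS_gt.
  have [x Sx xy] := inf_adherent e0 Sinf; rewrite -/y addrC subrK in xy.
  have yx : y <= x by apply: ge_inf => //; exact: Sinf.2.
  have <- : Num.truncn x = Num.truncn y.
    have h : (Num.truncn x < (Num.truncn y).+1)%N.
      by rewrite truncn_lt_nat//; exact: le_trans yx.
    by apply/eqP; rewrite eqn_leq -ltnS h le_truncn.
  by case: Sx => _ h; rewrite mulrC -ler_pdivlMr// mul1r.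
move=> x x0 xy; rewrite ltNge; apply/negP => h.
have : S x by split=> //; rewrite -[leRHS]mul1r ler_pdivlMr// mulrC.
by move=> /(ge_inf Sinf.2); rewrite -/y leNgt xy.
Qed.

Lemma tail_threshold_unbounded : (forall j, (0 < j)%N -> 0 < p j) ->
  unbounded tail_threshold.
Proof.
move=> pj B; pose t := (Num.truncn B).+1.
have pt : 0 < ptail p t.
  rewrite /ptail subr_gt0; have := law_le1 p0 p1 t.+1; rewrite big_nat_recr//=.
  by have := pj t isT; lra.
have [n0 h] := exists_natr_ge (ptail p t)^-1.
exists n0.+1 => n nn; have n1 : (0 < n)%N by exact: leq_trans nn.
have nr : 0 < (n%:R : R) by rewrite ltr0n.
have [y0 yt _] := tail_thresholdP n1.
rewrite leNgt; apply/negP => yB; move: yt; apply/negP; rewrite -ltNge.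
have h1 : 1 < n%:R * ptail p t.
  rewrite -ltr_pdivrMr// mul1r; apply: le_lt_trans h _; rewrite ltr_nat.
  exact: nn.
apply: lt_le_trans h1 _; rewrite ler_wpM2l//; apply: (ptail_nonincr p0).
by rewrite /t ltnS le_truncn// ltW.
Qed.

End Thresholds.

Section MomentsOfLaw.
Context {R : realType} dO (Omega : measurableType dO) (P : probability Omega R).
Variables (X : {RV P >-> nat}) (p : nat -> R) (mu : R).
Hypothesis Xp : pmf_of X =1 p.
Hypothesis pmu : series (fun j => p j * j%:R) @ \oo --> mu.

Let p0 j : 0 <= p j. Proof. by rewrite -Xp pmf_of_ge0. Qed.

Let p1 : series p @ \oo --> (1 : R).
Proof. by rewrite -(funext Xp); exact: sum_pmf_of. Qed.

Let expE (f : nat -> R) : (forall j, 0 <= f j) ->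
  ('E_P[fun o => f (X o)] = \sum_(0 <= j <oo) (f j * p j)%:E)%E.
Proof.
by move=> f0; rewrite expectation_pmf_of//; apply: eq_eseriesr => j _; rewrite Xp.
Qed.

Lemma moment2_bounded_of_moment k : (1 < k)%N -> (moment X k < +oo)%E ->
  exists B, forall M, moment2 p M <= B.
Proof.
move=> k1; rewrite /moment (expE (f := fun j => j%:R ^+ k)); last first.
  by move=> j; rewrite exprn_ge0.
move=> h; have jp0 j : 0 <= (j%:R : R) ^+ k * p j by rewrite mulr_ge0// exprn_ge0.
have E := eseries_fin (fun j _ => jp0 j) h.
set s := fine _ in E; exists s => M; rewrite -lee_fin -E.
apply: le_trans (eseries_partial_le M (fun j _ => jp0 j)); rewrite lee_fin.
apply: ler_sum => j _; rewrite mulrC; apply: ler_wpM2r => //.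
case: j => [|j]; first by rewrite expr0n exprn_ge0.
by rewrite ler_weXn2l// ler1n.
Qed.

Let mean_X : ('E_P[fun o => ((X o)%:R : R)%R] = mu%:E)%E.
Proof.
rewrite (expE (f := fun j => j%:R))//; apply: series_eseries.
  by move=> j; rewrite mulr_ge0.
by rewrite (_ : (fun j => _) = (fun j => p j * j%:R))//; apply/funext => j; rewrite mulrC.
Qed.

Lemma varE : var X = (\sum_(0 <= j <oo) (p j * (j%:R - mu) ^+ 2)%:E)%E.
Proof.
rewrite /var /variance unlock mean_X/=.
have := expE (f := fun j => (j%:R - mu) ^+ 2) (fun j => sqr_ge0 _).
rewrite (_ : (fun o => _) = (((fun o => (X o)%:R) \- cst mu) \*
  ((fun o => (X o)%:R) \- cst mu))%R); last first.
  by apply/funext => o; rewrite /= expr2.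
by move=> ->; apply: eq_eseriesr => j _; rewrite mulrC.
Qed.

Let mu_ge0 : 0 <= mu.
Proof. by apply: le_trans (law_mean_le p0 pmu 0); rewrite big_geq. Qed.

(** [j^2 <= 2 (j - mu)^2 + 2 mu^2] and [(j - mu)^2 <= j^2 + mu^2]. *)
Lemma var_finP : (var X < +oo)%E <-> exists B, forall M, moment2 p M <= B.
Proof.
have t0 j : 0 <= p j * (j%:R - mu) ^+ 2 by rewrite mulr_ge0// sqr_ge0.
rewrite varE; split=> [h|[B hB]].
  have E := eseries_fin (fun j _ => t0 j) h; set s := fine _ in E.
  exists (2 * s + 2 * mu ^+ 2) => M.
  apply: (@le_trans _ _ (\sum_(0 <= j < M)
     (2 * (p j * (j%:R - mu) ^+ 2) + 2 * mu ^+ 2 * p j))).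
    apply: ler_sum => j _; rewrite -subr_ge0.
    have := mulr_ge0 (p0 j) (sqr_ge0 (j%:R - 2 * mu)).
    by move=> z; apply: le_trans z _; apply: eq_ler; ring.
  rewrite big_split/= -!mulr_sumr; apply: lerD.
    rewrite ler_pM2l// -lee_fin -E; exact: (eseries_partial_le M (fun j _ => t0 j)).
  rewrite ler_piMr ?mulr_ge0 ?sqr_ge0//; exact: law_le1 p0 p1 M.
apply: le_lt_trans (ltry (B + mu ^+ 2)); apply: eseries_le => // N.
apply: (@le_trans _ _ (\sum_(0 <= j < N) (p j * j%:R ^+ 2 + mu ^+ 2 * p j))).
  apply: ler_sum => j _; rewrite -subr_ge0.
  have : 0 <= 2 * (p j * j%:R * mu) by rewrite !mulr_ge0.
  by move=> h; apply: le_trans h _; apply: eq_ler; ring.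
rewrite big_split/= -mulr_sumr; apply: lerD (hB N) _.
rewrite ler_piMr ?sqr_ge0//; exact: law_le1 p0 p1 N.
Qed.

Lemma trunc_moment2E x : 0 <= x -> trunc_moment2 X x = moment2_upto p x.
Proof.
move=> x0; rewrite /trunc_moment2.
rewrite (_ : (fun o => _) = (fun o => (fun j => j%:R ^+ 2 * (j%:R <= x)%R%:R) (X o))); last first.
  by apply/funext => o; rewrite indicE; congr (_ * (nat_of_bool _)%:R);
     apply/idP/idP; rewrite inE.
rewrite (expE (f := fun j => j%:R ^+ 2 * (j%:R <= x)%R%:R)); last first.
  by move=> j; rewrite mulr_ge0// exprn_ge0.
set t := Num.truncn x.
have jx j : ((j%:R : R) <= x) = (j < t.+1)%N by rewrite ltnS truncn_ge_nat.
suff -> : (\sum_(0 <= j <oo) (j%:R ^+ 2 * (j%:R <= x)%R%:R * p j)%:E =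
    (moment2_upto p x)%:E)%E by [].
have sE : moment2_upto p x =
    \sum_(0 <= j < t.+1) j%:R ^+ 2 * (j%:R <= x)%R%:R * p j.
  apply: eq_big_nat => j /andP[_ jt]; rewrite jx jt mulr1; exact: mulrC.
have f0 j : 0 <= j%:R ^+ 2 * (j%:R <= x)%R%:R * p j.
  by rewrite !mulr_ge0// exprn_ge0.
apply/eqP; rewrite eq_le; apply/andP; split; last first.
  by rewrite sE; exact: (eseries_partial_le t.+1 (fun j _ => f0 j)).
apply: eseries_le => // N; rewrite sE.
apply: (@le_trans _ _ (\sum_(0 <= j < maxn N t.+1)
    j%:R ^+ 2 * (j%:R <= x)%R%:R * p j)).
  by rewrite [leRHS](@big_cat_nat _ _ _ N)//= ?leq_maxl// lerDl sumr_ge0.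
rewrite (@big_cat_nat _ _ _ t.+1)//= ?leq_maxr// gerDl big_nat big1// => j /andP[tj _].
by rewrite jx ltnNge tj mulr0 mul0r.
Qed.

Lemma probability_gt (x : R) : 0 <= x ->
  P [set o | (x < (X o)%:R)%R] = (ptail p (Num.truncn x).+1)%:E.
Proof.
move=> x0; set t := Num.truncn x.
have -> : [set o | (x < (X o)%:R)%R] = X @^-1` [set j | (t < j)%N].
  by apply/seteqP; split=> o /=; rewrite ltNge -truncn_ge_nat// -ltnNge.
rewrite -expectation_indic; last exact: measurable_RV_pre.
rewrite (_ : \1__ = (fun o => (fun j => (t < j)%N%:R) (X o))); last first.
  by apply/funext => o; rewrite indicE; congr (nat_of_bool _)%:R;
     apply/idP/idP; rewrite inE.
rewrite (expE (f := fun j => (t < j)%N%:R))//; apply: series_eseries.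
  by move=> j; rewrite mulr_ge0.
have : series p n - \sum_(0 <= j < t.+1) p j @[n --> \oo] --> ptail p t.+1.
  by apply: cvgB => //; exact: cvg_cst.
apply: cvg_trans; apply: near_eq_cvg; exists t.+1 => // N /= tN.
have E : series (fun j => (t < j)%N%:R * p j) N =
    series p N - \sum_(0 <= j < t.+1) p j.
  rewrite !seriesEnat/= (@big_cat_nat _ _ _ t.+1)//=.
  rewrite [X in _ = X - _](@big_cat_nat _ _ _ t.+1)//= addrAC subrr add0r.
  rewrite big_nat big1 ?add0r => [|j /andP[_ jt]]; last first.
    by rewrite ltnNge -ltnS jt mul0r.
  by apply: eq_big_nat => j /andP[tj _]; rewrite tj mul1r.
by rewrite E.
Qed.

End MomentsOfLaw.

(** * The deviation scale, and admissible gaps *)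

Section ScaleOfFluctuations.
Context {R : realType} dO (Omega : measurableType dO) (P : probability Omega R).
Variables (X : {RV P >-> nat}) (p q : nat -> R) (mu b eta C2 alpha : R).
Hypothesis Xp : pmf_of X =1 p.
Hypothesis pq : regime p q mu b eta C2.
Hypothesis cases :
  (exists a, [/\ regvar p a, 2 < a & alpha = Num.min (a - 1) 2]) \/
  (exists B, forall M, moment2 p M <= B) /\ alpha = 2.

Let p0 := regime_ge0 pq.
Let p1 := regime_sum1 pq.
Let pmu := regime_mean pq.
Let mu0 : 0 < mu. Proof. exact: law_mean_gt0 p0 pmu (regime_gcd pq). Qed.

Definition deviation_scale n : R := scale_L X mu alpha n * n%:R `^ alpha^-1.

Let finite_variance_case : (var X < +oo)%E ->
  (forall n, deviation_scale n = 0) \/ exists y C, [/\ 0 < C,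
    upward_spread p mu y &
    exists n0, forall n, (n0 <= n)%N -> 0 <= deviation_scale n <= C * y n].
Proof.
move=> vfin; have [B hB] := (var_finP Xp pmu).1 vfin.
have a2 : alpha = 2.
  case: cases => [[a [pa a2 ->]]|[_ ->]//].
  suff : 2 <= a - 1 by move=> ?; apply/min_idPr.
  rewrite leNgt; apply/negP => a3.
  have a03 : 0 < a < 3 by apply/andP; split; lra.
  by have [M] := regvar_moment2_unbounded p0 pa a03 B; rewrite ltNge hB.
have t0 j : 0 <= p j * (j%:R - mu) ^+ 2 by rewrite mulr_ge0// sqr_ge0.
have vE := varE Xp pmu; rewrite vE in vfin.
have vs := eseries_fin (fun j _ => t0 j) vfin.
set s := fine _ in vs.
have s0 : 0 <= s by apply: fine_ge0; apply: nneseries_ge0 => j _ _; rewrite lee_fin.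
have ds n : deviation_scale n =
    mu `^ (- 1 - alpha^-1) * Num.sqrt (s / 2) * Num.sqrt n%:R.
  rewrite /deviation_scale /scale_L /scale_g vE vfin -/s.
  by rewrite {2}a2 powR12_sqrt.
have [s00|sn0] := eqVneq s 0.
  by left=> n; rewrite ds s00 mul0r sqrtr0 mulr0 mul0r.
have {sn0}s0 : 0 < s by rewrite lt_neqAle eq_sym sn0.
right; exists (fun n => Num.sqrt n%:R), (mu `^ (- 1 - alpha^-1) * Num.sqrt (s / 2)).
have C0 : 0 < mu `^ (- 1 - alpha^-1) * Num.sqrt (s / 2).
  by rewrite mulr_gt0 ?powR_gt0// sqrtr_gt0 divr_gt0.
split=> //; first exact: (spread_finite_variance p0 p1 pmu mu0 hB (eseries_cvg t0 vs)).
by exists 0 => n _; rewrite ds lexx mulr_ge0 ?sqrtr_ge0// ltW.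
Qed.

Let moment2_unbounded : ~~ (var X < +oo)%E -> forall B, exists M, B < moment2 p M.
Proof.
move=> /negP vinf B; apply: contrapT => /forallNP h; apply: vinf.
by apply/(var_finP Xp pmu); exists B => M; rewrite leNgt; apply/negP; exact: h.
Qed.

Let infinite_variance_case : ~~ (var X < +oo)%E -> exists y C, [/\ 0 < C,
  upward_spread p mu y &
  exists n0, forall n, (n0 <= n)%N -> 0 <= deviation_scale n <= C * y n].
Proof.
move=> vinf; have pun := moment2_unbounded vinf.
have [a [pa a2 aE]] : exists a, [/\ regvar p a, 2 < a & alpha = Num.min (a - 1) 2].
  case: cases => // -[[B hB] _]; have [M] := pun B; by rewrite ltNge hB.
have a3 : a <= 3.
  rewrite leNgt; apply/negP => a3; have a21 : 2 + 1 < a by lra.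
  have [C C0 hC] := regvar_moment_summable pa a21.
  have [M] := pun C; apply/negP; rewrite -leNgt /moment2.
  case: M => [|M]; first by rewrite big_geq// ltW.
  rewrite big_ltn// expr0n mulr0 add0r; apply: le_trans (hC M.+1).
  by apply: ler_sum_nat => j _; rewrite -powR_mulrn.
pose c := mu `^ (- 1 - alpha^-1).
have c0 : 0 < c by rewrite powR_gt0.
have [al2|al2] := eqVneq alpha 2.
  have {}a3 : a = 3.
    apply/eqP; rewrite eq_le a3 leNgt; apply/negP => a3'.
    by move: aE; rewrite al2 min_l; lra.
  rewrite a3 in pa.
  pose y := variance_threshold p.
  have yP (x0 : R) : 0 < x0 -> 0 < moment2_upto p x0 ->
      exists n0, forall n, (n0 <= n)%N ->
      [/\ (0 < n)%N, x0 <= y n & n%:R * moment2_upto p (y n) = y n ^+ 2].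
    move=> x00 T0; have [n0 hn] := exists_natr_ge (x0 ^+ 2 / moment2_upto p x0).
    exists n0.+1 => n nn; have n1 : (0 < n)%N by exact: leq_trans nn.
    have h : x0 ^+ 2 <= n%:R * moment2_upto p x0.
      by rewrite -ler_pdivrMr//; apply: le_trans hn _; rewrite ler_nat ltnW.
    by have [? ?] := variance_thresholdE p0 pmu n1 x00 h.
  have Tpos : exists2 x0, 0 < x0 & forall x, x0 <= x -> 0 < moment2_upto p x.
    have [M hM] := pun 0; exists M.+1%:R => [|x xM]; first by rewrite ltr0n.
    apply: lt_le_trans hM _; apply: (moment2_le p0).
    apply: leqW; rewrite truncn_ge_nat ?(le_trans _ xM)//.
    by rewrite ler_nat.
  have [x0 x00 Tx] := Tpos.
  have yoo : unbounded y.
    move=> B; have m0 : 0 < Num.max x0 B by rewrite lt_max x00.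
    have mx : x0 <= Num.max x0 B by rewrite le_max lexx.
    have [n0 h] := yP _ m0 (Tx _ mx).
    exists n0 => n /h[_ + _]; apply: le_trans; rewrite le_max lexx orbT//.
  have [n0 hn0] := yP _ x00 (Tx _ (lexx _)).
  exists y, (c * Num.sqrt 2^-1); split.
  - by rewrite mulr_gt0// sqrtr_gt0 invr_gt0.
  - apply: (spread_borderline p0 p1 pmu mu0 pa pun yoo).
    by exists n0 => n /hn0[].
  exists n0 => n /hn0[n1 xy yE].
  have y0 : 0 <= y n by apply: le_trans (ltW x00) xy.
  have E : deviation_scale n = c * Num.sqrt 2^-1 * y n.
    rewrite /deviation_scale /scale_L /scale_g (negbTE vinf) al2 eqxx.
    have -> : sup [set x | 0 <= x /\ n%:R^-1 <= trunc_moment2 X x / x ^+ 2] = y n.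
      rewrite /y /variance_threshold; congr sup; apply/seteqP.
      by split=> x /= [x1]; rewrite (trunc_moment2E Xp).
    rewrite (trunc_moment2E Xp)// powR12_sqrt// /c al2.
    rewrite -!mulrA -!sqrtrM ?invr_ge0//; last first.
      by rewrite mulr_ge0 ?invr_ge0// moment2_upto_ge0.
    by rewrite -mulrA [_ * n%:R]mulrC yE sqrtrM ?invr_ge0// sqrtr_sqr ger0_norm.
  by rewrite E lexx andbT !mulr_ge0 ?sqrtr_ge0// ltW.
have {}a3 : a < 3.
  rewrite lt_neqAle a3 andbT; apply/eqP => a3E; move: al2.
  by rewrite aE a3E min_r ?eqxx//; lra.
have pj j : (0 < j)%N -> 0 < p j by exact: regvar_gt0 pa.
have yoo := tail_threshold_unbounded p0 p1 pj.
pose y := tail_threshold p; pose d := `|Gamma (1 - alpha)| `^ alpha^-1.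
have d0 : 0 <= d by exact: powR_ge0.
exists y, (c * d + 1); split.
- by rewrite ltr_wpDl// mulr_ge0// ltW.
- apply: (@spread_heavy_tail _ p mu p0 p1 pmu mu0 a) => //; first by rewrite a2.
  by exists 1%N => n n1; have [_ ? ?] := tail_thresholdP p1 n1.
exists 1%N => n n1; have [y0 _ _] := tail_thresholdP p1 n1.
have E : deviation_scale n = c * d * y n.
  rewrite /deviation_scale /scale_L /scale_g (negbTE vinf) (negbTE al2).
  have -> : inf [set x | 0 <= x /\
      (P [set omega | (x < (X omega)%:R)%R] <= (n%:R^-1)%:E)%E] = y n.
    rewrite /y /tail_threshold; congr inf; apply/seteqP.
    by split=> x /= [x1]; rewrite (probability_gt Xp)// lee_fin.
  have nr : 0 < (n%:R : R) `^ alpha^-1 by rewrite powR_gt0// ltr0n.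
  rewrite powRN /c /d; field; exact: lt0r_neq0.
by rewrite E !mulr_ge0 ?(ltW c0)//= mulrDl mul1r lerDl.
Qed.

(** In each of the three cases the normalising sequence is, up to a constant, a
    sequence that the fluctuations of the partial sums reach. *)
Lemma deviation_scale_spread :
  (forall n, deviation_scale n = 0) \/ exists y C, [/\ 0 < C,
    upward_spread p mu y &
    exists n0, forall n, (n0 <= n)%N -> 0 <= deviation_scale n <= C * y n].
Proof.
by case: (boolP (var X < +oo)%E) => [/finite_variance_case|/infinite_variance_case];
   [|right].
Qed.

Lemma gap_over_scale (s : nat -> nat) : (forall n, (0 < n)%N -> (0 < s n)%N) ->
  (forall y, upward_spread p mu y -> forall C, 0 < C ->
     exists n0, forall n, (n0 <= n)%N -> C * y n < (s n)%:R) ->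
  (((s n)%:R)%:E / (deviation_scale n)%:E)%E @[n --> \oo] --> +oo%E.
Proof.
move=> s0 sy; apply/cvgeyPge => A.
have zero n : (0 < n)%N -> deviation_scale n = 0 ->
    (A%:E <= ((s n)%:R)%:E / (deviation_scale n)%:E)%E.
  move=> n0 ->; rewrite inver eqxx gt0_muley ?leey//.
  by rewrite lte_fin ltr0n s0.
case: deviation_scale_spread => [dz|[y [C [C0 yS [n0 hn]]]]].
  by exists 1%N => // n n1; exact: zero.
have AC : 0 < (`|A| + 1) * C by rewrite mulr_gt0// ltr_wpDl.
have [n1 h1] := sy y yS _ AC.
exists (maxn (maxn n0 n1) 1) => // n /=; rewrite !geq_max.
move=> /andP[/andP[/hn/andP[d0 dy] /h1 nn1] n2].
have [dz|dz] := eqVneq (deviation_scale n) 0; first exact: zero.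
have {}d0 : 0 < deviation_scale n by rewrite lt_neqAle eq_sym dz.
rewrite inver (negbTE dz) lee_fin ler_pdivlMr//.
apply: le_trans (ltW nn1); rewrite -mulrA.
apply: le_trans (_ : (`|A| + 1) * deviation_scale n <= _).
  by apply: ler_wpM2r; [exact: ltW|have := ler_norm A; lra].
by apply: ler_wpM2l => //; rewrite addr_ge0.
Qed.

End ScaleOfFluctuations.

Section GibbsLimit.
Context {R : realType}.

Lemma cvg0_of_near (f : nat -> R) : (forall n, 0 <= f n) ->
  (forall e : R, 0 < e -> exists n0, forall n, (n0 <= n)%N -> f n <= e) ->
  f n @[n --> \oo] --> (0 : R).
Proof.
move=> f0 fe; apply/cvgrPdist_le => e e0; have [n0 h] := fe e e0.
by exists n0 => // n /= nn; rewrite sub0r normrN ger0_norm// h.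
Qed.

Lemma dTV_ge0 d (T : measurableType d) (f g : set T -> \bar R) :
  (0 <= dTV f g)%E.
Proof.
apply: le_trans (_ : `|f set0 - g set0| <= _)%E; first exact: abse_ge0.
by apply: ereal_sup_ubound; exists set0.
Qed.

Section GapSufficient.
Variables (p : nat -> R).
Hypothesis p0 : forall j, 0 <= p j.

Let ratio_ge0 (s : nat -> nat) n : 0 <= n%:R * moment2 p n / (s n)%:R ^+ 2 :> R.
Proof. by rewrite divr_ge0 ?exprn_ge0// mulr_ge0// moment2_ge0. Qed.

Lemma gap_bounded_variance (B kappa : R) (s : nat -> nat) :
  (forall M, moment2 p M <= B) -> 2^-1 <= kappa ->
  (s n)%:R / n%:R `^ kappa @[n --> \oo] --> (+oo : set_system R) ->
  n%:R * moment2 p n / (s n)%:R ^+ 2 @[n --> \oo] --> (0 : R).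
Proof.
move=> hB k2 /cvgryPge sk; apply: cvg0_of_near => // e e0.
have B0 : 0 <= B by apply: le_trans (hB 0); rewrite /moment2 big_geq.
have [n0 _ h] := sk (Num.sqrt (B / e) + 1).
exists (maxn n0 1) => n; rewrite geq_max => /andP[/h /= hn n1].
have nr : 0 < (n%:R : R) by rewrite ltr0n.
have A0 : 0 < Num.sqrt (B / e) + 1 by rewrite ltr_wpDl// sqrtr_ge0.
have nk : 0 < (n%:R : R) `^ kappa by rewrite powR_gt0.
have sn : (Num.sqrt (B / e) + 1) * Num.sqrt n%:R <= (s n)%:R.
  rewrite ler_pdivlMr// in hn; apply: le_trans hn; apply: ler_wpM2l.
    exact: ltW.
  by rewrite -powR12_sqrt// ler_powR// ler1n.
have q0 : 0 < (Num.sqrt (B / e) + 1) * Num.sqrt n%:R.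
  by rewrite mulr_gt0// sqrtr_gt0.
have s2 : B / e * n%:R <= (s n)%:R ^+ 2.
  apply: le_trans (_ : ((Num.sqrt (B / e) + 1) * Num.sqrt n%:R) ^+ 2 <= _).
    rewrite exprMn sqr_sqrtr// ler_pM2r//.
    rewrite -[leLHS]sqr_sqrtr ?divr_ge0 ?(ltW e0)//.
    by apply: lerXn2r; rewrite ?nnegrE ?lerDl ?sqrtr_ge0 ?(ltW A0).
  by apply: lerXn2r; rewrite ?nnegrE// ltW.
have sp : 0 < (s n)%:R ^+ 2 :> R by rewrite exprn_gt0// (lt_le_trans q0).
rewrite ler_pdivrMr//; apply: le_trans (_ : n%:R * B <= _).
  by apply: ler_wpM2l.
have := ler_wpM2l (ltW e0) s2; apply: le_trans; apply: eq_ler.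
by field; exact: lt0r_neq0.
Qed.

Lemma gap_exists (eta C2 : R) : 0 < eta <= 1 ->
  (forall M, (0 < M)%N -> moment2 p M <= C2 * (M%:R : R) `^ (1 - eta)) ->
  exists s : nat -> nat, pos_little_o (R := R) s /\
    n%:R * moment2 p n / (s n)%:R ^+ 2 @[n --> \oo] --> (0 : R).
Proof.
move=> /andP[eta0 eta1] hM.
(* [n * n ^ (1 - eta) / n ^ (2 * k) = n ^ (- eta / 2)] *)
pose k := 1 - eta / 4.
exists (fun n => (Num.truncn ((n%:R : R) `^ k)).+1); split; first split=> //.
  apply: cvg0_of_near => [n|e e0]; first by rewrite divr_ge0.
  have e2 : 0 < e / 2 by rewrite divr_gt0.
  have eta4 : 0 < eta / 4 by rewrite divr_gt0.
  have [n1 n10 h1] := powR_vanish eta4 e2.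
  have [n2 n20 h2] := powR_vanish (@ltr01 R) e2.
  exists (maxn n1 n2) => n; rewrite geq_max => /andP[nn1 nn2].
  have n0 : (0 < n)%N by exact: leq_trans nn1.
  have nr : 0 < (n%:R : R) by rewrite ltr0n.
  have nk : (n%:R : R) `^ k = n%:R * n%:R `^ (- (eta / 4)).
    rewrite -{2}[n%:R]powRr1 ?(ltW nr)// -powRD//.
    by rewrite (gt_eqF nr)/= implybT.
  have h3 : (Num.truncn ((n%:R : R) `^ k))%:R <= (n%:R : R) `^ k.
    by rewrite truncn_le powR_ge0.
  rewrite ler_pdivrMr// -[_.+1%:R]natr1.
  have h4 := h1 n nn1; have h5 := h2 n nn2.
  rewrite powR_inv1 ?(ltW nr)// in h5.
  have h6 : 1 <= e / 2 * n%:R by rewrite -ler_pdivrMr// mul1r.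
  have h7 := ler_wpM2l (ltW nr) h4; rewrite -nk in h7.
  lra.
apply: cvg0_of_near => [n|e e0]; first exact: (ratio_ge0 (fun n => _)).
have C0 : 0 < `|C2| + 1 by rewrite ltr_wpDl.
have eC : 0 < e / (`|C2| + 1) by rewrite divr_gt0.
have eta2 : 0 < eta / 2 by rewrite divr_gt0.
have [n1 n10 h1] := powR_vanish eta2 eC.
exists n1 => n nn; have n0 : (0 < n)%N by exact: leq_trans nn.
have nr : 0 < (n%:R : R) by rewrite ltr0n.
have nk0 : 0 < (n%:R : R) `^ k by rewrite powR_gt0.
set s := (Num.truncn _).+1.
have sk : (n%:R : R) `^ k <= s%:R by exact: ltW (truncnS_gt _).
have s2 : ((n%:R : R) `^ k) ^+ 2 <= s%:R ^+ 2.
  by apply: lerXn2r; rewrite ?nnegrE// ltW.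
have s20 : 0 < s%:R ^+ 2 :> R by rewrite exprn_gt0// ltr0n.
rewrite ler_pdivrMr//.
apply: le_trans (_ : n%:R * ((`|C2| + 1) * n%:R `^ (1 - eta)) <= _).
  apply: ler_wpM2l => //; apply: le_trans (hM n n0) _.
  by apply: ler_wpM2r; [exact: powR_ge0|have := ler_norm C2; lra].
apply: le_trans (ler_wpM2l (ltW e0) s2).
have h2 := h1 n nn; rewrite ler_pdivlMr// in h2.
have nE : n%:R * n%:R `^ (1 - eta) = ((n%:R : R) `^ k) ^+ 2 * n%:R `^ (- (eta / 2)).
  rewrite -{1}[n%:R]powRr1 ?(ltW nr)// -powR_mulrn ?powR_ge0// -powRrM.
  rewrite -!powRD ?(gt_eqF nr) ?implybT//.
  by congr (_ `^ _); rewrite /k; field.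
rewrite mulrCA nE mulrC -mulrA [leRHS]mulrC; apply: ler_wpM2l.
  by rewrite exprn_ge0// ltW.
exact: h2.
Qed.

End GapSufficient.
End GibbsLimit.

(** * The limit theorem *)

Section TotalVariationLimit.
Context {R : realType}.
Variables (v w : nat -> R) (rho_v rho mu b eta C2 : R).
Hypotheses (rv0 : 0 < rho_v) (r0 : 0 < rho) (w0 : forall j, 0 <= w j).
Hypothesis hW : series (fun j => w j * rho ^+ j) @ \oo --> rho_v.
Hypothesis hu : forall n, (gibbs_u v w n < +oo)%E.
Hypothesis rg : regime (tilted_w w rho_v rho) (tilted_v v rho_v) mu b eta C2.
Context dO (Omega : measurableType dO) (P : probability Omega R).
Variables (X : {RV P >-> nat}) (Xs : nat -> {RV P >-> nat}).
Hypotheses (hX : has_gibbs_pgf v w X)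
  (hXs_law : forall i (A : set nat), P (Xs i @^-1` A) = P (X @^-1` A))
  (hXs_indep : mutually_independent Xs).
Context (dK : nat -> measure_display) (OmegaK : forall n, measurableType (dK n))
  (PK : forall n, probability (OmegaK n) R).
Variable K : forall n, {RV (PK n) >-> seq nat}.
Hypothesis hK : forall n, (0 < n)%N -> (0 < gibbs_u v w n)%E ->
  is_gibbs_sizes v w n (K n).

Local Notation p := (tilted_w w rho_v rho).
Local Notation q := (tilted_v v rho_v).

Let p0 := regime_ge0 rg.
Let p1 := regime_sum1 rg.
Let pmu := regime_mean rg.
Let qb := regime_regvar rg.
Let q0 := tilted_v_ge0 qb.
Let b1 := regime_b rg.
Let atom := positive_atom (regime_gcd rg).

Lemma gibbs_mu_regime : gibbs_mu v w = mu.
Proof. exact: (gibbs_mu_tilted rv0 r0 w0 hW hu b1 qb atom pmu). Qed.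

Lemma pmf_regime : pmf_of X =1 p.
Proof. exact: (tilted_pmf rv0 r0 w0 hW hu b1 qb atom hX). Qed.

Let Xs_point i j : P (Xs i @^-1` [set j]) = (p j)%:E.
Proof. by rewrite hXs_law pmf_ofE pmf_regime. Qed.

Let uE n := tilted_uE rv0 r0 w0 hu qb n.

Let u_gt0 n : (0 < gibbs_u v w n)%E -> 0 < tilted_u v w rho n.
Proof. exact: (tilted_u_gt0 r0 hu n).1. Qed.

Let sizes_law n : (0 < n)%N -> (0 < gibbs_u v w n)%E ->
  forall x, (0 < size x)%N -> sumn x = n ->
  PK n (K n @^-1` [set x]) =
  (q (size x) * (\prod_(y <- x) p y) / tilted_u v w rho n)%:E.
Proof. by move=> n0 un; apply: tilted_gibbs_sizes => //; exact: hK. Qed.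

(** The local estimate applies with probability tending to one; this bounds the
    law of the prefix from below by that of the copies. *)
Theorem gibbs_tv_limit_of_gap (s : nat -> nat) : pos_little_o (R := R) s ->
  n%:R * moment2 p n / (s n)%:R ^+ 2 @[n --> \oo] --> (0 : R) ->
  gibbs_tv_limit v w Xs K s.
Proof.
move=> [s0 sn] sT; rewrite /gibbs_tv_limit gibbs_mu_regime.
have win := gap_window p0 p1 pmu (regime_gcd rg) s0 sn (regime_eta rg)
  (regime_moment2 rg) b1 qb (regime_one_jump rg) sT.
have bound (e : R) : 0 < e -> exists n0, forall n, (n0 <= n)%N ->
    (0 < gibbs_u v w n)%E ->
    (dTV (pushforward (PK n) (fun o => take (Num.truncn (n%:R / mu) - s n) (K n o)))
         (pushforward P (fun o => mkseq (fun i => Xs i o)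
            (Num.truncn (n%:R / mu) - s n))) <= e%:E)%E.
  move=> e0; have e2 : 0 < e / 2 by rewrite divr_gt0.
  have [n0 h] := win _ e2; exists n0.+1 => n nn un.
  have [lo [hi [m0 hin hr hs]]] := h n (ltnW nn).
  have n1 : (0 < n)%N by exact: leq_trans nn.
  rewrite (_ : e = 2 * (e / 2)); last by field.
  apply: (gibbs_tv_le p0 (fun k _ => q0 k) (u_gt0 un) (uE n)
    (sizes_law n1 un) Xs_point hXs_indep m0 (ltW e2) hin hr hs).
apply/fine_cvgP; split.
  rewrite near_withinE; have [n0 h] := bound 1 ltr01.
  exists n0 => // n /= nn un; rewrite ge0_fin_numE ?dTV_ge0//.
  exact: le_lt_trans (h n nn un) (ltry 1).
apply/cvgrPdist_le => e e0; rewrite near_withinE; have [n0 h] := bound e e0.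
exists n0 => // n /= nn un; rewrite sub0r normrN ger0_norm; last first.
  by apply: fine_ge0; exact: dTV_ge0.
rewrite -lee_fin fineK; first exact: h.
by rewrite ge0_fin_numE ?dTV_ge0//; exact: le_lt_trans (h n nn un) (ltry e).
Qed.

(** A prefix of the component sizes never has a sum larger than [n], so the
    total variation distance bounds the probability that the independent copies
    have one. *)
Lemma overshoot_vanishes (s : nat -> nat) : gibbs_tv_limit v w Xs K s ->
  forall e : R, 0 < e -> exists n0, forall n, (n0 <= n)%N ->
  1 - \sum_(0 <= t < n.+1) conv p (Num.truncn (n%:R / mu) - s n) t <= e.
Proof.
rewrite /gibbs_tv_limit gibbs_mu_regime => /fine_cvgP[].
rewrite near_withinE => -[n1 _ h1] /cvgrPdist_le h e e0.
have := h e e0; rewrite near_withinE => -[n2 _ h2].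
have [n3 h3] := partition_weight_gt0 p0 p1 pmu (regime_gcd rg) qb.
exists (maxn (maxn n1 n2) (maxn n3 1)) => n; rewrite !geq_max.
move=> /andP[/andP[nn1 nn2] /andP[nn3 n0]].
have un : (0 < gibbs_u v w n)%E.
  apply/(tilted_u_gt0 r0 hu n); have [k [k0 qk]] := h3 n nn3.
  apply: lt_le_trans qk _; have := tilted_u_ge rv0 r0 w0 hu qb n k.+1.
  apply: le_trans; rewrite big_nat_recr//= lerDr big_nat sumr_ge0// => i _.
  by rewrite mulr_ge0 ?conv_ge0.
have := h2 n nn2 un; rewrite sub0r normrN => /(le_trans (ler_norm _)).
apply: le_trans; rewrite -lee_fin fineK; last exact: h1.
exact: (gibbs_tv_ge p0 (fun k _ => q0 k) (u_gt0 un) (uE n)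
    (sizes_law n0 un) Xs_point hXs_indep).
Qed.

End TotalVariationLimit.

Theorem lemma3p5 (R : realType) (v w : R^nat)
  (hv : forall i, (0 < i)%N -> 0 <= v i)
  (hw : forall i, 0 <= w i)
  (hu : forall n, (gibbs_u v w n < +oo)%E)
  (rho_v b alpha : R) (L_v : R -> R)
  (hrho_v : conv_radius v = rho_v%:E)
  (rho_v_gt0 : 0 < rho_v)
  (hL_v : slowly_varying L_v)
  (hb : 1 < b)
  (hvn : regularly_decaying v L_v b rho_v)
  (hcases :
    (exists (rho_w a : R) (L_w : R -> R),
       [/\ [/\ conv_radius w = rho_w%:E, 0 < rho_w
             & rho_v%:E = psum w (conv_radius w)],
           [/\ slowly_varying L_w, 2 < a & regularly_decaying w L_w a rho_w],
           b < a \/ b = a /\ L_w n%:R / L_v n%:R @[n --> \oo] --> (0 : R)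
         & alpha = Num.min (a - 1) 2])
    \/
    [/\ (rho_v%:E < psum w (conv_radius w))%E,
        is_gcd [set n | 0 < w n] 1
      & alpha = 2])
  (dO : measure_display) (Omega : measurableType dO) (P : probability Omega R)
  (X : {RV P >-> nat})
  (hX : has_gibbs_pgf v w X)
  (Xs : nat -> {RV P >-> nat})
  (hXs_law : forall i (A : set nat), P (Xs i @^-1` A) = P (X @^-1` A))
  (hXs_indep : mutually_independent Xs)
  (dK : nat -> measure_display) (OmegaK : forall n, measurableType (dK n))
  (PK : forall n, probability (OmegaK n) R)
  (K : forall n, {RV (PK n) >-> seq nat})
  (hK : forall n, (0 < n)%N -> (0 < gibbs_u v w n)%E ->
    is_gibbs_sizes v w n (K n)) :
  [/\ exists s : nat -> nat,
        pos_little_o (R := R) s /\ gibbs_tv_limit v w Xs K s,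
      forall s : nat -> nat,
        pos_little_o (R := R) s -> gibbs_tv_limit v w Xs K s ->
        (((s n)%:R)%:E /
          (scale_L X (gibbs_mu v w) alpha n * n%:R `^ alpha^-1)%:E)%E
          @[n --> \oo] --> +oo%E,
      ((moment X 3 < +oo)%E \/
       (moment X 2 < +oo)%E /\
       (exists C : R, \forall n \near \oo,
          (tail_moment2 X n <= (C * n%:R `^ (- (1 / 3)))%:E)%E)) ->
      forall s : nat -> nat, pos_little_o (R := R) s ->
        (s n)%:R / n%:R `^ (3 / 4) @[n --> \oo] --> (+oo : set_system R) ->
        gibbs_tv_limit v w Xs K s
    & forall r : R, 0 < r < 1 / 3 ->
      (moment X 2 < +oo)%E ->
      (exists C : R, \forall n \near \oo,
          (tail_moment2 X n <= (C * n%:R `^ (- r))%:E)%E) ->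
      forall s : nat -> nat, pos_little_o (R := R) s ->
        (s n)%:R / n%:R `^ (1 / (1 + r)) @[n --> \oo] --> (+oo : set_system R) ->
        gibbs_tv_limit v w Xs K s].
Proof.
(* both cases are reduced to one set of properties of the tilted sequences *)
have regimes : exists (rho mu eta C2 : R), [/\ 0 < rho,
    series (fun j => w j * rho ^+ j) @ \oo --> rho_v,
    regime (tilted_w w rho_v rho) (tilted_v v rho_v) mu b eta C2
  & (exists a, [/\ regvar (tilted_w w rho_v rho) a, 2 < a
       & alpha = Num.min (a - 1) 2]) \/
    (exists B, forall M, moment2 (tilted_w w rho_v rho) M <= B) /\ alpha = 2].
  case: hcases => [[rho_w [a [L_w [[cw rw0 rvE] [sw a2 wE] ab al]]]]|[rvE wg al]].
    have [mu [eta [C2 [hW pa rg]]]] := critical_regime hw rho_v_gt0 hL_v hb hvn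
      cw rw0 rvE sw a2 wE ab.
    by exists rho_w, mu, eta, C2; split=> //; left; exists a.
  have [rho [mu [C2 [r0 hW rg]]]] :=
    subcritical_regime hw hu rho_v_gt0 hL_v hb hvn rvE wg.
  exists rho, mu, 1, C2; split=> //; right; split=> //; exists (`|C2| + 1) => M.
  have [->|M0] := posnP M; first by rewrite /moment2 big_geq// addr_ge0.
  have := regime_moment2 rg M0; rewrite subrr powRr0 mulr1 => /le_trans; apply.
  by have := ler_norm C2; lra.
have [rho [mu [eta [C2 [r0 hW rg cases]]]]] := regimes.
have p0 := regime_ge0 rg; have pmu := regime_mean rg.
have Xp := pmf_regime rho_v_gt0 r0 hw hW hu rg hX.
have muE := gibbs_mu_regime rho_v_gt0 r0 hw hW hu rg.
have tv := gibbs_tv_limit_of_gap rho_v_gt0 r0 hw hW hu rg hX hXs_law hXs_indep hK.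
split.
- have [s [s0 sT]] := gap_exists p0 (regime_eta rg) (regime_moment2 rg).
  by exists s; split=> //; exact: tv.
- move=> s [s0 sn] stv; rewrite muE.
  have over := overshoot_vanishes rho_v_gt0 r0 hw hW hu rg hX hXs_law hXs_indep hK stv.
  apply: (gap_over_scale Xp rg cases s0) => y yS.
  exact: (gap_exceeds_spread p0 pmu (regime_gcd rg) s0 sn yS over).
- move=> mom s so sk; apply: tv => //.
  have [B hB] : exists B, forall M, moment2 (tilted_w w rho_v rho) M <= B.
    by case: mom => [|[+ _]]; exact: (moment2_bounded_of_moment Xp).
  by apply: (gap_bounded_variance p0 hB _ sk); lra.
- move=> r /andP[r_gt0 r_lt] mom _ s so sk; apply: tv => //.
  have [B hB] := moment2_bounded_of_moment Xp (isT : (1 < 2)%N) mom.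
  apply: (gap_bounded_variance p0 hB _ sk).
  by rewrite div1r lef_pV2 ?posrE//; lra.
Qed.
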